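(* Let $\mu,\nu\in\mathcal P_2(\mathbb R^d)$ with $\mu$ dominated by $\nu$ in convex order. Assume: (H1) $\int e^{q|y|}\,\nu(dy)<\infty$ for all $q\in\mathbb R_+$; (H2) $\nu$ is not concentrated on any (affine) hyperplane; (H3) the problem (D) has finite value and is attained by a $\nu$-integrable map $\psi$ such that there exists $(a,b)\in\mathbb R_+^2$ with $|\psi(y)|\le a+b|y|$ for $\nu$-a.e. $y$; (H4) for $\mu$-a.e. $x$, the problem $\sup_{h\in\mathbb R^d}\{h\cdot x-\log\int e^{\psi(y)+h\cdot y}\nu(dy)\}$ admits a unique solution, denoted $h(x)$. Define $\bar\mu=h_\#\mu$; $\ \bar\varphi(\bar x)=-\log\int e^{\psi(y)+\bar x\cdot y}\,\nu(dy)$; $\ m(dx,dy)=\mu(dx)m_x(dy)$ with $$\frac{dm_x}{d\nu}(y)=\frac{e^{h(x)\cdot y+\psi(y)}}{\int e^{h(x)\cdot\tilde y+\psi(\tilde y)}\,\nu(d\tilde y)};$$ and $\pi$ by $\frac{d\pi}{d\bar\mu\otimes\nu}(\bar x,y)=\exp\big(\bar\varphi(\bar x)+\psi(y)+\bar x\cdot y\big)$. Then: (1) $\bar\mu$ solves (VP), $\pi$ solves $SP(\bar\mu,\nu)$, and $(\bar\varphi,\psi)$ are the corresponding Schrödinger potentials associated to $(\bar\mu,\nu)$; (2) $m$ solves (P).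
   Context: $\mathcal P_2(\mathbb R^d)$: Borel probability measures on $\mathbb R^d$ with finite second moment. Convex order: $\int\phi\,d\mu\le\int\phi\,d\nu$ for all convex $\phi:\mathbb R^d\to\mathbb R$. $\mathsf{Cpl}(\alpha,\beta)$: couplings with first marginal $\alpha$ and second marginal $\beta$. $\mathsf{MT}(\mu,\nu)$: couplings $m(dx,dy)=\mu(dx)m_x(dy)\in\mathsf{Cpl}(\mu,\nu)$ with $\int y\,m_x(dy)=x$ for $\mu$-a.e. $x$. $H(Q\mid R)=\int\log\frac{dQ}{dR}\,dQ$ if $Q\ll R$, $+\infty$ otherwise. $\mathrm{MCov}(\bar\mu,\mu)=\sup_{\pi\in\mathsf{Cpl}(\bar\mu,\mu)}\int\bar x\cdot x\,\pi(d\bar x,dx)$. Problems (''solves''/''attains'' means being an optimizer): (P) $\ \inf_{m\in\mathsf{MT}(\mu,\nu)}H(m\mid\mu\otimes\nu)$. (D) $\ \sup_{\psi\in C_b(\mathbb R^d)}\mathcal D(\psi)$, where $\mathcal D(\psi)=\int\psi\,d\nu+\int\sup_{h\in\mathbb R^d}\big[h\cdot x-\log\int e^{h\cdot y+\psi(y)}\nu(dy)\big]\mu(dx)$. ''Attained by $\psi$'' means that $\mathcal D(\psi)$ equals the value of (D) ($\psi$ need not be bounded or continuous). $SP(\bar\mu,\nu)$: $\ \inf_{\pi\in\mathsf{Cpl}(\bar\mu,\nu)}\big[H(\pi\mid\bar\mu\otimes\nu)-\int\bar x\cdot y\,\pi(d\bar x,dy)\big]$. (VP) $\ \sup_{\bar\mu\in\mathcal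 P_2(\mathbb R^d)}\{SP(\bar\mu,\nu)+\mathrm{MCov}(\bar\mu,\mu)\}$, where $SP(\bar\mu,\nu)$ here denotes the value of that problem. Schrödinger potentials associated to $(\bar\mu,\nu)$: functions $(\bar\varphi,\psi)$ such that the minimizer $\pi$ of $SP(\bar\mu,\nu)$ satisfies $\frac{d\pi}{d\bar\mu\otimes\nu}(\bar x,y)=e^{\bar\varphi(\bar x)+\psi(y)+\bar x\cdot y}$, equivalently solving $\int e^{\bar\varphi(\bar x)+\psi(y)+\bar x\cdot y}\nu(dy)=1$ for $\bar\mu$-a.e. $\bar x$ and $\int e^{\bar\varphi(\bar x)+\psi(y)+\bar x\cdot y}\bar\mu(d\bar x)=1$ for $\nu$-a.e. $y$; they are unique up to $(\bar\varphi+c,\psi-c)$, $c\in\mathbb R$.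
   Formalization: In (1), the claims that μ̄ solves (VP), π solves SP(μ̄,ν) and (φ̄,ψ) give the density of its minimizer are proved when μ̄ has finite second moment; this can fail under (H1)–(H4), and then μ̄ is not admissible in (VP). The Schrödinger system and (2) hold without it. *)

(* Defs.v *)
From HB Require Import structures.
From mathcomp Require Import all_boot all_order all_algebra.
From mathcomp Require Import all_classical all_reals all_analysis.

Set Implicit Arguments.
Unset Strict Implicit.
Unset Printing Implicit Defensive.
Import Order.TTheory GRing.Theory Num.Theory.
Import numFieldNormedType.Exports.

Local Open Scope classical_set_scope.
Local Open Scope ring_scope.
Local Open Scope charge_scope.
Local Open Scope ereal_scope.

(* Row vectors carry the Borel sigma-algebra of their normed topology. *)
HB.instance Definition _ (R : realType) (n : nat) :=
  @isMeasurable.Build (sigma_display (@open 'rV[R]_n)) 'rV[R]_n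
    <<s @open 'rV[R]_n >> (@sigma_algebra0 _ setT _) (@sigma_algebraC _ _)
    (@sigma_algebra_bigcup _ setT _).

Definition dotp (R : realType) (n : nat) (x y : 'rV[R]_n) : R :=
  (\sum_(i < n) x ord0 i * y ord0 i)%R.

(* The library norm on 'rV[R]_n is the sup norm. *)
Definition enorm (R : realType) (n : nat) (x : 'rV[R]_n) : R :=
  Num.sqrt (dotp x x).

Definition finite_second_moment (R : realType) (n : nat)
    (mu : probability 'rV[R]_n R) : Prop :=
  \int[mu]_x (enorm x ^+ 2)%:E < +oo.

Definition convex_order (R : realType) (n : nat)
    (mu nu : probability 'rV[R]_n R) : Prop :=
  forall phi : 'rV[R]_n -> R, @convex_function R 'rV[R]_n setT phi ->
    \int[mu]_x (phi x)%:E <= \int[nu]_y (phi y)%:E.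

Definition concentrated_on (R : realType) (n : nat)
    (nu : probability 'rV[R]_n R) (A : set 'rV[R]_n) : Prop :=
  {ae nu, forall y, A y}.

Definition hyperplane (R : realType) (n : nat) (a : 'rV[R]_n) (c : R) :
    set 'rV[R]_n :=
  [set y | dotp a y = c].

Definition is_minimizer (R : realType) (T : Type) (S : set T)
    (f : T -> \bar R) (x : T) : Prop :=
  S x /\ forall y, S y -> f x <= f y.

Definition is_maximizer (R : realType) (T : Type) (S : set T)
    (f : T -> \bar R) (x : T) : Prop :=
  S x /\ forall y, S y -> f y <= f x.

Definition coupling d1 d2 (T1 : measurableType d1) (T2 : measurableType d2)
    (R : realType) (alpha : probability T1 R) (beta : probability T2 R) :
    set (probability (T1 * T2)%type R) :=
  [set pi | (forall A, measurable A -> pi (fst @^-1` A) = alpha A) /\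
            (forall B, measurable B -> pi (snd @^-1` B) = beta B)].

(* m(dx,dy) = mu(dx) kappa_x(dy) *)
Definition disintegrates d1 d2 (T1 : measurableType d1)
    (T2 : measurableType d2) (R : realType) (mu : probability T1 R)
    (kappa : R.-pker T1 ~> T2) (m : probability (T1 * T2)%type R) : Prop :=
  forall A, measurable A -> m A = \int[mu]_x kappa x (xsection A x).

(* An integral whose positive and negative parts are both infinite is -oo, so
   the barycenter equation forces y to be kappa_x-integrable. *)
Definition martingale_coupling (R : realType) (n : nat)
    (mu nu : probability 'rV[R]_n R) :
    set (probability ('rV[R]_n * 'rV[R]_n)%type R) :=
  [set m | coupling mu nu m /\
    exists kappa : R.-pker 'rV[R]_n ~> 'rV[R]_n,
      disintegrates mu kappa m /\
      {ae mu, forall x, forall i : 'I_n,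
        \int[kappa x]_y (y ord0 i)%:E = (x ord0 i)%:E}].

Definition rel_entropy d (T : measurableType d) (R : realType)
    (Q P : probability T R) : \bar R :=
  if pselect (Q `<< P) then
    \int[Q]_x lne (('d (charge_of_finite_measure Q) '/d P) x)
  else +oo.

Definition has_density d (T : measurableType d) (R : realType)
    (Q P : probability T R) (f : T -> R) : Prop :=
  measurable_fun setT f /\
  forall A, measurable A -> Q A = \int[P]_(x in A) (f x)%:E.

Definition solves_P (R : realType) (n : nat) (mu nu : probability 'rV[R]_n R) :
    probability ('rV[R]_n * 'rV[R]_n)%type R -> Prop :=
  is_minimizer (martingale_coupling mu nu)
    (fun m => rel_entropy m (mu \x nu)).

Definition log_laplace (R : realType) (n : nat) (nu : probability 'rV[R]_n R)
    (psi : 'rV[R]_n -> R) (h : 'rV[R]_n) : \bar R :=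
  lne (\int[nu]_y (expR (dotp h y + psi y))%:E).

Definition inner_objective (R : realType) (n : nat)
    (nu : probability 'rV[R]_n R) (psi : 'rV[R]_n -> R) (x h : 'rV[R]_n) :
    \bar R :=
  (dotp h x)%:E - log_laplace nu psi h.

Definition inner_solution (R : realType) (n : nat)
    (nu : probability 'rV[R]_n R) (psi : 'rV[R]_n -> R) (x : 'rV[R]_n) :
    'rV[R]_n -> Prop :=
  is_maximizer setT (inner_objective nu psi x).

Definition dual_objective (R : realType) (n : nat)
    (mu nu : probability 'rV[R]_n R) (psi : 'rV[R]_n -> R) : \bar R :=
  \int[nu]_y (psi y)%:E +
  \int[mu]_x ereal_sup (range (inner_objective nu psi x)).

Definition dual_value (R : realType) (n : nat)
    (mu nu : probability 'rV[R]_n R) : \bar R :=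
  ereal_sup [set dual_objective mu nu psi | psi in
    [set psi : 'rV[R]_n -> R^o | continuous psi /\ bounded_fun psi]].

(* For marginals with finite second moments the pairing is integrable under
   every coupling, so no oo - oo occurs. *)
Definition SP_objective (R : realType) (n : nat)
    (mubar nu : probability 'rV[R]_n R)
    (pi : probability ('rV[R]_n * 'rV[R]_n)%type R) : \bar R :=
  rel_entropy pi (mubar \x nu) - \int[pi]_z (dotp z.1 z.2)%:E.

Definition SP_value (R : realType) (n : nat)
    (mubar nu : probability 'rV[R]_n R) : \bar R :=
  ereal_inf [set SP_objective mubar nu pi | pi in coupling mubar nu].

Definition solves_SP (R : realType) (n : nat)
    (mubar nu : probability 'rV[R]_n R) :
    probability ('rV[R]_n * 'rV[R]_n)%type R -> Prop :=
  is_minimizer (coupling mubar nu) (SP_objective mubar nu).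

Definition schrodinger_density (R : realType) (n : nat)
    (phibar psi : 'rV[R]_n -> R) (z : 'rV[R]_n * 'rV[R]_n) : R :=
  expR (phibar z.1 + psi z.2 + dotp z.1 z.2).

Definition schrodinger_potentials (R : realType) (n : nat)
    (mubar nu : probability 'rV[R]_n R) (phibar psi : 'rV[R]_n -> R) : Prop :=
  (exists pi, solves_SP mubar nu pi) /\
  forall pi, solves_SP mubar nu pi ->
    has_density pi (mubar \x nu) (schrodinger_density phibar psi).

Definition schrodinger_system (R : realType) (n : nat)
    (mubar nu : probability 'rV[R]_n R) (phibar psi : 'rV[R]_n -> R) : Prop :=
  {ae mubar, forall xbar,
    \int[nu]_y (schrodinger_density phibar psi (xbar, y))%:E = 1} /\
  {ae nu, forall y,
    \int[mubar]_xbar (schrodinger_density phibar psi (xbar, y))%:E = 1}.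

Definition MCov (R : realType) (n : nat) (mubar mu : probability 'rV[R]_n R) :
    \bar R :=
  ereal_sup [set \int[q]_z (dotp z.1 z.2)%:E | q in coupling mubar mu].

Definition solves_VP (R : realType) (n : nat)
    (mu nu : probability 'rV[R]_n R) : probability 'rV[R]_n R -> Prop :=
  is_maximizer [set mubar | finite_second_moment mubar]
    (fun mubar => SP_value mubar nu + MCov mubar mu).

(* Main.v *)
(** The density defining m is the law nu tilted by h(x).  Optimality of psi
    extends from C_b to Borel functions of linear growth, since these are
    reached by pointwise limits; perturbing psi by small multiples of
    indicators then shows that m has second marginal nu, and the first-order
    condition for h(x) that m is a martingale coupling.  On the region
    |h(x)| <= N the log-density h(x).y + psi(y) - L(h(x)), with L the log-Laplace
    transform, has the same integral under every martingale coupling, and the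
    limit in N is D(psi).  Gibbs' inequality gives D(psi) <= H(m' | mu x nu)
    for every m', and Fatou's lemma gives H(m | mu x nu) <= D(psi).  For (VP),
    a coupling q of (mubar', mu) is glued with m along mu; the data processing
    inequality bounds SP(mubar', nu) plus the q-integral of the pairing by
    D(psi), with equality for mubar = h_# mu. *)

Require Import Defs.
From HB Require Import structures.
From mathcomp Require Import all_boot all_order all_algebra.
From mathcomp Require Import all_classical all_reals all_analysis.
From mathcomp Require Import measurable_realfun ring lra.

Set Implicit Arguments.
Unset Strict Implicit.
Unset Printing Implicit Defensive.
Import Order.TTheory GRing.Theory Num.Theory.
Import numFieldNormedType.Exports.

Local Open Scope classical_set_scope.
Local Open Scope ring_scope.
Local Open Scope ereal_scope.

(** * Densities, kernels and image measures *)

(** Nothing bounds [h]: the term h(x).y of the log-density may fail to be integrable under a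
    martingale coupling, so the martingale property cannot be applied to it directly. The cutoff
    multiplies the whole log-density; where it vanishes the exponential of the product is 1, so
    every fibre keeps mass 1 against [nu] and Gibbs' inequality applies at each level N. What
    survives in the limit is h(x).x - L(h(x)), which is mu-integrable because D(psi) is finite,
    whether or not its two terms are. Only functions in C_b compete in (D), while the marginal
    condition needs indicators. Fatou's lemma makes D lower semicontinuous along dominated pointwise
    limits, the direction that preserves an upper bound on D. Gibbs' inequality is proved with a
    Hellinger remainder, so that its equality case identifies every minimizer of SP; the claim on
    Schroedinger potentials rests on this. Uniqueness in (H4) yields measurability of [h]: it turns
    membership of h(x) in a compact set into an equality of two suprema. *)

Lemma ae_le_integral d (T : measurableType d) (R : realType)
    (mu : {measure set T -> \bar R}) (f g : T -> \bar R) :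
  measurable_fun setT f -> measurable_fun setT g ->
  {ae mu, forall x, f x <= g x} -> \int[mu]_x f x <= \int[mu]_x g x.
Proof.
move=> mf mg fg; rewrite (integralE _ _ f) (integralE _ _ g); apply: leeB.
- apply: ae_ge0_le_integral => //; [exact: measurable_funepos..|].
  by apply: filterS fg => x fgx _; rewrite !funeposE ge_max !le_max fgx lexx orbT.
- apply: ae_ge0_le_integral => //; [exact: measurable_funeneg..|].
  by apply: filterS fg => x fgx _; rewrite !funenegE ge_max !le_max leeN2 fgx lexx orbT.
Qed.

Lemma integral_pushforwardT d1 d2 (X : measurableType d1) (Y : measurableType d2)
    (R : realType) (phi : X -> Y) (mphi : measurable_fun setT phi)
    (mu : {measure set X -> \bar R}) (f : Y -> \bar R) :
  measurable_fun setT f ->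
  \int[pushforward mu phi]_y f y = \int[mu]_x f (phi x).
Proof.
move=> mf; rewrite (integralE _ _ f) (integralE _ _ (fun x => f (phi x))).
congr (_ - _).
- rewrite (@ge0_integral_pushforward _ _ _ _ _ _ mphi mu setT f^\+)//.
    by rewrite preimage_setT -funepos_comp.
  exact: measurable_funepos.
- rewrite (@ge0_integral_pushforward _ _ _ _ _ _ mphi mu setT f^\-)//.
    by rewrite preimage_setT -funeneg_comp.
  exact: measurable_funeneg.
Qed.

Lemma integrable_pushforwardT d1 d2 (X : measurableType d1) (Y : measurableType d2)
    (R : realType) (phi : X -> Y) (mphi : measurable_fun setT phi)
    (mu : {measure set X -> \bar R}) (f : Y -> \bar R) :
  measurable_fun setT f ->
  mu.-integrable setT (fun x => f (phi x)) ->
  (pushforward mu phi).-integrable setT f.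
Proof.
move=> mf /integrableP[mfp fi]; apply/integrableP; split=> //.
rewrite integral_pushforwardT//; exact: measurableT_comp.
Qed.

Lemma density_dominates d (T : measurableType d) (R : realType)
    (Q P : probability T R) (f : T -> R) : has_density Q P f -> Q `<< P.
Proof.
move=> [mf Qf]; apply/null_content_dominatesP => A mA PA.
rewrite Qf//; apply: null_set_integral => //.
  exact/measurable_EFinP/measurable_funTS.
Qed.

(** The proofs [mf], [f0] and [f1] are arguments so that the measure and probability instances can
    be found from the term alone. *)
Definition dens d (T : measurableType d) (R : realType) (P : probability T R)
    (f : T -> R) (mf : measurable_fun setT f) (f0 : forall x, (0 <= f x)%R)
    (f1 : \int[P]_x (f x)%:E = 1) (A : set T) : \bar R :=
  \int[P]_(x in A) (f x)%:E.

Lemma dens_set0 d (T : measurableType d) (R : realType) (P : probability T R)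
    (f : T -> R) mf f0 f1 : @dens d T R P f mf f0 f1 set0 = 0.
Proof. exact: integral_set0. Qed.

Lemma dens_ge0 d (T : measurableType d) (R : realType) (P : probability T R)
    (f : T -> R) mf f0 f1 A : 0 <= @dens d T R P f mf f0 f1 A.
Proof. by apply: integral_ge0 => x _; rewrite lee_fin. Qed.

Lemma dens_sigma_additive d (T : measurableType d) (R : realType)
    (P : probability T R) (f : T -> R) mf f0 f1 :
  semi_sigma_additive (@dens d T R P f mf f0 f1).
Proof.
move=> F mF tF mUF; rewrite /dens ge0_integral_bigcup//.
- by apply: is_cvg_ereal_nneg_natsum => n _; exact: dens_ge0.
- exact/measurable_EFinP/measurable_funTS.
- by move=> x _; rewrite lee_fin.
Qed.

HB.instance Definition _ d (T : measurableType d) (R : realType)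
    (P : probability T R) (f : T -> R) mf f0 f1 :=
  isMeasure.Build d T R (@dens d T R P f mf f0 f1)
    (dens_set0 mf f0 f1) (dens_ge0 mf f0 f1)
    (@dens_sigma_additive d T R P f mf f0 f1).

Lemma dens_setT d (T : measurableType d) (R : realType) (P : probability T R)
    (f : T -> R) mf f0 f1 : @dens d T R P f mf f0 f1 setT = 1.
Proof. exact: f1. Qed.

HB.instance Definition _ d (T : measurableType d) (R : realType)
    (P : probability T R) (f : T -> R) mf f0 f1 :=
  @Measure_isProbability.Build d T R (@dens d T R P f mf f0 f1)
    (dens_setT mf f0 f1).

Lemma density_probability d (T : measurableType d) (R : realType)
    (P : probability T R) (f : T -> R) :
  measurable_fun setT f -> (forall x, (0 <= f x)%R) ->
  \int[P]_x (f x)%:E = 1 -> exists Q : probability T R, has_density Q P f.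
Proof.
move=> mf f0 f1.
by exists (dens mf f0 f1 : probability T R); split.
Qed.

(** * Probability kernels given by densities, and disintegration *)

Definition kdens d1 d2 (X : measurableType d1) (T : measurableType d2)
    (R : realType) (P : probability T R) (f : X * T -> R)
    (mf : measurable_fun setT f) (f0 : forall z, (0 <= f z)%R)
    (f1 : forall x, \int[P]_y (f (x, y))%:E = 1) (x : X) :
    {measure set T -> \bar R} :=
  dens (measurable_fun_pair2 x mf) (fun y => f0 (x, y)) (f1 x).

Lemma measurable_kdens d1 d2 (X : measurableType d1) (T : measurableType d2)
    (R : realType) (P : probability T R) (f : X * T -> R) mf f0 f1 U :
  measurable U ->
  measurable_fun setT ((@kdens d1 d2 X T R P f mf f0 f1) ^~ U).
Proof.
move=> mU.
pose g (z : X * T) : \bar R := (f z * \1_U z.2)%:E.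
rewrite [X in measurable_fun _ X](_ : _ = fubini_F P g); last first.
  apply/funext => x; rewrite /kdens /= /dens integral_mkcond /fubini_F.
  by apply: eq_integral => y _; rewrite /g /= EFinM epatch_indic.
apply: measurable_fun_fubini_tonelli_F; last first.
  by move=> z; rewrite lee_fin mulr_ge0.
apply/measurable_EFinP; apply: measurable_funM => //.
exact: measurableT_comp.
Qed.

HB.instance Definition _ d1 d2 (X : measurableType d1) (T : measurableType d2)
    (R : realType) (P : probability T R) (f : X * T -> R) mf f0 f1 :=
  isKernel.Build d1 d2 X T R (@kdens d1 d2 X T R P f mf f0 f1)
    (@measurable_kdens d1 d2 X T R P f mf f0 f1).

Lemma kdens_setT d1 d2 (X : measurableType d1) (T : measurableType d2)
    (R : realType) (P : probability T R) (f : X * T -> R) mf f0 f1 x :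
  @kdens d1 d2 X T R P f mf f0 f1 x setT = 1.
Proof. exact: f1. Qed.

HB.instance Definition _ d1 d2 (X : measurableType d1) (T : measurableType d2)
    (R : realType) (P : probability T R) (f : X * T -> R) mf f0 f1 :=
  Kernel_isProbability.Build d1 d2 X T R (@kdens d1 d2 X T R P f mf f0 f1)
    (@kdens_setT d1 d2 X T R P f mf f0 f1).

Lemma density_kernel d1 d2 (X : measurableType d1) (T : measurableType d2)
    (R : realType) (P : probability T R) (f : X * T -> R) :
  measurable_fun setT f -> (forall z, (0 <= f z)%R) ->
  (forall x, \int[P]_y (f (x, y))%:E = 1) ->
  exists kappa : R.-pker X ~> T, forall x A,
    kappa x A = \int[P]_(y in A) (f (x, y))%:E.
Proof.
by move=> mf f0 f1; exists (kdens mf f0 f1 : R.-pker X ~> T).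
Qed.

(** The kernel sending x to the product of the Dirac mass at x with [kappa x]. The domain
    [unit * T1] is the shape that the composition [\;] expects after a kernel from [unit], here the
    constant one with value [mu]. *)
Definition kpair d1 d2 (T1 : measurableType d1) (T2 : measurableType d2)
    (R : realType) (kappa : R.-pker T1 ~> T2) (x : unit * T1) :
    {measure set (T1 * T2) -> \bar R} :=
  measure_function_pushforward__canonical__measure_function_Measure
    (kappa x.2) (pair1_measurable x.2).

Lemma measurable_kpair d1 d2 (T1 : measurableType d1) (T2 : measurableType d2)
    (R : realType) (kappa : R.-pker T1 ~> T2) U : measurable U ->
  measurable_fun setT ((kpair kappa) ^~ U).
Proof.
move=> mU; rewrite [X in measurable_fun _ X](_ : _ =
    (fun x => kappa x (xsection U x)) \o snd); last first.
  by apply/funext => -[t x]; rewrite /kpair /= /pushforward xsectionE.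
apply: measurableT_comp => //.
by apply: measurable_fun_xsection_finite_kernel; rewrite inE.
Qed.

HB.instance Definition _ d1 d2 (T1 : measurableType d1) (T2 : measurableType d2)
    (R : realType) (kappa : R.-pker T1 ~> T2) :=
  isKernel.Build _ _ _ _ R (kpair kappa) (measurable_kpair kappa).

Lemma kpair_setT d1 d2 (T1 : measurableType d1) (T2 : measurableType d2)
    (R : realType) (kappa : R.-pker T1 ~> T2) x : kpair kappa x setT = 1.
Proof. exact: prob_kernel. Qed.

HB.instance Definition _ d1 d2 (T1 : measurableType d1) (T2 : measurableType d2)
    (R : realType) (kappa : R.-pker T1 ~> T2) :=
  Kernel_isProbability.Build _ _ _ _ R (kpair kappa) (kpair_setT kappa).

(** [m] agrees on measurable sets with the composition of the constant kernel [mu] and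
    [kpair kappa], so the formula is the one for integrals against a composed kernel. *)
Lemma disintegrates_ge0_integral d1 d2 (T1 : measurableType d1)
    (T2 : measurableType d2) (R : realType) (mu : probability T1 R)
    (kappa : R.-pker T1 ~> T2) (m : probability (T1 * T2)%type R)
    (F : T1 * T2 -> \bar R) :
  disintegrates mu kappa m -> measurable_fun setT F -> (forall z, 0 <= F z) ->
  \int[m]_z F z = \int[mu]_x \int[kappa x]_y F (x, y).
Proof.
move=> mE mF F0.
have mP : measurable_fun [set: unit] (fun=> (mu : pprobability T1 R)) by [].
rewrite (eq_measure_integral
    ((kprobability mP \; (kpair kappa : R.-pker _ ~> _)) tt)).
  rewrite integral_kcomp//; apply: eq_integral => x _.
  rewrite /= (@ge0_integral_pushforward _ _ _ _ _ _ (pair1_measurable x))//.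
move=> A mA _; apply: (etrans (mE A mA)).
by rewrite /= /kcomp; apply: eq_integral => x _; rewrite xsectionE.
Qed.

Lemma disintegrates_integrable d1 d2 (T1 : measurableType d1)
    (T2 : measurableType d2) (R : realType) (mu : probability T1 R)
    (kappa : R.-pker T1 ~> T2) (m : probability (T1 * T2)%type R)
    (F : T1 * T2 -> \bar R) :
  disintegrates mu kappa m -> m.-integrable setT F ->
  \int[m]_z F z = \int[mu]_x \int[kappa x]_y F (x, y).
Proof.
move=> mE iF; have mF := measurable_int _ iF.
have mFp := measurable_funepos mF; have mFn := measurable_funeneg mF.
have mk (G : T1 * T2 -> \bar R) : measurable_fun setT G -> (forall z, 0 <= G z) ->
    measurable_fun setT (fun x => \int[kappa x]_y G (x, y)).
  by move=> mG G0; exact: measurable_fun_integral_finite_kernel.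
have ik (G : T1 * T2 -> \bar R) : measurable_fun setT G -> (forall z, 0 <= G z) ->
    \int[m]_z G z < +oo ->
    mu.-integrable setT (fun x => \int[kappa x]_y G (x, y)).
  move=> mG G0 iG; apply/integrableP; split; first exact: mk.
  under eq_integral do rewrite gee0_abs ?integral_ge0//.
  by rewrite -(disintegrates_ge0_integral mE).
have ip := ik _ mFp (funepos_ge0 _) (integral_funepos_lt_pinfty measurableT iF).
have iN := ik _ mFn (funeneg_ge0 _) (integral_funeneg_lt_pinfty measurableT iF).
rewrite integralE !(disintegrates_ge0_integral mE)// -integralB//.
apply: eq_integral => x _; rewrite [in RHS]integralE.
by congr (_ - _); apply: eq_integral => y _; rewrite !(funeposE, funenegE).
Qed.

(** [f] equals the Radon-Nikodym derivative P-a.e., both having the same integral over every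
    measurable set. *)
Lemma density_ge0_integral d (T : measurableType d) (R : realType)
    (Q P : probability T R) (f : T -> R) (F : T -> \bar R) :
  has_density Q P f -> (forall x, (0 <= f x)%R) -> measurable_fun setT F ->
  (forall x, 0 <= F x) ->
  \int[Q]_x F x = \int[P]_x (F x * (f x)%:E).
Proof.
move=> hd f0 mF F0; have [mf Qf] := hd; have QP := density_dominates hd.
rewrite -(Radon_Nikodym_SigmaFinite.change_of_variables QP)//.
have mrn : measurable_fun setT (Radon_Nikodym_SigmaFinite.f Q P).
  exact: measurable_int (Radon_Nikodym_SigmaFinite.f_integrable QP).
apply: ae_eq_integral => //; [exact: emeasurable_funM| |].
  by apply: emeasurable_funM => //; exact/measurable_EFinP.
apply: ae_eqe_mul2l; apply: integral_ae_eq => //.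
- exact: Radon_Nikodym_SigmaFinite.f_integrable.
- exact/measurable_EFinP.
- by move=> A _ mA; rewrite -Radon_Nikodym_SigmaFinite.f_integral//; exact: Qf.
Qed.

Lemma density_integral d (T : measurableType d) (R : realType)
    (Q P : probability T R) (f : T -> R) (F : T -> \bar R) :
  has_density Q P f -> (forall x, (0 <= f x)%R) -> measurable_fun setT F ->
  \int[Q]_x F x = \int[P]_x (F x * (f x)%:E).
Proof.
move=> hd f0 mF; have [mf _] := hd.
rewrite integralE [RHS]integralE !(density_ge0_integral hd)//.
- congr (_ - _); apply: eq_integral => x _.
    by rewrite !funeposE maxe_pMl ?lee_fin// mul0e.
  by rewrite !funenegE maxe_pMl ?lee_fin// mul0e mulNe.
- exact: measurable_funeneg.
- exact: measurable_funepos.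
Qed.

(** * Relative entropy *)

(** The Q-mass of the zero set of [f] is an integral of 0. Hence [lne f] is Q-a.e. the finite number
    [ln f]. *)
Lemma ae_density_gt0 d (T : measurableType d) (R : realType)
    (Q P : probability T R) (f : T -> R) :
  has_density Q P f -> (forall x, (0 <= f x)%R) ->
  {ae Q, forall x, (0 < f x)%R}.
Proof.
move=> [mf Qf] f0.
have mA : measurable [set x | f x = 0%R].
  by rewrite -[X in measurable X]setTI; exact: (mf measurableT _ (measurable_set1 0%R)).
exists [set x | f x = 0%R]; split => //.
- apply: (etrans (Qf _ mA)).
  rewrite (eq_integral (cst 0)) ?integral0// => x; rewrite inE /= => -> //.
- by move=> x /= /negP; rewrite -leNgt => fx; apply/eqP; rewrite eq_le fx f0.
Qed.

Lemma measurable_lne (R : realType) : measurable_fun setT (@lne R).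
Proof.
rewrite (_ : @lne R = fun x => if x <= 0 then -oo else
    if x == +oo then +oo else (ln (fine x))%:E); last first.
  by apply/funext => -[r| |]; rewrite /= ?lee_fin ?leNye ?leye_eq.
apply: measurable_fun_ifT => //.
  exact: measurable_fun_lee.
apply: measurable_fun_ifT => //.
  exact: measurable_fun_eqe.
apply/measurable_EFinP; apply: measurableT_comp; first exact: measurable_ln.
exact: fine_measurable.
Qed.

Lemma rel_entropy_density d (T : measurableType d) (R : realType)
    (Q P : probability T R) (f : T -> R) :
  has_density Q P f -> (forall x, (0 <= f x)%R) ->
  rel_entropy Q P = \int[Q]_x lne (f x)%:E.
Proof.
move=> hd f0; have QP := density_dominates hd; have [mf Qf] := hd.
rewrite /rel_entropy; case: (pselect (Q `<< P)) => [QP'|/(_ QP)//].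
have iRN := @Radon_Nikodym_integrable _ _ _ (charge_of_finite_measure Q) P QP.
have mlf : measurable_fun setT (fun x => lne (f x)%:E).
  by apply: (measurableT_comp (@measurable_lne R)); exact/measurable_EFinP.
apply: (ae_eq_integral (fun x => lne (f x)%:E)) => //.
- by apply: measurableT_comp; [exact: measurable_lne|exact: measurable_int iRN].
- apply: (null_dominates_ae_eq measurableT QP).
  have : ae_eq P setT (Radon_Nikodym (charge_of_finite_measure Q) P) (EFin \o f).
    apply: integral_ae_eq => //; first exact/measurable_EFinP.
    by move=> A _ mA; rewrite -Radon_Nikodym_integral//; exact: Qf.
  by apply: filterS => x /= /[apply] ->.
Qed.

Lemma dominates_density d (T : measurableType d) (R : realType)
    (Q P : probability T R) : Q `<< P ->
  exists f : T -> R, (forall x, (0 <= f x)%R) /\ has_density Q P f.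
Proof.
move=> QP; pose f x := fine (Radon_Nikodym_SigmaFinite.f Q P x).
exists f; split; first by move=> x; apply/fine_ge0/Radon_Nikodym_SigmaFinite.f_ge0.
split.
  apply: measurableT_comp; first exact: fine_measurable.
  exact: measurable_int (Radon_Nikodym_SigmaFinite.f_integrable QP).
move=> A mA; apply: (etrans (Radon_Nikodym_SigmaFinite.f_integral QP mA)).
by apply: eq_integral => x _; rewrite /f fineK// Radon_Nikodym_SigmaFinite.f_fin_num.
Qed.

(** * Gibbs' inequality with a Hellinger remainder *)

Lemma integrable_le_norm d (T : measurableType d) (R : realType)
    (P : {measure set T -> \bar R}) (f g : T -> R) :
  measurable_fun setT f -> (forall x, (`|f x| <= g x)%R) ->
  P.-integrable setT (EFin \o g) -> P.-integrable setT (EFin \o f).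
Proof.
move=> mf fg; apply: le_integrable => //; first exact/measurable_EFinP.
by move=> x _ /=; rewrite lee_fin (le_trans (fg x))// ler_norm.
Qed.

Lemma ge0_integrable d (T : measurableType d) (R : realType)
    (P : {measure set T -> \bar R}) (f : T -> \bar R) :
  measurable_fun setT f -> (forall x, 0 <= f x) -> \int[P]_x f x < +oo ->
  P.-integrable setT f.
Proof.
move=> mf f0 fi; apply/integrableP; split => //.
by under eq_integral do rewrite gee0_abs//.
Qed.

(** The square root, written through [ln] so that it combines with [expR (t / 2)] by the exponential
    law. *)
Definition root_density (R : realType) (r : R) : R :=
  if (r <= 0)%R then 0%R else expR (ln r / 2).

Lemma sqr_root_density (R : realType) (r : R) : (0 <= r)%R ->
  (root_density r ^+ 2 = r)%R.
Proof.
move=> r0; rewrite /root_density; case: ifPn => [r0'|].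
  by rewrite expr0n /=; apply/eqP; rewrite eq_le r0 r0'.
rewrite -ltNge => r1; rewrite -expRM_natl.
by rewrite -mulr_natl mulrC divfK// lnK.
Qed.

Lemma measurable_root_density (R : realType) : measurable_fun setT (@root_density R).
Proof.
apply: measurable_fun_ifT => //.
  exact: measurable_fun_ler.
apply: measurableT_comp; first exact: measurable_expR.
by apply: measurable_funM => //; exact: measurable_ln.
Qed.

(** With r = f and t = g, the first factor is sqrt (exp g / f): its integral under the law of
    density f becomes a P-integral of a product of square roots. *)
Lemma root_density_mul (R : realType) (r t : R) : (0 <= r)%R ->
  (expR ((t - ln r) / 2) * r = root_density r * expR (t / 2))%R.
Proof.
move=> r0; rewrite -{2}(sqr_root_density r0) /root_density; case: ifPn => _.
  by rewrite expr0n /= mulr0 mul0r.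
rewrite expr2 mulrA -expRD -mulrDl subrK mulrC; congr (_ * _)%R.
Qed.

Lemma root_density_ge0 (R : realType) (r : R) : (0 <= root_density r)%R.
Proof. by rewrite /root_density; case: ifPn => // _; exact: expR_ge0. Qed.

Lemma density_integrable1 d (T : measurableType d) (R : realType)
    (Q P : probability T R) (f : T -> R) :
  has_density Q P f -> (forall x, (0 <= f x)%R) ->
  P.-integrable setT (EFin \o f) /\ \int[P]_x (f x)%:E = 1.
Proof.
move=> [mf Qf] f0; have f1 : \int[P]_x (f x)%:E = 1.
  by rewrite -Qf//; exact: probability_setT.
split=> //; apply: ge0_integrable => //; first exact/measurable_EFinP.
by rewrite /= f1 ltry.
Qed.

Lemma sqr_exp_half (R : realType) (t : R) : (expR (t / 2) ^+ 2 = expR t)%R.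
Proof. by rewrite -expRM_natl -mulr_natl mulrC divfK. Qed.

(* The inequality ln t <= t - 1 applied to t = sqrt (exp g / f) leaves the
   squared Hellinger distance between f and exp g as a remainder. *)
Lemma gibbs_hellinger d (T : measurableType d) (R : realType)
    (Q P : probability T R) (f g : T -> R) :
  has_density Q P f -> (forall x, (0 <= f x)%R) ->
  measurable_fun setT g -> Q.-integrable setT (EFin \o g) ->
  \int[P]_x (expR (g x))%:E = 1 ->
  \int[Q]_x (g x)%:E +
  \int[P]_x ((root_density (f x) - expR (g x / 2)) ^+ 2)%:E <=
  \int[Q]_x lne (f x)%:E.
Proof.
move=> hd f0 mg ig g1; have [mf Qf] := hd.
have [if_ f1] := density_integrable1 hd f0.
pose s x := root_density (f x); pose u x := expR (g x / 2).
have ms : measurable_fun setT s by exact: measurableT_comp (@measurable_root_density R) mf.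
have mu : measurable_fun setT u.
  by apply: measurableT_comp => //; exact: measurable_funM.
pose w x := expR ((g x - ln (f x)) / 2).
have mw : measurable_fun setT w.
  apply: measurableT_comp => //; apply: measurable_funM => //.
  by apply: measurable_funB => //; exact: measurableT_comp (@measurable_ln R) mf.
have wf x : (w x * f x = s x * u x)%R by exact: root_density_mul.
have iexp : P.-integrable setT (fun x => (expR (g x))%:E).
  apply: ge0_integrable => //.
  - by apply/measurable_EFinP; exact: measurableT_comp.
  - by rewrite g1 ltry.
have s2 x : (s x ^+ 2 = f x)%R by exact: sqr_root_density.
have u2 x : (u x ^+ 2 = expR (g x))%R by exact: sqr_exp_half.
have isu : P.-integrable setT (EFin \o (fun x => s x * u x)%R).
  apply: (@integrable_le_norm _ _ _ _ _ (fun x => f x + expR (g x))%R).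
  - exact: measurable_funM.
  - move=> x; rewrite ger0_norm; last by rewrite mulr_ge0 ?root_density_ge0 ?expR_ge0.
    rewrite -s2 -u2; nra.
  - exact: (integrableD measurableT if_ iexp).
(* The Hellinger affinity. As f and exp g both have P-integral 1, expanding the square gives 2 - 2
   B; and [B] is also the Q-integral of [w]. *)
pose B := \int[P]_x (s x * u x)%:E.
have Bfin : B \is a fin_num by exact: integrable_fin_num.
have isu2 : P.-integrable setT (fun x => (2 * (s x * u x))%:E).
  by under eq_fun do rewrite EFinM; exact: integrableZl.
have dE : \int[P]_x ((s x - u x) ^+ 2)%:E = 2%:E - 2%:E * B.
  transitivity (\int[P]_x ((f x)%:E + (expR (g x))%:E - (2 * (s x * u x))%:E)).
    apply: eq_integral => x _; rewrite [LHS](_ : _ =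
      (f x + expR (g x) - 2 * (s x * u x))%:E)//.
    by rewrite -s2 -u2; congr EFin; ring.
  rewrite integralB//; last exact: (integrableD measurableT if_ iexp).
  rewrite integralD// f1 g1; congr (_ - _).
  by under eq_integral do rewrite EFinM; rewrite integralZl.
have wB : \int[Q]_x (w x)%:E = B.
  rewrite (density_ge0_integral hd f0)//.
  - by apply: eq_integral => x _; rewrite -EFinM wf.
  - exact/measurable_EFinP.
  - by move=> x; rewrite lee_fin expR_ge0.
have iw : Q.-integrable setT (EFin \o w).
  apply: ge0_integrable => //; first exact/measurable_EFinP.
  - by move=> x; rewrite lee_fin expR_ge0.
  - by rewrite wB ltey_eq Bfin.
have ic : Q.-integrable setT (fun=> 2%:E : \bar R).
  exact: finite_measure_integrable_cst.
have iw2 : Q.-integrable setT (fun x => 2%:E * (w x)%:E) by exact: integrableZl.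
rewrite dE; have -> : \int[Q]_x (g x)%:E + (2%:E - 2%:E * B) =
    \int[Q]_x ((g x)%:E + (2%:E - 2%:E * (w x)%:E)).
  rewrite integralD//; last exact: integrableB.
  rewrite integralB// integral_cst// integralZl// wB; congr (_ + (_ - _)).
  by rewrite -[LHS]mule1; congr (_ * _); exact/esym/probability_setT.
apply: ae_le_integral.
- apply/measurable_EFinP; apply: measurable_funD => //.
  by apply: measurable_funB => //; apply: measurable_funM.
- by apply: (measurableT_comp (@measurable_lne R)); exact/measurable_EFinP.
- apply: filterS (ae_density_gt0 hd f0) => x fx.
  (* The pointwise claim g + 2 - 2 w <= ln f is twice the inequality 1 + s <= exp s at s = (g - ln
     f) / 2. *)
  rewrite lne_EFin// -EFinM -EFinB -EFinD lee_fin /w.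
  have := expR_ge1Dx ((g x - ln (f x)) / 2)%R; lra.
Qed.

Lemma rel_entropy_ge d (T : measurableType d) (R : realType)
    (Q P : probability T R) (g : T -> R) :
  measurable_fun setT g -> Q.-integrable setT (EFin \o g) ->
  \int[P]_x (expR (g x))%:E = 1 ->
  \int[Q]_x (g x)%:E <= rel_entropy Q P.
Proof.
move=> mg ig g1; have [QP|nQP] := pselect (Q `<< P); last first.
  by rewrite /rel_entropy; case: (pselect (Q `<< P)) => // QP; rewrite leey.
have [f [f0 hf]] := dominates_density QP.
rewrite (rel_entropy_density hf f0); apply: le_trans (gibbs_hellinger hf f0 mg ig g1).
by rewrite leeDl// integral_ge0// => x _; rewrite lee_fin sqr_ge0.
Qed.

Lemma rel_entropy_exp_density d (T : measurableType d) (R : realType)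
    (Q P : probability T R) (g : T -> R) :
  has_density Q P (fun x => expR (g x)) ->
  rel_entropy Q P = \int[Q]_x (g x)%:E.
Proof.
move=> hd; rewrite (rel_entropy_density hd); last by move=> x; exact: expR_ge0.
by apply: eq_integral => x _; rewrite lne_EFin ?expR_gt0// expRK.
Qed.

(** The equality case of Gibbs' inequality: the Hellinger remainder is squeezed to 0, so the square
    roots of the two densities agree P-a.e. *)
Lemma rel_entropy_le_density d (T : measurableType d) (R : realType)
    (Q P : probability T R) (g : T -> R) :
  measurable_fun setT g -> Q.-integrable setT (EFin \o g) ->
  \int[P]_x (expR (g x))%:E = 1 ->
  rel_entropy Q P <= \int[Q]_x (g x)%:E ->
  has_density Q P (fun x => expR (g x)).
Proof.
move=> mg ig g1 entle.
have Afin : \int[Q]_x (g x)%:E \is a fin_num by exact: integrable_fin_num ig.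
have [QP|nQP] := pselect (Q `<< P); last first.
  move: entle; rewrite /rel_entropy; case: (pselect (Q `<< P)) => // ? /=.
  by rewrite leye_eq => /eqP A; rewrite A in Afin.
have [f [f0 hf]] := dominates_density QP; have [mf Qf] := hf.
move: entle; rewrite (rel_entropy_density hf f0) => entle.
have := le_trans (gibbs_hellinger hf f0 mg ig g1) entle.
rewrite -[X in _ <= X]adde0 leeD2lE//.
set H := fun x => _; move=> H0.
have mH : measurable_fun setT H.
  apply/measurable_EFinP; apply: measurable_funX; apply: measurable_funB.
    exact: measurableT_comp (@measurable_root_density R) mf.
  by apply: measurableT_comp => //; exact: measurable_funM.
have {}H0 : \int[P]_x `|H x| = 0.
  apply/eqP; rewrite eq_le integral_ge0// andbT.
  by under eq_integral do rewrite gee0_abs ?lee_fin ?sqr_ge0//.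
have {}H0 := (ae_eq_integral_abs P measurableT mH).1 H0.
split; first by apply: measurableT_comp.
move=> A mA; rewrite Qf//; apply: ae_eq_integral => //.
- exact/measurable_EFinP/measurable_funTS.
- by apply/measurable_EFinP/measurable_funTS; exact: measurableT_comp.
- apply: filterS H0 => x /(_ I) /= [] /eqP.
  rewrite sqrf_eq0 subr_eq0 => /eqP su _; congr EFin.
  by rewrite -(sqr_root_density (f0 x)) su sqr_exp_half.
Qed.

(** * Euclidean structure of row vectors *)

Lemma continuous_rV_measurable (R : realType) (n : nat) (f : 'rV[R]_n -> R) :
  continuous f -> measurable_fun setT f.
Proof.
move=> /continuousP cf.
apply: (measurability (@RGenOpens.G R)); first exact: RGenOpens.measurableE.
move=> _ [_ [a [b ->]] <-]; rewrite setTI.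
by apply: sub_sigma_algebra; apply: cf; exact: interval_open.
Qed.

Lemma open_rV_measurable (R : realType) (n : nat) (U : set 'rV[R]_n) :
  open U -> measurable U.
Proof. exact: sub_sigma_algebra. Qed.

Lemma measurable_coord (R : realType) (n : nat) (i : 'I_n) :
  measurable_fun setT (fun x : 'rV[R]_n => x ord0 i).
Proof. by apply: continuous_rV_measurable; exact: coord_continuous. Qed.

Lemma measurable_dotp d (T : measurableType d) (R : realType) (n : nat)
    (f g : T -> 'rV[R]_n) :
  measurable_fun setT f -> measurable_fun setT g ->
  measurable_fun setT (fun t => dotp (f t) (g t)).
Proof.
move=> mf mg; apply: measurable_sum => i.
by apply: measurable_funM; exact: measurableT_comp (@measurable_coord _ _ i) _.
Qed.

Lemma dotp_continuous (R : realType) (n : nat) (h : 'rV[R]_n) :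
  continuous (dotp h).
Proof.
apply: continuous_big => [|i _ x]; first exact: add_continuous.
by apply: continuousM; [exact: cst_continuous|exact: coord_continuous].
Qed.

Lemma enorm_continuous (R : realType) (n : nat) : continuous (@enorm R n).
Proof.
have cd : continuous (fun x : 'rV[R]_n => dotp x x).
  apply: continuous_big => [|i _ x]; first exact: add_continuous.
  by apply: continuousM; exact: coord_continuous.
by move=> x; apply: continuous_comp; [exact: cd|exact: sqrt_continuous].
Qed.

Lemma measurable_enorm (R : realType) (n : nat) : measurable_fun setT (@enorm R n).
Proof. by apply: continuous_rV_measurable; exact: enorm_continuous. Qed.

Lemma dotpC (R : realType) (n : nat) (x y : 'rV[R]_n) : dotp x y = dotp y x.
Proof. by apply: eq_bigr => i _; rewrite mulrC. Qed.

Lemma dotpDl (R : realType) (n : nat) (x y z : 'rV[R]_n) :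
  (dotp (x + y) z = dotp x z + dotp y z)%R.
Proof. by rewrite /dotp -big_split; apply: eq_bigr => i _; rewrite mxE mulrDl. Qed.

Lemma dotpZl (R : realType) (n : nat) (k : R) (x y : 'rV[R]_n) :
  (dotp (k *: x) y = k * dotp x y)%R.
Proof. by rewrite /dotp mulr_sumr; apply: eq_bigr => i _; rewrite mxE mulrA. Qed.

Lemma dotpNl (R : realType) (n : nat) (x y : 'rV[R]_n) :
  (dotp (- x) y = - dotp x y)%R.
Proof. by rewrite -scaleN1r dotpZl mulN1r. Qed.

Lemma dotp0l (R : realType) (n : nat) (y : 'rV[R]_n) : dotp 0%R y = 0%R.
Proof. by rewrite -(scale0r y) dotpZl mul0r. Qed.

Lemma dotp_delta (R : realType) (n : nat) (i : 'I_n) (y : 'rV[R]_n) :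
  dotp (delta_mx ord0 i) y = y ord0 i.
Proof.
rewrite /dotp (bigD1 i)//= mxE !eqxx mul1r big1 ?addr0// => j ji.
by rewrite mxE (negbTE ji) andbF mul0r.
Qed.

Lemma dotp_ge0 (R : realType) (n : nat) (x : 'rV[R]_n) : (0 <= dotp x x)%R.
Proof. by apply: sumr_ge0 => i _; rewrite -expr2 sqr_ge0. Qed.

Lemma enorm_ge0 (R : realType) (n : nat) (x : 'rV[R]_n) : (0 <= enorm x)%R.
Proof. exact: sqrtr_ge0. Qed.

Lemma sqr_enorm (R : realType) (n : nat) (x : 'rV[R]_n) :
  (enorm x ^+ 2 = dotp x x)%R.
Proof. by rewrite sqr_sqrtr ?dotp_ge0. Qed.

Lemma enorm0 (R : realType) (n : nat) : enorm (0 : 'rV[R]_n)%R = 0%R.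
Proof. by rewrite /enorm dotp0l sqrtr0. Qed.

Lemma dotp_le_enorm (R : realType) (n : nat) (x y : 'rV[R]_n) :
  (dotp x y <= enorm x * enorm y)%R.
Proof.
(* This square expands to 2 |x| |y| (|x| |y| - x.y), so vectors of zero norm are treated apart
   before dividing. *)
have := dotp_ge0 (enorm y *: x - enorm x *: y).
have [x0|x0] := eqVneq (enorm x) 0%R.
  rewrite x0 mul0r.
  have xi i : x ord0 i = 0%R.
    have : dotp x x == 0%R by rewrite -sqr_enorm x0 expr0n.
    rewrite psumr_eq0; last by move=> j _; rewrite -expr2 sqr_ge0.
    by move=> /allP/(_ i (mem_index_enum _)); rewrite mulf_eq0 orbb => /eqP.
  by move=> _; rewrite /dotp big1// => i _; rewrite xi mul0r.
have [y0|y0] := eqVneq (enorm y) 0%R.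
  rewrite y0 mulr0.
  have yi i : y ord0 i = 0%R.
    have : dotp y y == 0%R by rewrite -sqr_enorm y0 expr0n.
    rewrite psumr_eq0; last by move=> j _; rewrite -expr2 sqr_ge0.
    by move=> /allP/(_ i (mem_index_enum _)); rewrite mulf_eq0 orbb => /eqP.
  by move=> _; rewrite /dotp big1// => i _; rewrite yi mulr0.
rewrite dotpDl dotpNl !dotpZl !(dotpC _ (_ - _)) !dotpDl !dotpNl !dotpZl.
rewrite (dotpC y x) -!sqr_enorm => H.
have xy : (0 < enorm x * enorm y)%R.
  by rewrite mulr_gt0// lt_def enorm_ge0 ?x0 ?y0.
rewrite -(ler_pM2l xy); move: H; nra.
Qed.

Lemma norm_dotp_le (R : realType) (n : nat) (x y : 'rV[R]_n) :
  (`|dotp x y| <= enorm x * enorm y)%R.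
Proof.
rewrite ler_norml dotp_le_enorm andbT lerNl -dotpNl.
apply: le_trans (dotp_le_enorm _ _) _.
by rewrite /enorm dotpNl dotpC dotpNl opprK.
Qed.

(** The index set may be uncountable: the supremum is lower semicontinuous, so its strict superlevel
    sets are open. *)
Lemma measurable_sup_continuous (R : realType) (n : nat) (I : Type) (S : set I)
    (f : I -> 'rV[R]_n -> R) : (forall i, continuous (f i)) ->
  measurable_fun setT (fun x => ereal_sup [set (f i x)%:E | i in S]).
Proof.
move=> cf; apply: (measurability (@ErealGenOInfty.G R)).
  exact: ErealGenOInfty.measurableE.
move=> _ [_ [r ->] <-]; rewrite setTI; apply: open_rV_measurable.
rewrite [X in open X](_ : _ = \bigcup_(i in S) (f i @^-1` [set t | (r < t)%R])).
  apply: bigcup_open => i _; move/continuousP: (cf i); apply.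
  exact: open_gt.
apply/seteqP; split => x /=.
  rewrite in_itv/= andbT => /ereal_sup_gt[_ [i Si <-]]; rewrite lte_fin => rf.
  by exists i.
move=> [i Si] /= rf; rewrite in_itv/= andbT (@lt_le_trans _ _ (f i x)%:E) ?lte_fin//.
by apply: ereal_sup_ubound; exists i.
Qed.

(** * Laplace transforms of functions of linear growth *)

Definition exp_moments (R : realType) (n : nat) (nu : probability 'rV[R]_n R) :
    Prop :=
  forall q : R, (0 <= q)%R -> \int[nu]_y (expR (q * enorm y))%:E < +oo.

Definition grows (R : realType) (n : nat) (nu : probability 'rV[R]_n R)
    (a b : R) (f : 'rV[R]_n -> R) : Prop :=
  measurable_fun setT f /\ {ae nu, forall y, (`|f y| <= a + b * enorm y)%R}.

Definition laplace (R : realType) (n : nat) (nu : probability 'rV[R]_n R)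
    (psi : 'rV[R]_n -> R) (h : 'rV[R]_n) : R :=
  (\int[nu]_y expR (dotp h y + psi y))%R.

Definition inner_sup (R : realType) (n : nat) (nu : probability 'rV[R]_n R)
    (psi : 'rV[R]_n -> R) (x : 'rV[R]_n) : \bar R :=
  ereal_sup (range (inner_objective nu psi x)).

Lemma integrable_exp_enorm (R : realType) (n : nat)
    (nu : probability 'rV[R]_n R) (c q : R) : exp_moments nu -> (0 <= q)%R ->
  nu.-integrable setT (fun y => (c * expR (q * enorm y))%:E).
Proof.
move=> H1 q0; under eq_fun do rewrite EFinM; apply: integrableZl => //.
apply: ge0_integrable; last exact: H1.
- apply/measurable_EFinP; apply: measurableT_comp => //.
  by apply: measurable_funM => //; exact: measurable_enorm.
- by move=> y; rewrite lee_fin expR_ge0.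
Qed.

Lemma exp_dominated_integrable (R : realType) (n : nat)
    (nu : probability 'rV[R]_n R) (c q : R) (F : 'rV[R]_n -> R) :
  exp_moments nu -> (0 <= q)%R -> measurable_fun setT F ->
  {ae nu, forall y, (`|F y| <= c * expR (q * enorm y))%R} ->
  nu.-integrable setT (EFin \o F).
Proof.
move=> H1 q0 mF Fle; have ic := integrable_exp_enorm c H1 q0.
apply/integrableP; split; first exact/measurable_EFinP.
have [mg gi] := integrableP _ _ _ ic.
apply: le_lt_trans gi; apply: ae_le_integral.
- by apply: measurableT_comp => //; exact/measurable_EFinP.
- exact: measurableT_comp.
- by apply: filterS Fle => y Fy /=; rewrite lee_fin (le_trans Fy)// ler_norm.
Qed.

Lemma measurable_tilt (R : realType) (n : nat) (psi : 'rV[R]_n -> R)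
    (h : 'rV[R]_n) : measurable_fun setT psi ->
  measurable_fun setT (fun y => dotp h y + psi y)%R.
Proof. by move=> mp; apply: measurable_funD => //; exact: measurable_dotp. Qed.

Lemma grows_tilt (R : realType) (n : nat) (nu : probability 'rV[R]_n R)
    (a b : R) (psi : 'rV[R]_n -> R) (h : 'rV[R]_n) (N : R) :
  grows nu a b psi -> (enorm h <= N)%R ->
  {ae nu, forall y, (`|dotp h y + psi y| <= a + (b + N) * enorm y)%R}.
Proof.
move=> [_ gp] hN; apply: filterS gp => y gy.
apply: (le_trans (ler_normD _ _)).
have := norm_dotp_le h y; have := enorm_ge0 y; have := enorm_ge0 h; nra.
Qed.

Lemma integrable_enorm (R : realType) (n : nat) (nu : probability 'rV[R]_n R)
    (a b : R) : exp_moments nu ->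
  nu.-integrable setT (fun y => (a + b * enorm y)%:E).
Proof.
move=> H1; apply: (@exp_dominated_integrable _ _ _ (`|a| + `|b|) 1) => //.
  apply: measurable_funD => //; apply: measurable_funM => //.
  exact: measurable_enorm.
apply: aeW => y; rewrite mul1r.
have := expR_ge1Dx (enorm y); have := enorm_ge0 y.
have := ler_norm a; have := ler_norm b; have := ler_norm (- a); have := ler_norm (- b).
rewrite !normrN => *; rewrite ler_norml; nra.
Qed.

Lemma grows_integrable (R : realType) (n : nat) (nu : probability 'rV[R]_n R)
    (a b : R) (f : 'rV[R]_n -> R) : exp_moments nu -> grows nu a b f ->
  nu.-integrable setT (EFin \o f).
Proof.
move=> H1 [mf gf]; have /integrableP[mg gi] := integrable_enorm a b H1.
apply/integrableP; split; first exact/measurable_EFinP.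
apply: le_lt_trans gi; apply: ae_le_integral.
- by apply: measurableT_comp => //; exact/measurable_EFinP.
- exact: measurableT_comp.
- by apply: filterS gf => y Fy /=; rewrite lee_fin (le_trans Fy)// ler_norm.
Qed.

Lemma exp_growth_le (R : realType) (n : nat) (a c : R) (t : R) (y : 'rV[R]_n) :
  (`|t| <= a + c * enorm y -> expR t <= expR a * expR (c * enorm y))%R.
Proof. by move=> ty; rewrite -expRD ler_expR (le_trans _ ty)// ler_norm. Qed.

Lemma integrable_exp_tilt (R : realType) (n : nat)
    (nu : probability 'rV[R]_n R) (a b : R) (psi : 'rV[R]_n -> R)
    (h : 'rV[R]_n) : exp_moments nu -> (0 <= b)%R -> grows nu a b psi ->
  nu.-integrable setT (fun y => (expR (dotp h y + psi y))%:E).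
Proof.
move=> H1 b0 gp.
apply: (@exp_dominated_integrable _ _ _ (expR a) (b + enorm h)) => //.
- by rewrite addr_ge0// enorm_ge0.
- by apply: measurableT_comp => //; apply: measurable_tilt; case: gp.
- apply: filterS (grows_tilt gp (lexx (enorm h))) => y hy.
  by rewrite ger0_norm ?expR_ge0//; exact: exp_growth_le.
Qed.

Lemma integral_exp_tilt (R : realType) (n : nat)
    (nu : probability 'rV[R]_n R) (a b : R) (psi : 'rV[R]_n -> R)
    (h : 'rV[R]_n) : exp_moments nu -> (0 <= b)%R -> grows nu a b psi ->
  \int[nu]_y (expR (dotp h y + psi y))%:E = (laplace nu psi h)%:E.
Proof.
move=> H1 b0 gp; rewrite /laplace /Rintegral fineK//.
by apply: integrable_fin_num => //; exact: integrable_exp_tilt gp.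
Qed.

(* Jensen's inequality, from exp t >= 1 + t. *)
Lemma laplace_ge (R : realType) (n : nat) (nu : probability 'rV[R]_n R)
    (a b : R) (psi : 'rV[R]_n -> R) (h : 'rV[R]_n) (N : R) :
  exp_moments nu -> (0 <= b)%R -> grows nu a b psi -> (enorm h <= N)%R ->
  (expR (- fine (\int[nu]_y (a + (b + N) * enorm y)%:E)) <= laplace nu psi h)%R.
Proof.
move=> H1 b0 gp hN; have im := integrable_enorm a (b + N) H1.
set I := \int[nu]_y (a + (b + N) * enorm y)%:E.
have Ifin : I \is a fin_num := integrable_fin_num measurableT im.
rewrite -lee_fin -(integral_exp_tilt h H1 b0 gp).
have mt : measurable_fun setT (fun y => dotp h y + psi y)%R.
  by apply: measurable_tilt; case: gp.
set m := fine I.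
(* The constant is rewritten as the integral of a function lying below the integrand: exp t = exp (-
   m) exp (t + m) is at least exp (- m) (1 + t + m), and t is at least minus the linear bound, whose
   mean is [m]. *)
have -> : (expR (- m))%:E = \int[nu]_y (expR (- m) * (1 + m - (a + (b + N) * enorm y)))%:E.
  under eq_integral do rewrite EFinM.
  rewrite integralZl//; last first.
    under eq_fun do rewrite EFinB.
    by apply: integrableB => //; exact: finite_measure_integrable_cst.
  under eq_integral do rewrite EFinB.
  rewrite integralB//; last exact: finite_measure_integrable_cst.
  rewrite integral_cst// -/I -(fineK Ifin) -/m.
  rewrite [X in _ * (X - _)](_ : _ = (1 + m)%:E); last first.
    by rewrite -[RHS]mule1; congr (_ * _); exact/probability_setT.
  by rewrite -EFinB addrK -EFinM mulr1.
apply: ae_le_integral.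
- apply/measurable_EFinP; apply: measurable_funM => //; apply: measurable_funB => //.
  by move: im => /(measurable_int _)/measurable_EFinP.
- by apply/measurable_EFinP; exact: measurableT_comp.
- apply: filterS (grows_tilt gp hN) => y hy; rewrite lee_fin.
  set t := (dotp h y + psi y)%R in hy *.
  have -> : (expR t = expR (- m) * expR (t + m))%R by rewrite -expRD addrC addrK.
  rewrite ler_pM2l ?expR_gt0//; apply: le_trans (expR_ge1Dx _).
  by move: hy; rewrite ler_norml => /andP[]; lra.
Qed.

Lemma laplace_gt0 (R : realType) (n : nat) (nu : probability 'rV[R]_n R)
    (a b : R) (psi : 'rV[R]_n -> R) (h : 'rV[R]_n) :
  exp_moments nu -> (0 <= b)%R -> grows nu a b psi -> (0 < laplace nu psi h)%R.
Proof.
move=> H1 b0 gp; apply: lt_le_trans (laplace_ge H1 b0 gp (lexx (enorm h))).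
exact: expR_gt0.
Qed.

(** The constant is chosen before [psi]: one bound must serve a whole sequence of potentials with
    the same growth. *)
Lemma ln_laplace_bounded (R : realType) (n : nat)
    (nu : probability 'rV[R]_n R) (a b N : R) :
  exp_moments nu -> (0 <= b)%R -> (0 <= N)%R ->
  exists C : R, forall psi h, grows nu a b psi -> (enorm h <= N)%R ->
    (`|ln (laplace nu psi h)| <= C)%R.
Proof.
move=> H1 b0 N0.
set m := fine (\int[nu]_y (a + (b + N) * enorm y)%:E).
have bN0 : (0 <= b + N)%R by rewrite addr_ge0.
have iM := integrable_exp_enorm (expR a) H1 bN0.
set M := fine (\int[nu]_y (expR a * expR ((b + N) * enorm y))%:E).
exists (`|m| + `|ln M|)%R => psi h gp hN.
have Z0 := laplace_gt0 h H1 b0 gp.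
have ZM : (laplace nu psi h <= M)%R.
  rewrite -lee_fin -(integral_exp_tilt h H1 b0 gp) /M fineK ?(integrable_fin_num _ iM)//.
  apply: ae_le_integral.
  - apply/measurable_EFinP; apply: measurableT_comp => //.
    by apply: measurable_tilt; case: gp.
  - exact: measurable_int iM.
  - apply: filterS (grows_tilt gp hN) => y hy; rewrite lee_fin.
    exact: exp_growth_le.
have lM : (ln (laplace nu psi h) <= ln M)%R.
  by rewrite ler_ln// posrE (lt_le_trans Z0 ZM).
have lm : (- m <= ln (laplace nu psi h))%R.
  by rewrite -ler_expR lnK//; exact: laplace_ge gp hN.
have := ler_norm m; have := ler_norm (ln M).
have := normr_ge0 m; have := normr_ge0 (ln M).
by rewrite ler_norml => *; apply/andP; split; lra.
Qed.

Lemma log_laplaceE (R : realType) (n : nat) (nu : probability 'rV[R]_n R)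
    (a b : R) (psi : 'rV[R]_n -> R) (h : 'rV[R]_n) :
  exp_moments nu -> (0 <= b)%R -> grows nu a b psi ->
  log_laplace nu psi h = (ln (laplace nu psi h))%:E.
Proof.
move=> H1 b0 gp; rewrite /log_laplace (integral_exp_tilt h H1 b0 gp).
by rewrite lne_EFin//; exact: laplace_gt0 gp.
Qed.

Lemma inner_objectiveE (R : realType) (n : nat) (nu : probability 'rV[R]_n R)
    (a b : R) (psi : 'rV[R]_n -> R) (x h : 'rV[R]_n) :
  exp_moments nu -> (0 <= b)%R -> grows nu a b psi ->
  inner_objective nu psi x h = (dotp h x - ln (laplace nu psi h))%:E.
Proof. by move=> H1 b0 gp; rewrite /inner_objective (log_laplaceE h H1 b0 gp). Qed.

Lemma measurable_inner_sup (R : realType) (n : nat)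
    (nu : probability 'rV[R]_n R) (a b : R) (psi : 'rV[R]_n -> R) :
  exp_moments nu -> (0 <= b)%R -> grows nu a b psi ->
  measurable_fun setT (inner_sup nu psi).
Proof.
move=> H1 b0 gp; rewrite [X in measurable_fun _ X](_ : _ = fun x =>
    ereal_sup [set (dotp h x - ln (laplace nu psi h))%:E | h in setT]).
  apply: measurable_sup_continuous => h x.
  by apply: continuousB; [exact: dotp_continuous|exact: cst_continuous].
apply/funext => x; congr ereal_sup; apply: eq_imagel => h _.
exact: inner_objectiveE gp.
Qed.

Lemma inner_sup_ge (R : realType) (n : nat) (nu : probability 'rV[R]_n R)
    (psi : 'rV[R]_n -> R) (x h : 'rV[R]_n) :
  inner_objective nu psi x h <= inner_sup nu psi x.
Proof. by apply: ereal_sup_ubound; exists h. Qed.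

(** * Dual optimality beyond bounded continuous functions *)

Lemma le_limn_einf (R : realType) (u v : (\bar R)^nat) :
  (forall n, u n <= v n) -> limn_einf u <= limn_einf v.
Proof.
move=> uv; rewrite !limn_einf_lim; apply: lee_lim; [exact: is_cvg_einfs..|].
apply: nearW => n; apply: le_ereal_inf_tmp => _ [k nk <-].
by apply: le_trans (uv k); apply: ereal_inf_lbound; exists k.
Qed.

Lemma measurable_limn_einf d (T : measurableType d) (R : realType)
    (f : (T -> \bar R)^nat) : (forall n, measurable_fun setT (f n)) ->
  measurable_fun setT (fun x => limn_einf (f^~ x)).
Proof.
move=> mf; rewrite [X in measurable_fun _ X](_ : _ =
    fun x => - limn_esup ((fun n x => - f n x)^~ x)); last first.
  apply/funext => x; rewrite -limn_einfN; congr limn_einf.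
  by apply/funext => n /=; rewrite oppeK.
apply: (measurableT_comp (@oppe_measurable R setT)).
by apply: measurable_fun_limn_esup => n; exact: (measurableT_comp (@oppe_measurable R setT)).
Qed.

(** The integral of [f] may be +oo, as for [inner_sup]; the lower bound makes that of its negative
    part finite. The shift by [c] makes Fatou's lemma applicable. *)
Lemma integral_addc d (T : measurableType d) (R : realType)
    (P : probability T R) (f : T -> \bar R) (c : R) : (0 <= c)%R ->
  measurable_fun setT f -> (forall x, - c%:E <= f x) ->
  \int[P]_x (f x + c%:E) = \int[P]_x f x + c%:E.
Proof.
move=> c0 mf fc.
have ic : \int[P]_x (c%:E : \bar R) = c%:E.
  rewrite (@integral_cst _ _ _ P setT measurableT c%:E).
  by rewrite -[RHS]mule1; congr (_ * _); exact: probability_setT.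
have mfp := measurable_funepos mf; have mfn := measurable_funeneg mf.
have fn : \int[P]_x f^\- x \is a fin_num.
  rewrite ge0_fin_numE ?integral_ge0//.
  apply: (@le_lt_trans _ _ (\int[P]_x c%:E)); last by rewrite ic ltry.
  apply: ge0_le_integral => // x _.
  by rewrite funenegE ge_max lee_fin c0 andbT leeNl.
have fc0 x : 0 <= f x + c%:E by rewrite -leeBlDr// sub0e.
(* Moving the negative part to the left leaves only nonnegative integrands, where additivity is
   unconditional. *)
have : \int[P]_x (f x + c%:E) + \int[P]_x f^\- x = \int[P]_x f^\+ x + c%:E.
  rewrite -ge0_integralD//; last exact: emeasurable_funD.
  rewrite -[X in _ = _ + X]ic -ge0_integralD//.
  apply: eq_integral => x _; rewrite funeposE funenegE.
  have := fc x; case: (f x) => [r| |] /=.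
  - move=> _; rewrite -!EFin_max; congr EFin.
    have [r0|r0] := leP r 0%R.
      by rewrite max_l ?oppr_ge0//; lra.
    by rewrite max_r ?oppr_le0 ?ltW//; lra.
  - by move=> _; rewrite maxye /= max_r ?leNye// adde0.
  - by [].
move=> /(congr1 (fun z => z - \int[P]_x f^\- x)); rewrite addeK// => ->.
by rewrite addeAC -integralE.
Qed.

Lemma cvg_integral_dominated d (T : measurableType d) (R : realType)
    (mu : {measure set T -> \bar R}) (u : (T -> R)^nat) (f g : T -> R) :
  (forall n, measurable_fun setT (u n)) -> measurable_fun setT f ->
  (forall x, u n x @[n --> \oo] --> f x) -> mu.-integrable setT (EFin \o g) ->
  (forall n, {ae mu, forall x, (`|u n x| <= g x)%R}) ->
  (\int[mu]_x (u n x)%:E) @[n --> \oo] --> \int[mu]_x (f x)%:E.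
Proof.
move=> mu_ mf uf ig ug.
have [|||//||_ _] := @dominated_convergence _ _ _ mu setT measurableT
  (fun n x => (u n x)%:E) (EFin \o f) (EFin \o g).
- by move=> n; exact/measurable_EFinP.
- exact/measurable_EFinP.
- by apply: aeW => x _; apply: cvg_EFin; [exact: nearW|exact: uf].
- have : {ae mu, forall x n, (`|u n x| <= g x)%R} by apply: ae_foralln.
  by apply: filterS => x H n _ /=; rewrite lee_fin.
exact.
Qed.

(** Lower semicontinuity of the dual objective. The nu-integrals converge by domination; for each
    fixed h the inner objectives converge, so the supremum at the limit is at most the liminf of the
    suprema, and Fatou's lemma carries this to the mu-integrals. *)
Lemma dual_objective_limit (R : realType) (n : nat)
    (mu nu : probability 'rV[R]_n R) (a b : R) (u : ('rV[R]_n -> R)^nat)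
    (f : 'rV[R]_n -> R) (V : \bar R) :
  exp_moments nu -> (0 <= b)%R -> V \is a fin_num ->
  (forall k, grows nu a b (u k)) -> grows nu a b f ->
  (forall y, u k y @[k --> \oo] --> f y) ->
  (forall k, dual_objective mu nu (u k) <= V) -> dual_objective mu nu f <= V.
Proof.
move=> H1 b0 Vfin gu gf uf DV.
have ik k := grows_integrable H1 (gu k); have i_f := grows_integrable H1 gf.
have cI : (\int[nu]_y (u k y)%:E) @[k --> \oo] --> \int[nu]_y (f y)%:E.
  apply: cvg_integral_dominated uf (integrable_enorm a b H1) _.
  - by move=> k; case: (gu k).
  - by case: gf.
  - by move=> k; case: (gu k).
have cL h : ln (laplace nu (u k) h) @[k --> \oo] --> ln (laplace nu f h).
  apply: continuous_cvg; first by apply: continuous_ln; exact: laplace_gt0 gf.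
  apply: fine_cvg; rewrite -(integral_exp_tilt h H1 b0 gf).
  have bh : (0 <= b + enorm h)%R by rewrite addr_ge0 ?enorm_ge0.
  apply: cvg_integral_dominated (integrable_exp_enorm (expR a) H1 bh) _.
  - move=> k; apply: measurableT_comp => //.
    by apply: measurable_tilt; case: (gu k).
  - by apply: measurableT_comp => //; apply: measurable_tilt; case: gf.
  - move=> y; apply: continuous_cvg; first exact: continuous_expR.
    by apply: cvgD; [exact: cvg_cst|exact: uf].
  - move=> k; apply: filterS (grows_tilt (gu k) (lexx (enorm h))) => y hy.
    by rewrite ger0_norm ?expR_ge0//; exact: exp_growth_le.
(* The candidate h = 0 bounds every [inner_sup] below by minus a log-Laplace value at 0, uniformly
   in the sequence; hence N = 0 here. *)
have [C0 HC] := @ln_laplace_bounded _ _ nu a b 0 H1 b0 (lexx _).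
pose C := `|C0|%R; have C_ge0 : (0 <= C)%R by exact: normr_ge0.
have lb g x : grows nu a b g -> - C%:E <= inner_sup nu g x.
  move=> gg; apply: le_trans (inner_sup_ge nu g x 0%R).
  rewrite (inner_objectiveE _ _ H1 b0 gg) dotp0l sub0r -EFinN lee_fin lerN2.
  apply: le_trans (ler_norm _) _; apply: le_trans (HC _ 0%R gg _) _.
    by rewrite enorm0.
  exact: ler_norm.
pose G k x := inner_sup nu (u k) x + C%:E.
have mG k : measurable_fun setT (G k).
  apply: emeasurable_funD => //; exact: measurable_inner_sup (gu k).
have G0 k x : 0 <= G k x by rewrite -leeBlDr// sub0e; exact: lb.
have mf := measurable_inner_sup H1 b0 gf.
(* It suffices to treat one candidate h at a time, since the liminf on the right does not depend on
   h. *)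
have fG x : inner_sup nu f x + C%:E <= limn_einf (G^~ x).
  rewrite -leeBrDr//; apply: ge_ereal_sup => _ [h _ <-]; rewrite leeBrDr//.
  rewrite (inner_objectiveE _ _ H1 b0 gf).
  have cv : (dotp h x - ln (laplace nu (u k) h))%:E + C%:E @[k --> \oo] -->
      (dotp h x - ln (laplace nu f h))%:E + C%:E.
    apply: cvgeD => //; last exact: cvg_cst.
    apply: cvg_EFin; first exact: nearW.
    by apply: cvgB; [exact: cvg_cst|exact: cL].
  rewrite -(cvg_limn_einf_sup cv).1; apply: le_limn_einf => k.
  by rewrite /G leeD2r// -(inner_objectiveE _ _ H1 b0 (gu k)) inner_sup_ge.
have Ifin k : \int[nu]_y (u k y)%:E \is a fin_num by exact: integrable_fin_num (ik k).
have Ffin : \int[nu]_y (f y)%:E \is a fin_num by exact: integrable_fin_num i_f.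
rewrite /dual_objective -[X in _ + X]/(\int[mu]_x inner_sup nu f x).
rewrite -leeBrDl// -(@leeD2rE _ C%:E)//.
rewrite -integral_addc//; last by move=> x; exact: lb.
apply: (@le_trans _ _ (\int[mu]_x limn_einf (G^~ x))).
  apply: ae_le_integral; [exact: emeasurable_funD|exact: measurable_limn_einf|].
  exact: aeW.
apply: le_trans (fatou mu measurableT mG (fun k x _ => G0 k x)) _.
have cv : V - \int[nu]_y (u k y)%:E + C%:E @[k --> \oo] -->
    V - \int[nu]_y (f y)%:E + C%:E.
  apply: cvgeD => //; last exact: cvg_cst.
    by rewrite fin_num_adde_defl.
  by apply: cvgeB => //; [rewrite fin_num_adde_defr|exact: cvg_cst].
rewrite -(cvg_limn_einf_sup cv).1; apply: le_limn_einf => k.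
have -> : \int[mu]_x G k x = \int[mu]_x inner_sup nu (u k) x + C%:E.
  have mk := measurable_inner_sup H1 b0 (gu k).
  exact: (@integral_addc _ _ _ mu (inner_sup nu (u k)) C C_ge0 mk (fun x => lb _ x (gu k))).
by rewrite leeD2r// leeBrDl//; exact: DV.
Qed.

Import HBNNSimple.

(** * Bounded Borel functions as iterated limits of bounded continuous ones *)

Lemma cvg_norm_le (R : realType) (u : R^nat) (l M : R) :
  (forall k, (`|u k| <= M)%R) -> (u k @[k --> \oo] --> l)%R -> (`|l| <= M)%R.
Proof. by move=> uM /cvg_norm ul; apply: (cvgr_to_le ul); exact: nearW. Qed.

(* Closing the bounded continuous functions under bounded pointwise limits
   yields all bounded Borel functions, so a property stable under such limits
   passes from C_b to them. *)
Inductive bounded_baire (R : realType) (T : topologicalType) :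
    (T -> R) -> Prop :=
| baire_continuous f : continuous f ->
    (exists M, forall x, (`|f x| <= M)%R) -> bounded_baire f
| baire_limit u f M : (forall k, bounded_baire (u k)) ->
    (forall k x, (`|u k x| <= M)%R) ->
    (forall x, (u k x @[k --> \oo] --> f x)%R) -> bounded_baire f.

Lemma baire_cst (R : realType) (T : topologicalType) (c : R) :
  bounded_baire (fun _ : T => c).
Proof.
by apply: baire_continuous; [exact: cst_continuous|exists `|c|%R].
Qed.

Lemma baire_bounded (R : realType) (T : topologicalType) (f : T -> R) :
  bounded_baire f -> exists M, forall x, (`|f x| <= M)%R.
Proof.
elim=> [//|u {}f M _ _ uM uf]; by exists M => x; exact: (cvg_norm_le (fun k => uM k x) (uf x)).
Qed.

Lemma baire_measurable (R : realType) (n : nat) (f : 'rV[R]_n -> R) :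
  bounded_baire f -> measurable_fun setT f.
Proof.
elim=> [{}f cf _|u {}f M _ mu _ uf]; first exact: continuous_rV_measurable.
by apply: (measurable_fun_cvg mu) => x _; exact: uf.
Qed.

(** Induction on [f] with [g] continuous. It is the base case of the induction on [g] that follows,
    since both functions cannot be approximated at once when their limits are nested to different
    depths. *)
Lemma baire_lin_continuous (R : realType) (T : topologicalType) (c : R)
    (f g : T -> R) : continuous g -> (exists M, forall x, (`|g x| <= M)%R) ->
  bounded_baire f -> bounded_baire (fun x => f x + c * g x)%R.
Proof.
move=> cg [M gM]; elim=> [{}f cf [K fK]|u {}f K _ IH uK uf].
  apply: baire_continuous.
    move=> x; apply: cvgD; first exact: cf.
    by apply: cvgM; [exact: cvg_cst|exact: cg].
  exists (K + `|c| * M)%R => x; apply: le_trans (ler_normD _ _) _.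
  by rewrite lerD// normrM ler_wpM2l.
apply: (@baire_limit _ _ (fun k x => u k x + c * g x)%R _ (K + `|c| * M)%R IH).
  move=> k x; apply: le_trans (ler_normD _ _) _.
  by rewrite lerD// normrM ler_wpM2l.
by move=> x; apply: cvgD; [exact: uf|exact: cvg_cst].
Qed.

Lemma baire_lin (R : realType) (T : topologicalType) (c : R) (f g : T -> R) :
  bounded_baire f -> bounded_baire g -> bounded_baire (fun x => f x + c * g x)%R.
Proof.
move=> bf; elim=> [{}g cg gM|u {}g K _ IH uK ug]; first exact: baire_lin_continuous.
have [M fM] := baire_bounded bf.
apply: (@baire_limit _ _ (fun k x => f x + c * u k x)%R _ (M + `|c| * K)%R IH).
  move=> k x; apply: le_trans (ler_normD _ _) _.
  by rewrite lerD// normrM ler_wpM2l.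
move=> x; apply: cvgD; first exact: cvg_cst.
by apply: cvgM; [exact: cvg_cst|exact: ug].
Qed.

(** The functions min (1, k dist(x, complement of U)) are continuous and increase to the
    indicator. *)
Lemma baire_indic_open (R : realType) (n : nat) (U : set 'rV[R]_n) :
  open U -> bounded_baire (\1_U : 'rV[R]_n -> R).
Proof.
(* The whole space is set apart because the distance to the empty set is +oo; otherwise the point
   [z] of the complement makes all distances finite. *)
move=> oU; have [CU0|/set0P[z Uz]] := eqVneq (~` U) set0.
  rewrite (_ : \1_U = fun=> 1%R); first exact: baire_cst.
  by apply/funext => x; rewrite -(setCK U) CU0 setC0 indicT.
pose e x := fine (edist_inf (~` U) x).
have efin x : edist_inf (~` U) x \is a fin_num.
  rewrite ge0_fin_numE ?edist_inf_ge0//.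
  apply: le_lt_trans (edist_inf_triangle _ x z) _.
  rewrite edist_inf0// adde0 -ge0_fin_numE ?edist_ge0//.
  by apply/edist_finP; exists (`|x - z| + 1)%R => //; rewrite -ball_normE /= ltrDl.
have e0 x : (0 <= e x)%R by rewrite fine_ge0// edist_inf_ge0.
have ce : continuous e.
  move=> x; have := @edist_inf_continuous _ _ (~` U) x.
  by rewrite /continuous_at -[X in _ --> X](fineK (efin x)) => /fine_cvg.
apply: (@baire_limit _ _ (fun k x => Num.min 1 (k%:R * e x))%R _ 1%R).
- move=> k; apply: baire_continuous.
    move=> x; apply: (@continuous_min _ _ (fun=> 1%R) (fun x => k%:R * e x)%R).
      exact: cst_continuous.
    by apply: continuousM; [exact: cst_continuous|exact: ce].
  exists 1%R => x; rewrite ger0_norm ?ge_min ?lexx//.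
  by rewrite le_min ler01 mulr_ge0.
- move=> k x; rewrite ger0_norm ?ge_min ?lexx//.
  by rewrite le_min ler01 mulr_ge0.
- move=> x; rewrite indicE; case: (boolP (x \in U)) => xU /=; last first.
    have ex0 : e x = 0%R.
      by rewrite /e edist_inf0//; move: xU; rewrite notin_setE.
    rewrite ex0; under eq_fun do rewrite mulr0 min_r//; exact: cvg_cst.
  have ex0 : (0 < e x)%R.
    have /nbhs_ballP[r /= r0 rU] : nbhs x U by apply: open_nbhs_nbhs; split=> //; rewrite inE in xU.
    apply: (lt_le_trans r0); rewrite -lee_fin /e fineK//.
    apply: le_ereal_inf_tmp => _ [y Uy <-]; rewrite leNgt; apply/negP => /edist_lt_ball.
    by move=> /rU.
  apply: cvg_near_cst; near=> k; apply: min_l.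
  rewrite -ler_pdivrMr// mul1r; near: k; exact: nbhs_infty_ger.
Unshelve. all: by end_near. Qed.

(** Dynkin's theorem: open sets form a pi-system, and the sets with a Baire indicator are stable
    under proper differences and increasing unions. *)
Lemma baire_indic (R : realType) (n : nat) (A : set 'rV[R]_n) :
  measurable A -> bounded_baire (\1_A : 'rV[R]_n -> R).
Proof.
apply: (@lambda_system_subset _ (@open 'rV[R]_n) _ setT
  [set A | bounded_baire (\1_A : 'rV[R]_n -> R)]) => //.
- by move=> B C; exact: openI.
- split => //=.
  + by rewrite indicT; exact: baire_cst.
  + move=> C B BC bC bB.
    rewrite /= (_ : \1_(C `\` B) = fun x => \1_C x + (-1) * \1_B x)%R.
      exact: baire_lin.
    apply/funext => x; rewrite !indicE mulN1r in_setD.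
    case: (boolP (x \in B)) => xB /=; last by rewrite andbT subr0.
    by rewrite andbF (_ : x \in C) ?subrr//; move: xB; rewrite !inE; exact: BC.
  + move=> F ndF bF; apply: (@baire_limit _ _ (fun k => \1_(F k)) _ 1%R) => //.
      by move=> k x; rewrite indicE; case: (_ \in _); rewrite ?normr1 ?normr0.
    move=> x; apply: cvg_near_cst; rewrite !indicE.
    case: (boolP (x \in \bigcup_i F i)) => xF.
      move: xF; rewrite inE => -[i _ Fi]; exists i => // j /= ij.
      by rewrite indicE mem_set//; move/subsetPset: (ndF _ _ ij); exact.
    apply: nearW => k; rewrite indicE; case: (boolP (x \in F k)) => //.
    by rewrite inE => Fk; move: xF; rewrite notin_setE => -[]; exists k.
- by move=> B oB; exact: baire_indic_open.
Qed.

(** After a shift to nonnegative values, simple functions are linear combinations of indicators and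
    increase to the function while staying below its bound, so one more limit reaches it. *)
Lemma baire_bounded_measurable (R : realType) (n : nat) (f : 'rV[R]_n -> R) :
  measurable_fun setT f -> (exists M, forall x, (`|f x| <= M)%R) ->
  bounded_baire f.
Proof.
move=> mf [M fM].
suff {mf fM} pos (g : 'rV[R]_n -> R) K : measurable_fun setT g ->
    (forall x, (0 <= g x <= K)%R) -> bounded_baire g.
  have -> : f = (fun x => - M + 1 * (f x + M))%R.
    by apply/funext => x; rewrite mul1r addrC addrK.
  apply: baire_lin; first exact: baire_cst.
  apply: (pos _ (M + M)%R); first exact: measurable_funD.
  by move=> x; have := fM x; rewrite ler_norml => /andP[]; lra.
move=> mg gK; have mg' : measurable_fun setT (EFin \o g) by exact/measurable_EFinP.
have g0 x : setT x -> 0 <= (EFin \o g) x by rewrite lee_fin; case/andP: (gK x).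
pose u k : 'rV[R]_n -> R := nnsfun_approx measurableT mg' k.
apply: (@baire_limit R 'rV[R]_n u g K).
- move=> k; rewrite /u; set h := nnsfun_approx _ _ _.
  have [s hs] : exists s : seq R,
      (h : 'rV[R]_n -> R) = fun x => (\sum_(y <- s) y * \1_(h @^-1` [set y]) x)%R.
    exists (finmap.enum_fset (fset_set (range h))).
    by apply/funext => x; rewrite {1}fimfunE fsbig_finite.
  rewrite hs; move: s {hs}.
  elim=> [|y s IH].
    by under eq_fun do rewrite big_nil; exact: baire_cst.
  under eq_fun do rewrite big_cons addrC.
  by apply: baire_lin => //; exact: baire_indic.
- move=> k x; rewrite ger0_norm//.
  have [_ gxK] := andP (gK x); apply: le_trans gxK; rewrite -lee_fin /u.
  by rewrite nnsfun_approxE; exact: (@le_approx _ _ _ _ _ k x g0 I).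
- move=> x; have := cvg_nnsfun_approx measurableT mg' g0 (x := x) I.
  by move=> /fine_cvg.
Qed.

Lemma dual_objective_baire (R : realType) (n : nat)
    (mu nu : probability 'rV[R]_n R) (f : 'rV[R]_n -> R) :
  exp_moments nu -> dual_value mu nu \is a fin_num -> bounded_baire f ->
  dual_objective mu nu f <= dual_value mu nu.
Proof.
move=> H1 Vfin; elim=> [{}f cf [M fM]|u {}f M bu IH uM uf].
  apply: ereal_sup_ubound; exists f => //; split=> //.
  exists M; split; first exact: num_real.
  by move=> K MK x _ /=; exact: le_trans (fM x) (ltW MK).
have gM g : bounded_baire g -> (forall x, (`|g x| <= M)%R) -> grows nu M 0 g.
  by move=> bg gM; split; [exact: baire_measurable|apply: aeW => y; rewrite mul0r addr0].
apply: (@dual_objective_limit _ _ _ _ M 0 u) => //.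
  by move=> k; exact: gM.
apply: gM; first exact: baire_limit uf.
by move=> x; exact: (cvg_norm_le (fun k => uM k x) (uf x)).
Qed.

(** Truncation at levels -k and k never increases the absolute value, so the truncated functions
    share the growth constants of [f], as the limit lemma demands. *)
Lemma dual_objective_le (R : realType) (n : nat)
    (mu nu : probability 'rV[R]_n R) (a b : R) (f : 'rV[R]_n -> R) :
  exp_moments nu -> (0 <= b)%R -> dual_value mu nu \is a fin_num ->
  grows nu a b f -> dual_objective mu nu f <= dual_value mu nu.
Proof.
move=> H1 b0 Vfin gf; have [mf fab] := gf.
pose u (k : nat) x : R := Num.max (- k%:R)%R (Num.min k%:R%R (f x)).
have uk k x : (`|u k x| <= k%:R)%R.
  rewrite ler_norml /u le_max lexx /= ge_max ge_min lexx andbT.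
  by rewrite (@le_trans _ _ 0%R)// oppr_le0.
have ukf k x : (`|u k x| <= `|f x|)%R.
  have k0 := ler0n R k; have f0 := normr_ge0 (f x).
  have := lexx `|f x|%R; rewrite {1}ler_norml => /andP[f1 f2].
  rewrite ler_norml /u le_max ge_max le_min ge_min f1 f2 !orbT andbT /=.
  apply/andP; split; last lra.
  by apply/orP; right; lra.
have muk k : measurable_fun setT (u k).
  by apply: measurable_maxr => //; exact: measurable_minr.
apply: (@dual_objective_limit _ _ _ _ a b u) => //.
- move=> k; split=> //; apply: filterS fab => y; exact: le_trans.
- move=> y; apply: cvg_near_cst; near=> k.
  have : (`|f y| <= k%:R)%R by near: k; exact: nbhs_infty_ger.
  by rewrite ler_norml => /andP[fk kf]; rewrite /u min_r// max_r.
- move=> k; apply: dual_objective_baire => //.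
  by apply: baire_bounded_measurable => //; exists k%:R.
Unshelve. all: by end_near. Qed.

(** * Tilted laws *)

(** The parameter is the dual vector [k] and not the point x: the same density serves [m] with k =
    h(x), [pi] with k = xbar, and the glued law on triples. *)
Definition tilt (R : realType) (n : nat) (nu : probability 'rV[R]_n R)
    (psi : 'rV[R]_n -> R) (k y : 'rV[R]_n) : R :=
  (expR (dotp k y + psi y) / laplace nu psi k)%R.

Lemma tilt_ge0 (R : realType) (n : nat) (nu : probability 'rV[R]_n R)
    (psi : 'rV[R]_n -> R) (k y : 'rV[R]_n) : (0 <= tilt nu psi k y)%R.
Proof.
by rewrite /tilt divr_ge0 ?expR_ge0// /laplace Rintegral_ge0.
Qed.

Lemma measurable_tilt_density (R : realType) (n : nat)
    (nu : probability 'rV[R]_n R) (psi : 'rV[R]_n -> R) (k : 'rV[R]_n) :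
  measurable_fun setT psi -> measurable_fun setT (tilt nu psi k).
Proof.
move=> mp; apply: measurable_funM => //.
by apply: measurableT_comp => //; exact: measurable_tilt.
Qed.

Lemma integral_tilt (R : realType) (n : nat) (nu : probability 'rV[R]_n R)
    (a b : R) (psi : 'rV[R]_n -> R) (k : 'rV[R]_n) :
  exp_moments nu -> (0 <= b)%R -> grows nu a b psi ->
  \int[nu]_y (tilt nu psi k y)%:E = 1.
Proof.
move=> H1 b0 gp; have Z0 := laplace_gt0 k H1 b0 gp.
under eq_integral do rewrite /tilt mulrC EFinM.
rewrite integralZl//; last exact: integrable_exp_tilt gp.
by rewrite (integral_exp_tilt k H1 b0 gp) -EFinM mulVf// gt_eqF.
Qed.

Lemma tilt_exp_moments (R : realType) (n : nat)
    (nu Q : probability 'rV[R]_n R) (a b : R) (psi : 'rV[R]_n -> R)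
    (k : 'rV[R]_n) :
  exp_moments nu -> (0 <= b)%R -> grows nu a b psi ->
  has_density Q nu (tilt nu psi k) -> exp_moments Q.
Proof.
move=> H1 b0 gp hQ q q0; have Z0 := laplace_gt0 k H1 b0 gp.
have mq : measurable_fun setT (fun y : 'rV[R]_n => expR (q * enorm y)).
  apply: measurableT_comp => //.
  by apply: measurable_funM => //; exact: measurable_enorm.
rewrite (density_ge0_integral hQ); last 3 first.
- exact: tilt_ge0.
- exact/measurable_EFinP.
- by move=> y; rewrite lee_fin expR_ge0.
under eq_integral do rewrite -EFinM.
apply: integrable_lty => //.
apply: (@exp_dominated_integrable _ _ _ (expR a / laplace nu psi k)
  (q + (b + enorm k))) => //.
- by rewrite !addr_ge0// enorm_ge0.
- apply: measurable_funM => //; apply: measurable_tilt_density.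
  by case: gp.
- apply: filterS (grows_tilt gp (lexx (enorm k))) => y hy.
  rewrite ger0_norm; last by rewrite mulr_ge0 ?expR_ge0 ?tilt_ge0.
  rewrite /tilt mulrDl [expR (q * _ + _)]expRD [leRHS]mulrCA ler_pM2l ?expR_gt0// [leRHS]mulrAC.
  by rewrite ler_pM2r ?invr_gt0//; exact: exp_growth_le.
Qed.

Lemma tilt_probability (R : realType) (n : nat)
    (nu : probability 'rV[R]_n R) (a b : R) (psi : 'rV[R]_n -> R)
    (k : 'rV[R]_n) :
  exp_moments nu -> (0 <= b)%R -> grows nu a b psi ->
  exists Q : probability 'rV[R]_n R, has_density Q nu (tilt nu psi k).
Proof.
move=> H1 b0 gp; apply: density_probability.
- by apply: measurable_tilt_density; case: gp.
- exact: tilt_ge0.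
- exact: integral_tilt gp.
Qed.

Lemma integrable_dotp_exp_moments (R : realType) (n : nat) (Q : probability 'rV[R]_n R)
    (v : 'rV[R]_n) : exp_moments Q ->
  Q.-integrable setT (fun y => (dotp v y)%:E).
Proof.
move=> H1; apply: (@integrable_le_norm _ _ _ _ _ (fun y => 0 + enorm v * enorm y)%R).
- exact: measurable_dotp.
- by move=> y; rewrite add0r norm_dotp_le.
- exact: integrable_enorm.
Qed.

(** Stands in for differentiation under the integral sign: with s = t (v.y) and 0 < t <= 1, the
    error is t^2 times a fixed integrable function. *)
Lemma expR_le_quadratic (R : realType) (s : R) :
  (expR s <= 1 + s + s ^+ 2 * expR `|s|)%R.
Proof.
have es : (expR s - 1 <= s * expR s)%R.
  have := expR_ge1Dx (- s); rewrite expRN => H.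
  have e0 := expR_gt0 s.
  have : ((1 - s) * expR s <= 1)%R by rewrite -ler_pdivlMr// mul1r.
  by lra.
have es' := expR_ge1Dx s.
have [s0|s0] := leP 0%R s.
  by rewrite ger0_norm//; nra.
rewrite ltr0_norm//.
have : (1 <= expR (- s))%R by rewrite -expR0 ler_expR; lra.
have : (expR s <= 1)%R by rewrite -expR0 ler_expR; lra.
by nra.
Qed.

(** The integral is the ratio of the Laplace transforms at k + v and k. Comparing the candidates k
    and k + v bounds v.x by the logarithm of that ratio, and 1 + s <= exp s concludes. *)
Lemma tilt_exp_le (R : realType) (n : nat) (nu Q : probability 'rV[R]_n R)
    (a b : R) (psi : 'rV[R]_n -> R) (x k v : 'rV[R]_n) :
  exp_moments nu -> (0 <= b)%R -> grows nu a b psi ->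
  has_density Q nu (tilt nu psi k) -> inner_solution nu psi x k ->
  (1 + dotp v x)%:E <= \int[Q]_y (expR (dotp v y))%:E.
Proof.
move=> H1 b0 gp hQ [_ /(_ (k + v)%R I)].
have Zk := laplace_gt0 k H1 b0 gp; have Zkv := laplace_gt0 (k + v)%R H1 b0 gp.
rewrite !(inner_objectiveE _ _ H1 b0 gp) lee_fin dotpDl => le1.
have -> : \int[Q]_y (expR (dotp v y))%:E =
    (laplace nu psi (k + v) / laplace nu psi k)%:E.
  rewrite (density_ge0_integral hQ); last 3 first.
  - exact: tilt_ge0.
  - by apply/measurable_EFinP; apply: measurableT_comp => //; exact: measurable_dotp.
  - by move=> y; rewrite lee_fin expR_ge0.
  rewrite mulrC EFinM -(integral_exp_tilt (k + v)%R H1 b0 gp).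
  rewrite -integralZl//; last exact: integrable_exp_tilt gp.
  apply: eq_integral => y _; rewrite -!EFinM /tilt; congr EFin.
  rewrite mulrA -expRD mulrC; congr (_ * expR _)%R.
  by rewrite dotpDl addrA (addrC (dotp v y)).
rewrite lee_fin; apply: le_trans (expR_ge1Dx _) _.
move: (laplace nu psi k) (laplace nu psi (k + v)%R) (dotp k x) (dotp v x)
  Zk Zkv le1 => p q r s p0 q0 le1.
rewrite -[leRHS]lnK ?posrE ?divr_gt0// ler_expR lnM ?posrE ?invr_gt0// lnV ?posrE//.
clear -le1; lra.
Qed.

(* First-order condition of the inner problem. *)
Lemma tilt_barycenter (R : realType) (n : nat)
    (nu Q : probability 'rV[R]_n R)
    (a b : R) (psi : 'rV[R]_n -> R) (x k : 'rV[R]_n) (i : 'I_n) :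
  exp_moments nu -> (0 <= b)%R -> grows nu a b psi ->
  has_density Q nu (tilt nu psi k) -> inner_solution nu psi x k ->
  \int[Q]_y (y ord0 i)%:E = (x ord0 i)%:E.
Proof.
move=> H1 b0 gp hQ sol; have HQ := tilt_exp_moments H1 b0 gp hQ.
have key v : (dotp v x)%:E <= \int[Q]_y (dotp v y)%:E.
  have iv := integrable_dotp_exp_moments v HQ.
  have vfin : \int[Q]_y (dotp v y)%:E \is a fin_num by exact: integrable_fin_num iv.
  pose G y := (dotp v y ^+ 2 * expR `|dotp v y|)%R.
  have md : measurable_fun setT (dotp v) by exact: measurable_dotp.
  have iG : Q.-integrable setT (EFin \o G).
    (* The rate 2 + |v| comes from |y|^2 <= exp (2 |y|) and |v.y| <= |v| |y|. *)
    apply: (@exp_dominated_integrable _ _ _ (enorm v ^+ 2) (2 + enorm v)) => //.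
    - by rewrite addr_ge0// enorm_ge0.
    - apply: measurable_funM; first exact: measurable_funX.
      by apply: measurableT_comp => //; exact: measurableT_comp.
    - apply: aeW => y; rewrite ger0_norm; last by rewrite mulr_ge0 ?sqr_ge0 ?expR_ge0.
      rewrite mulrDl expRD mulrA; apply: ler_pM; rewrite ?sqr_ge0 ?expR_ge0//.
        rewrite -real_normK ?num_real//.
        apply: (@le_trans _ _ ((enorm v * enorm y) ^+ 2)%R).
          by rewrite ler_pXn2r ?nnegrE ?mulr_ge0 ?enorm_ge0// norm_dotp_le.
        rewrite exprMn ler_wpM2l ?sqr_ge0// mulrC expRM_natr.
        rewrite ler_pXn2r ?nnegrE ?expR_ge0 ?enorm_ge0//.
        by have := expR_ge1Dx (enorm y); lra.
      by rewrite ler_expR norm_dotp_le.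
  have Gfin : \int[Q]_y (G y)%:E \is a fin_num by exact: integrable_fin_num iG.
  rewrite -(fineK vfin) lee_fin; set m := fine _; set K := fine (\int[Q]_y (G y)%:E).
  have K0 : (0 <= K)%R.
    apply: fine_ge0; apply: integral_ge0 => y _.
    by rewrite lee_fin mulr_ge0 ?sqr_ge0 ?expR_ge0.
  (* The previous lemma along t v, with the quadratic bound on its right side; 1 cancels and one
     divides by t. *)
  have tle t : (0 < t <= 1)%R -> (dotp v x <= m + t * K)%R.
    move=> /andP[t0 t1]; have := tilt_exp_le (t *: v)%R H1 b0 gp hQ sol.
    have le2 : \int[Q]_y (expR (dotp (t *: v)%R y))%:E <=
        (1 + t * m + t ^+ 2 * K)%:E.
      have -> : (1 + t * m + t ^+ 2 * K)%:E =
          \int[Q]_y (1 + t * dotp v y + t ^+ 2 * G y)%:E.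
        under eq_integral do rewrite EFinD.
        have i1 : Q.-integrable setT (fun=> 1%:E : \bar R).
          exact: finite_measure_integrable_cst.
        have i2 : Q.-integrable setT (fun y => (t * dotp v y)%:E).
          by under eq_fun do rewrite EFinM; exact: integrableZl.
        have i3 : Q.-integrable setT (fun y => (t ^+ 2 * G y)%:E).
          by under eq_fun do rewrite EFinM; exact: integrableZl.
        rewrite integralD//; last first.
          by under eq_fun do rewrite EFinD; exact: integrableD.
        under eq_integral do rewrite EFinD.
        rewrite integralD//.
        under [X in _ = _ + X + _]eq_integral do rewrite EFinM.
        under [X in _ = _ + X]eq_integral do rewrite EFinM.
        rewrite !integralZl// integral_cst// mul1e -(fineK vfin) -(fineK Gfin).
        by rewrite !EFinD !EFinM; congr (_ + _ + _); exact/esym/probability_setT.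
      apply: ae_le_integral.
      - apply/measurable_EFinP; apply: measurableT_comp => //.
        exact: measurable_dotp.
      - apply/measurable_EFinP; apply: measurable_funD.
          by apply: measurable_funD => //; exact: measurable_funM.
        apply: measurable_funM => //.
        by move: iG => /(measurable_int _)/measurable_EFinP.
      - apply: aeW => y; rewrite lee_fin dotpZl.
        apply: le_trans (expR_le_quadratic _) _.
        rewrite lerD2l exprMn -mulrA ler_wpM2l ?sqr_ge0// ler_wpM2l ?sqr_ge0//.
        by rewrite ler_expR normrM gtr0_norm// ler_piMl.
    move=> /le_trans/(_ le2); rewrite lee_fin dotpZl -addrA lerD2l => H.
    by rewrite -(ler_pM2l t0) mulrDr mulrA -expr2.
  apply/ler_addgt0Pr => e e0.
  (* This choice makes t K at most [e]; the denominator K + 1 is positive even when K = 0. *)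
  pose t := Num.min 1%R (e / (K + 1))%R.
  have K1 : (0 < K + 1)%R by lra.
  have t0 : (0 < t)%R by rewrite lt_min ltr01 divr_gt0.
  have t1 : (t <= 1)%R by rewrite ge_min lexx.
  apply: le_trans (tle t _) _; first by rewrite t0.
  rewrite lerD2l; have : (t <= e / (K + 1))%R by rewrite ge_min lexx orbT.
  rewrite ler_pdivlMr// => H; apply: le_trans H; rewrite ler_pM2l//; lra.
(* Applied to a basis vector and its opposite, the one-sided bound becomes an equality. *)
have := key (delta_mx ord0 i); have := key (- delta_mx ord0 i)%R.
rewrite dotpNl dotp_delta.
under eq_integral do rewrite dotpNl dotp_delta EFinN.
under [in X in _ -> _ <= X -> _]eq_integral do rewrite dotp_delta.
rewrite integralN ?EFinN ?leeN2 => [h1 h2|]; first by apply/eqP; rewrite eq_le h1 h2.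
have := integrable_dotp_exp_moments (delta_mx ord0 i) HQ.
under eq_fun do rewrite dotp_delta.
exact: integrable_add_def.
Qed.

(** * The tilted kernel and its second marginal *)

Lemma probability_integral_cst d (T : measurableType d) (R : realType)
    (P : probability T R) (c : \bar R) : \int[P]_x c = c.
Proof.
rewrite integral_cst// -[RHS]mule1; congr (_ * _); exact: probability_setT.
Qed.

Lemma measurable_laplace (R : realType) (n : nat)
    (nu : probability 'rV[R]_n R) (psi : 'rV[R]_n -> R) :
  measurable_fun setT psi -> measurable_fun setT (laplace nu psi).
Proof.
move=> mp; pose g (z : 'rV[R]_n * 'rV[R]_n) := (expR (dotp z.1 z.2 + psi z.2))%:E.
rewrite (_ : laplace nu psi = fine \o fubini_F nu g)//.
apply: measurableT_comp; first exact: fine_measurable.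
apply: measurable_fun_fubini_tonelli_F => [|z]; last by rewrite lee_fin expR_ge0.
apply/measurable_EFinP; apply: measurableT_comp => //.
by apply: measurable_funD; [exact: measurable_dotp|exact: measurableT_comp].
Qed.

Lemma measurable_tilt_pair (R : realType) (n : nat)
    (nu : probability 'rV[R]_n R) (psi : 'rV[R]_n -> R)
    d (T : measurableType d) (h : T -> 'rV[R]_n) :
  measurable_fun setT psi -> measurable_fun setT h ->
  measurable_fun setT (fun z : T * 'rV[R]_n => tilt nu psi (h z.1) z.2).
Proof.
move=> mp mh; have mh1 : measurable_fun setT (fun z : T * 'rV[R]_n => h z.1).
  exact: measurableT_comp.
apply: measurable_funM.
  apply: measurableT_comp => //; apply: measurable_funD.
    exact: measurable_dotp.
  exact: measurableT_comp.
have L0 k : (0 <= laplace nu psi k)%R by rewrite /laplace Rintegral_ge0.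
rewrite (_ : (fun _ => _) = (fun z => laplace nu psi (h z.1) `^ (- 1)))%R; last first.
  by apply/funext => z; rewrite powR_inv1.
apply: (measurableT_comp (@measurable_powR R (-1)%R)).
exact: measurableT_comp (measurable_laplace _ mp) mh1.
Qed.

Lemma tilt_kernel (R : realType) (n : nat) (nu : probability 'rV[R]_n R)
    (a b : R) (psi : 'rV[R]_n -> R) d (T : measurableType d)
    (h : T -> 'rV[R]_n) :
  exp_moments nu -> (0 <= b)%R -> grows nu a b psi -> measurable_fun setT h ->
  exists kappa : R.-pker T ~> 'rV[R]_n, forall x A,
    kappa x A = \int[nu]_(y in A) (tilt nu psi (h x) y)%:E.
Proof.
move=> H1 b0 gp mh.
have [kappa hk] := @density_kernel _ _ _ _ _ nu
  (fun z : T * 'rV[R]_n => tilt nu psi (h z.1) z.2)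
  (measurable_tilt_pair nu (proj1 gp) mh) (fun z => tilt_ge0 _ _ _ _)
  (fun x => integral_tilt (h x) H1 b0 gp).
by exists kappa.
Qed.

Lemma inner_sup_solution (R : realType) (n : nat)
    (nu : probability 'rV[R]_n R) (psi : 'rV[R]_n -> R) (x k : 'rV[R]_n) :
  inner_solution nu psi x k -> inner_sup nu psi x = inner_objective nu psi x k.
Proof.
move=> [_ kmax]; apply/eqP; rewrite eq_le inner_sup_ge andbT.
by apply: ge_ereal_sup => _ [k' _ <-]; exact: kmax.
Qed.

Lemma integrable_bounded_below d (T : measurableType d) (R : realType)
    (P : probability T R) (f : T -> \bar R) (c : R) : (0 <= c)%R ->
  measurable_fun setT f -> (forall x, - c%:E <= f x) ->
  \int[P]_x f x < +oo -> P.-integrable setT f.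
Proof.
move=> c0 mf fc fi; have fc0 x : 0 <= f x + c%:E by rewrite -leeBlDr// sub0e.
have : P.-integrable setT (fun x => (f x + c%:E) - c%:E).
  apply: integrableB => //; last exact: finite_measure_integrable_cst.
  apply: ge0_integrable => //; first exact: emeasurable_funD.
  by rewrite integral_addc// lte_add_pinfty// ltry.
by under eq_fun do rewrite addeK//.
Qed.

Lemma grows_indic (R : realType) (n : nat) (nu : probability 'rV[R]_n R)
    (a b e : R) (psi : 'rV[R]_n -> R) (A : set 'rV[R]_n) :
  grows nu a b psi -> measurable A ->
  grows nu (a + `|e|) b (fun y => psi y + e * \1_A y)%R.
Proof.
move=> gp mA; split; first by apply: measurable_funD; [case: gp|exact: measurable_funM].
apply: filterS (proj2 gp) => y py; apply: le_trans (ler_normD _ _) _.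
rewrite addrAC lerD// normrM ler_piMr// indicE.
by case: (_ \in _); rewrite ?normr1 ?normr0.
Qed.

(** Perturbing by e 1_A multiplies the Laplace transform by exactly 1 + (exp e - 1) Q(A), and ln (1
    + s) <= s. *)
Lemma ln_laplace_indic_le (R : realType) (n : nat)
    (nu Q : probability 'rV[R]_n R)
    (a b e : R) (psi : 'rV[R]_n -> R) (k : 'rV[R]_n) (A : set 'rV[R]_n) :
  exp_moments nu -> (0 <= b)%R -> grows nu a b psi -> measurable A ->
  has_density Q nu (tilt nu psi k) ->
  (0 < laplace nu (fun y => psi y + e * \1_A y) k)%R ->
  (ln (laplace nu (fun y => psi y + e * \1_A y) k) <=
   ln (laplace nu psi k) + (expR e - 1) * fine (Q A))%R.
Proof.
move=> H1 b0 gp mA hQ Z'0; have Z0 := laplace_gt0 k H1 b0 gp.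
have QAfin : Q A \is a fin_num by exact: fin_num_measure.
suff H : (laplace nu (fun y => psi y + e * \1_A y) k =
    laplace nu psi k * (1 + (expR e - 1) * fine (Q A)))%R.
  have : (0 < 1 + (expR e - 1) * fine (Q A))%R by move: Z'0; rewrite H pmulr_rgt0.
  rewrite H; move: (_ * fine _)%R (laplace nu psi k) Z0 => s z z0 s0.
  rewrite lnM ?posrE// lerD2l.
  by rewrite -ler_expR lnK ?posrE// expR_ge1Dx.
have i1 : Q.-integrable setT (fun=> 1%:E : \bar R).
  exact: finite_measure_integrable_cst.
have iA : Q.-integrable setT (fun y => (\1_A y)%:E) by exact: integrable_indic.
have iA' : Q.-integrable setT (fun y => ((expR e - 1) * \1_A y)%:E).
  by under eq_fun do rewrite EFinM; exact: integrableZl.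
have : \int[Q]_y (1 + (expR e - 1) * \1_A y)%:E =
    (1 + (expR e - 1) * fine (Q A))%:E.
  under eq_integral do rewrite EFinD.
  rewrite integralD// probability_integral_cst.
  under [X in _ + X]eq_integral do rewrite EFinM.
  by rewrite integralZl// integral_indic// setIT [RHS]EFinD [in RHS]EFinM fineK//.
rewrite (density_integral hQ); last 2 first.
- exact: tilt_ge0.
- by apply/measurable_EFinP; apply: measurable_funD => //; exact: measurable_funM.
move=> HI; have -> : (1 + (expR e - 1) * fine (Q A) =
    fine (\int[nu]_y ((1 + (expR e - 1) * \1_A y)%:E * (tilt nu psi k y)%:E)))%R.
  by rewrite HI.
have -> : \int[nu]_y ((1 + (expR e - 1) * \1_A y)%:E * (tilt nu psi k y)%:E) =
    \int[nu]_y ((laplace nu psi k)^-1%:E *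
      (expR (dotp k y + (psi y + e * \1_A y)))%:E).
  apply: eq_integral => y _; rewrite -!EFinM; congr EFin.
  rewrite /tilt mulrA mulrC; congr (_ * _)%R.
  rewrite [in RHS]addrA [in RHS]expRD [RHS]mulrC; congr (_ * _)%R.
  rewrite indicE; case: (_ \in _); rewrite ?mulr1 ?mulr0 ?expR0 ?addr0//.
  by rewrite addrC subrK.
have g' := grows_indic e gp mA.
rewrite integralZl//; last exact: integrable_exp_tilt g'.
rewrite (integral_exp_tilt k H1 b0 g') -EFinM /= mulrA divff ?mul1r//.
by rewrite gt_eqF.
Qed.

Lemma inner_sup_integrable (R : realType) (n : nat)
    (mu nu : probability 'rV[R]_n R) (a b : R) (psi : 'rV[R]_n -> R) :
  exp_moments nu -> (0 <= b)%R -> grows nu a b psi ->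
  dual_objective mu nu psi \is a fin_num ->
  mu.-integrable setT (inner_sup nu psi).
Proof.
move=> H1 b0 gp; rewrite /dual_objective fin_numD => /andP[_ Sfin].
have mS := measurable_inner_sup H1 b0 gp.
have [C0 HC] := @ln_laplace_bounded _ _ nu a b 0 H1 b0 (lexx _).
apply: (@integrable_bounded_below _ _ _ _ _ `|C0|) => //; last first.
  by rewrite ltey_eq Sfin.
move=> x; apply: le_trans (inner_sup_ge nu psi x 0%R).
rewrite (inner_objectiveE _ _ H1 b0 gp) dotp0l sub0r -EFinN lee_fin lerN2.
apply: le_trans (ler_norm _) _; apply: le_trans (HC _ 0%R gp _) (ler_norm _).
by rewrite enorm0.
Qed.

(* Perturbing psi to psi + e 1_A and letting e decrease to 0: optimality of psi
   forces the second marginal of mu(dx) kappa_x(dy) to be nu. *)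
Lemma tilt_marginal (R : realType) (n : nat) (mu nu : probability 'rV[R]_n R)
    (a b : R) (psi : 'rV[R]_n -> R) (h : 'rV[R]_n -> 'rV[R]_n)
    (kappa : R.-pker 'rV[R]_n ~> 'rV[R]_n) (A : set 'rV[R]_n) :
  exp_moments nu -> (0 <= b)%R -> grows nu a b psi ->
  dual_value mu nu \is a fin_num ->
  dual_objective mu nu psi = dual_value mu nu ->
  {ae mu, forall x, inner_solution nu psi x (h x)} ->
  (forall x A, measurable A ->
    kappa x A = \int[nu]_(y in A) (tilt nu psi (h x) y)%:E) ->
  measurable A -> \int[mu]_x kappa x A = nu A.
Proof.
move=> H1 b0 gp Vfin DV sol hk mA.
have kle1 x B : measurable B -> kappa x B <= 1.
  by move=> mB; rewrite -(prob_kernel x (s := kappa)) le_measure// inE.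
have kfin x B : measurable B -> kappa x B \is a fin_num.
  by move=> mB; rewrite ge0_fin_numE// (le_lt_trans (kle1 x B mB))// ltry.
have mk B : measurable B -> measurable_fun setT (kappa ^~ B).
  exact: measurable_kernel.
have ik B : measurable B -> mu.-integrable setT (kappa ^~ B).
  move=> mB; apply: ge0_integrable => //; first exact: mk.
  apply: (@le_lt_trans _ _ (\int[mu]_x 1)).
    by apply: ge0_le_integral => // [|x _]; [exact: mk|exact: kle1].
  by rewrite probability_integral_cst ltry.
have Mfin B : measurable B -> \int[mu]_x kappa x B \is a fin_num.
  by move=> mB; apply: integrable_fin_num => //; exact: ik.
(* One inequality for all sets is enough: both sides have total mass 1, so the bound for the
   complement gives the reverse one. *)
suff key B : measurable B -> nu B <= \int[mu]_x kappa x B.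
  have mCA := measurableC mA.
  have nuC : nu A + nu (~` A) = 1 by rewrite probability_setC// addeC subeK// fin_num_measure.
  have MC : \int[mu]_x kappa x A + \int[mu]_x kappa x (~` A) = 1.
    rewrite -integralD//; [|exact: ik..].
    rewrite -[RHS](probability_integral_cst mu 1); apply: eq_integral => x _.
    have kU := @measureU _ _ _ (kappa x) A (~` A) mA mCA (setICr A).
    by rewrite -[RHS](prob_kernel x (s := kappa)) -(setUCr A) -kU.
  have := key _ mA; have := key _ mCA; move: nuC MC.
  have nA : nu A \is a fin_num by exact: fin_num_measure.
  have nCA : nu (~` A) \is a fin_num by exact: fin_num_measure.
  rewrite -(fineK (Mfin _ mA)) -(fineK (Mfin _ mCA)) -(fineK nA) -(fineK nCA).
  move=> [e1] [e2]; rewrite !lee_fin => l1 l2.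
  by congr EFin; clear -e1 e2 l1 l2; lra.
move=> mB; have nB : nu B \is a fin_num by exact: fin_num_measure.
have := Mfin _ mB; move ME : (\int[mu]_x kappa x B) => M MBfin.
have n1 : (fine (nu B) <= 1)%R by rewrite -lee_fin fineK// probability_le1.
have n0 : (0 <= fine (nu B))%R by rewrite fine_ge0.
have ip := grows_integrable H1 gp.
have Pfin : \int[nu]_y (psi y)%:E \is a fin_num by exact: integrable_fin_num ip.
have Sfin : \int[mu]_x inner_sup nu psi x \is a fin_num.
  by move: Vfin; rewrite -DV /dual_objective fin_numD => /andP[].
have mS := measurable_inner_sup H1 b0 gp.
have iS : mu.-integrable setT (inner_sup nu psi).
  by apply: inner_sup_integrable H1 b0 gp _; rewrite DV.
(* Optimality gives e nu(B) <= (exp e - 1) M. The factor 1 - e appears through (1 - e) (exp e - 1)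
   <= e, which permits division by e without derivatives. *)
have step e : (0 < e < 1)%R -> ((1 - e) * fine (nu B) <= fine M)%R.
  move=> /andP[e0 e1]; have gp' := grows_indic e gp mB.
  set psi' := (fun y => psi y + e * \1_B y)%R in gp'.
  pose r x := ((expR e - 1)%:E * kappa x B).
  have ir : mu.-integrable setT r by apply: integrableZl => //; exact: ik.
  have rE : \int[mu]_x r x = (expR e - 1)%:E * M by rewrite integralZl// ?ME//; exact: ik.
  have mr : measurable_fun setT r by exact: measurable_int ir.
  (* [h x] is kept as a candidate, perhaps no longer optimal, in the perturbed inner problem. *)
  have le1 : \int[mu]_x (inner_sup nu psi x - r x) <= \int[mu]_x inner_sup nu psi' x.
    apply: ae_le_integral; first exact: emeasurable_funB.
      exact: measurable_inner_sup gp'.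
    apply: filterS sol => x solx; rewrite (inner_sup_solution solx).
    rewrite (inner_objectiveE _ _ H1 b0 gp).
    apply: le_trans (inner_sup_ge nu psi' x (h x)).
    rewrite (inner_objectiveE _ _ H1 b0 gp').
    have [Q hQ] := tilt_probability (h x) H1 b0 gp.
    have QE : kappa x B = Q B by rewrite hk//; apply/esym; exact: (proj2 hQ).
    have := ln_laplace_indic_le H1 b0 gp mB hQ (laplace_gt0 (h x) H1 b0 gp').
    rewrite /r -(fineK (kfin x B mB)) -EFinM -EFinB lee_fin QE -/psi'.
    move: (ln (laplace nu psi' (h x))) (ln (laplace nu psi (h x)))
      (dotp (h x) x) (_ * fine _)%R => p q t s le1; clear -le1; lra.
  have := dual_objective_le H1 b0 Vfin gp'.
  rewrite -DV /dual_objective -[X in _ + X <= _]/(\int[mu]_x inner_sup nu psi' x).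
  rewrite -[X in _ <= _ + X]/(\int[mu]_x inner_sup nu psi x).
  have -> : \int[nu]_y (psi' y)%:E = \int[nu]_y (psi y)%:E + (e * fine (nu B))%:E.
    have iB : nu.-integrable setT (fun y => (\1_B y)%:E) by exact: integrable_indic.
    under eq_integral do rewrite EFinD EFinM.
    rewrite integralD//; last exact: integrableZl.
    by rewrite integralZl// integral_indic// setIT EFinM fineK.
  rewrite -addeA leeD2lE// => le2.
  have := le_trans (leeD2l (e * fine (nu B))%:E le1) le2.
  rewrite integralB// rE -(fineK Sfin) -(fineK MBfin) -EFinM -EFinB -EFinD lee_fin.
  move=> {le1 le2}; set s := fine (\int[mu]_x _); move=> le3.
  have M0 : (0 <= fine M)%R by rewrite -ME fine_ge0// integral_ge0.
  have ee : ((1 - e) * (expR e - 1) <= e)%R.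
    have := expR_ge1Dx (- e); rewrite expRN => H.
    have e0' := expR_gt0 e.
    have : ((1 - e) * expR e <= 1)%R by rewrite -ler_pdivlMr// mul1r.
    by clear; lra.
  rewrite -(ler_pM2l e0); clear -le3 ee M0 e1 e0; nra.
rewrite -(fineK nB) -(fineK MBfin) lee_fin.
apply/ler_addgt0Pr => e e0.
(* As nu(B) <= 1, the loss t nu(B) is at most [e]; the bound 1 / 2 keeps t inside the range of
   [step]. *)
pose t := Num.min (1 / 2)%R e.
have t0 : (0 < t)%R by rewrite lt_min e0 andbT; clear; lra.
have t1 : (t < 1)%R by rewrite gt_min; apply/orP; left; clear; lra.
have te : (t <= e)%R by rewrite ge_min lexx orbT.
have := step t; rewrite t0 t1 => /(_ isT).
by clear -n1 n0 t0 t1 te; nra.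
Qed.

(** * Measurable selection of the inner maximizer *)

(** The points of norm at most m and at distance at least 1 / (m + 1) from the complement. This
    reduces measurability of the maximizer to preimages of compact sets, on which suprema are
    attained. *)
Lemma open_sigma_compact (R : realType) (n : nat) (U : set 'rV[R]_n) : open U ->
  exists K : (set 'rV[R]_n)^nat, (forall m, compact (K m)) /\ U = \bigcup_m K m.
Proof.
move=> oU; pose d x := edist_inf (~` U) x.
pose K m := [set x : 'rV[R]_n | (`|x| <= m%:R)%R] `&`
  [set x | (m.+1%:R^-1)%:E <= d x].
exists K; split.
  move=> m; apply: bounded_closed_compact.
    exists m%:R; split; first exact: num_real.
    by move=> r mr x [/= xm _]; exact: le_trans xm (ltW mr).
  apply: closedI.
    have /continuous_closedP cn := @norm_continuous _ 'rV[R]_n.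
    exact: (cn _ (@closed_le _ m%:R)).
  have /continuous_closedP cd := @edist_inf_continuous _ _ (~` U).
  exact: (cd _ (@closed_ereal_le_ereal _ (m.+1%:R^-1)%:E)).
apply/seteqP; split => x.
  move=> Ux; have /nbhs_ballP[r /= r0 rU] : nbhs x U by apply: open_nbhs_nbhs.
  have [m1 _ hm1] := @nbhs_infty_ger R `|x|%R.
  have [m2 _ hm2] := @nbhs_infty_ger R (r^-1)%R.
  exists (maxn m1 m2) => //; split => /=.
    by apply: hm1 => /=; exact: leq_maxl.
  apply: le_ereal_inf_tmp => _ [y Uy <-]; rewrite leNgt; apply/negP => lt1.
  apply: Uy; apply: rU; apply: (@edist_lt_ball _ _ r (x, y)).
  apply: (lt_le_trans lt1); rewrite lee_fin invf_ple ?posrE//.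
  apply: (@le_trans _ _ (maxn m1 m2)%:R); last by rewrite ler_nat.
  by apply: hm2 => /=; exact: leq_maxr.
move=> [m _ [_ /= dx]]; apply: contrapT => Ux.
by move: dx; rewrite /d edist_inf0// lee_fin invr_le0 leNgt ltr0n.
Qed.

Lemma expR_dist (R : realType) (s t : R) :
  (`|expR s - expR t| <= `|s - t| * (expR s + expR t))%R.
Proof.
wlog st : s t / (t <= s)%R => [H|].
  have [ts|/ltW st] := leP t s; first exact: H.
  by rewrite distrC (distrC s) (addrC (expR s)); exact: H.
rewrite !ger0_norm ?subr_ge0 ?ler_expR//.
have := expR_ge1Dx (t - s); rewrite expRD expRN => H.
have s0 := expR_gt0 s; have t0 := expR_gt0 t.
have : ((1 + (t - s)) * expR s <= expR t)%R by rewrite -ler_pdivlMr.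
by nra.
Qed.

(** Source of the continuity of the inner objective in h, which the extreme value theorem
    requires. *)
Lemma laplace_lipschitz (R : realType) (n : nat) (nu : probability 'rV[R]_n R)
    (a b N : R) (psi : 'rV[R]_n -> R) :
  exp_moments nu -> (0 <= b)%R -> (0 <= N)%R -> grows nu a b psi ->
  exists2 C : R, (0 <= C)%R & forall k l, (enorm k <= N)%R -> (enorm l <= N)%R ->
    (`|laplace nu psi k - laplace nu psi l| <= C * enorm (k - l))%R.
Proof.
move=> H1 b0 N0 gp.
(* The additional 1 in the rate absorbs the factor |y| coming from |(k - l).y| <= |k - l| |y|. *)
have q0 : (0 <= b + N + 1)%R by rewrite !addr_ge0.
have iC := integrable_exp_enorm (2 * expR a) H1 q0.
pose C := \int[nu]_y (2 * expR a * expR ((b + N + 1) * enorm y))%:E.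
have Cfin : C \is a fin_num by exact: integrable_fin_num iC.
exists (fine C).
  apply: fine_ge0; apply: integral_ge0 => y _.
  by rewrite lee_fin !mulr_ge0 ?expR_ge0.
move=> k l kN lN; rewrite -lee_fin.
have ik := integrable_exp_tilt k H1 b0 gp.
have il := integrable_exp_tilt l H1 b0 gp.
rewrite /laplace -RintegralB//.
have idiff : nu.-integrable setT (fun y =>
    (expR (dotp k y + psi y) - expR (dotp l y + psi y))%:E).
  by under eq_fun do rewrite EFinB; exact: integrableB.
apply: (@le_trans _ _ (\int[nu]_y `|(expR (dotp k y + psi y) -
    expR (dotp l y + psi y))%:E|)).
  rewrite /Rintegral EFin_normr_Rintegral//.
  by apply: le_abse_integral => //; exact: measurable_int idiff.
rewrite EFinM fineK// muleC -integralZl//.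
apply: ae_le_integral.
- by apply: measurableT_comp => //; exact: measurable_int idiff.
- by apply: measurable_funeM; exact: measurable_int iC.
- apply: filterS2 (grows_tilt gp kN) (grows_tilt gp lN) => y hk hl.
  rewrite abse_EFin -EFinM lee_fin; apply: le_trans (expR_dist _ _) _.
  have -> : (dotp k y + psi y - (dotp l y + psi y) = dotp (k - l) y)%R.
    by rewrite dotpDl dotpNl; ring.
  have := exp_growth_le hk; have := exp_growth_le hl.
  have := expR_ge0 (dotp k y + psi y); have := expR_ge0 (dotp l y + psi y).
  move: (expR (dotp k y + psi y)) (expR (dotp l y + psi y)) => ek el el0 ek0 hel hek.
  apply: (@le_trans _ _ (enorm (k - l) * enorm y *
      (expR a * expR ((b + N) * enorm y) + expR a * expR ((b + N) * enorm y))))%R.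
    apply: ler_pM; [exact: normr_ge0|exact: addr_ge0|exact: norm_dotp_le|exact: lerD].
  rewrite -mulrA ler_wpM2l ?enorm_ge0//.
  have -> : ((b + N + 1) * enorm y = (b + N) * enorm y + enorm y)%R.
    by rewrite mulrDl mul1r.
  rewrite expRD.
  have ey : (enorm y <= expR (enorm y))%R by have := expR_ge1Dx (enorm y); lra.
  have AB : (0 <= expR a * expR ((b + N) * enorm y))%R by rewrite mulr_ge0 ?expR_ge0.
  move: (enorm y) (expR (enorm y)) (expR ((b + N) * enorm y)) (expR a)
    ey AB => t E B A tE AB.
  by clear -tE AB; nra.
Qed.

Lemma laplace_continuous (R : realType) (n : nat) (nu : probability 'rV[R]_n R)
    (a b : R) (psi : 'rV[R]_n -> R) :
  exp_moments nu -> (0 <= b)%R -> grows nu a b psi -> continuous (laplace nu psi).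
Proof.
move=> H1 b0 gp k.
have N0 : (0 <= enorm k + 1)%R by rewrite addr_ge0 ?enorm_ge0.
have [C C0 HC] := laplace_lipschitz H1 b0 N0 gp.
apply: (cvgrPdist_lt (FF := nbhs_filter k) _ _).2 => e e0.
have cN : \forall l \near k, (enorm l < enorm k + 1)%R.
  apply: (cvgr_lt (FF := nbhs_filter k) _ (@enorm_continuous R n k)).
  by rewrite ltrDl.
have cD : \forall l \near k, (C * enorm (k - l) < e)%R.
  have cc : continuous (fun l : 'rV[R]_n => C * enorm (k - l) : R)%R.
    move=> l; apply: (@continuousM R 'rV[R]_n (fun=> C) (fun l => enorm (k - l))).
      exact: cst_continuous.
    apply: (@continuous_comp _ _ _ (fun l : 'rV[R]_n => k - l)%R (@enorm R n)).
      apply: (@continuousB R 'rV[R]_n 'rV[R]_n (fun=> k) id).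
        exact: cst_continuous.
      exact: cvg_id.
    exact: enorm_continuous.
  apply: (cvgr_lt (FF := nbhs_filter k) _ (cc k)).
  by rewrite subrr enorm0 mulr0.
apply: filterS2 cN cD => l lN lD; apply: le_lt_trans lD.
by apply: HC; [rewrite lerDl|exact: ltW].
Qed.

Lemma inner_objective_continuous (R : realType) (n : nat)
    (nu : probability 'rV[R]_n R) (a b : R) (psi : 'rV[R]_n -> R)
    (x : 'rV[R]_n) :
  exp_moments nu -> (0 <= b)%R -> grows nu a b psi ->
  continuous (fun k => dotp k x - ln (laplace nu psi k))%R.
Proof.
move=> H1 b0 gp k.
apply: (@continuousB R R^o 'rV[R]_n (fun k => dotp k x)
  (fun k => ln (laplace nu psi k))).
  rewrite (_ : (fun k => _) = dotp x); first exact: dotp_continuous.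
  by apply/funext => l; rewrite dotpC.
apply: (@continuous_comp _ _ _ (laplace nu psi) (@ln R)).
  exact: laplace_continuous gp k.
by apply: continuous_ln; exact: laplace_gt0 gp.
Qed.

(* The maximizer lies in a compact K iff the supremum over K is the global
   one, and both suprema are lower semicontinuous in x. *)
Lemma measurable_inner_solution (R : realType) (n : nat)
    (mu nu : probability 'rV[R]_n R) (a b : R) (psi : 'rV[R]_n -> R) :
  exp_moments nu -> (0 <= b)%R -> grows nu a b psi ->
  {ae mu, forall x, exists! k, inner_solution nu psi x k} ->
  exists h : {mfun 'rV[R]_n >-> 'rV[R]_n},
    {ae mu, forall x, inner_solution nu psi x (h x)}.
Proof.
move=> H1 b0 gp [N [mN N0 Nsol]].
(* On the exceptional set [N], which contains every point without a unique maximizer, the value is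
   the constant 0, so that the part of a preimage inside [N] is [N] itself or empty. *)
pose f x : 'rV[R]_n := if x \in N then 0%R else xget 0%R (inner_solution nu psi x).
have fsol x : x \notin N -> inner_solution nu psi x (f x).
  move=> xN; rewrite /f (negbTE xN); apply: xgetPex.
  move: xN; rewrite notin_setE => xN.
  have /contrapT[k [solk _]] : ~ ~ (exists! k, inner_solution nu psi x k).
    by move=> H; apply: xN; exact: Nsol.
  by exists k.
have funi x k : x \notin N -> inner_solution nu psi x k -> k = f x.
  move=> xN solk; move: (xN); rewrite notin_setE => xN'.
  have /contrapT[l [_ luni]] : ~ ~ (exists! k, inner_solution nu psi x k).
    by move=> H; apply: xN'; exact: Nsol.
  by rewrite -(luni _ solk); exact: luni (fsol _ xN).
pose F x k := (dotp k x - ln (laplace nu psi k))%R.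
have mfK K : compact K -> measurable (~` N `&` f @^-1` K).
  move=> cK.
  have -> : ~` N `&` f @^-1` K =
      ~` N `&` [set x | ereal_sup [set (F x k)%:E | k in K] = inner_sup nu psi x].
    apply/seteqP; split => x [xN /= h]; split=> //=.
      apply/eqP; rewrite eq_le; apply/andP; split.
        apply: ge_ereal_sup => _ [k Kk <-].
        by rewrite -(inner_objectiveE _ _ H1 b0 gp); exact: inner_sup_ge.
      have xN' : x \notin N by rewrite notin_setE.
      rewrite (inner_sup_solution (fsol _ xN')) (inner_objectiveE _ _ H1 b0 gp).
      by apply: ereal_sup_ubound; exists (f x).
    have xN' : x \notin N by rewrite notin_setE.
    (* Over the empty set the supremum is -oo, whereas off [N] the global supremum is attained and
       finite. *)
    have K0 : K !=set0.
      apply/set0P/eqP => K0; move: h; rewrite K0 image_set0 ereal_sup0.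
      rewrite (inner_sup_solution (fsol _ xN')) (inner_objectiveE _ _ H1 b0 gp).
      by [].
    have cF : {within K, continuous (F x)}.
      by apply: continuous_subspaceT; exact: inner_objective_continuous gp.
    (* The supremum over K is attained at some k; being also the global supremum, it makes k a
       maximizer, equal to [f x] by uniqueness. *)
    have [k Kk kmax] := compact_EVT_max K0 cK cF.
    suff solk : inner_solution nu psi x k.
      by rewrite -(funi x k xN' solk); move: Kk; rewrite inE.
    split=> // l _.
    apply: le_trans (inner_sup_ge nu psi x l) _.
    rewrite -h (inner_objectiveE _ _ H1 b0 gp); apply: ge_ereal_sup => _ [m Km <-].
    by rewrite lee_fin; apply: kmax; rewrite inE.
  apply: measurableI; first exact: measurableC.
  rewrite -[X in measurable X]setTI; apply: measurable_eqe => //.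
    apply: (@measurable_sup_continuous _ _ _ K (fun k x => F x k)) => k x.
    apply: (@continuousB R R^o 'rV[R]_n (dotp k) (fun=> ln (laplace nu psi k))).
      exact: dotp_continuous.
    exact: cst_continuous.
  exact: measurable_inner_sup gp.
have mf : measurable_fun setT f.
  apply: (@measurability _ _ _ _ _ _ (@open 'rV[R]_n)) => // _ [U oU <-].
  rewrite setTI; have [K [cK UK]] := open_sigma_compact oU.
  have -> : f @^-1` U = (N `&` f @^-1` U) `|` \bigcup_m (~` N `&` f @^-1` (K m)).
    by rewrite -setI_bigcupr -preimage_bigcup -UK -setIUl setUCr setTI.
  apply: measurableU; last by apply: bigcup_measurable => m _; exact: mfK.
  have [U0|U0] := pselect (U 0%R).
    rewrite (_ : _ `&` _ = N)//; apply/seteqP; split=> [x []//|x Nx]; split=> //=.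
    by rewrite /f mem_set.
  rewrite (_ : _ `&` _ = set0)//; apply/seteqP; split=> [x [Nx] /=|//].
  by rewrite /f mem_set.
pose hm := @isMeasurableFun.Build _ _ _ _ f mf.
pose h : {mfun 'rV[R]_n >-> 'rV[R]_n} := HB.pack f hm.
exists h; exists N; split=> // x /= nsol; apply: contrapT => xN; apply: nsol.
by apply: fsol; rewrite notin_setE.
Qed.

(** * The primal problem *)

Lemma coupling_integral_fst d1 d2 (T1 : measurableType d1)
    (T2 : measurableType d2) (R : realType) (alpha : probability T1 R)
    (beta : probability T2 R) (p : probability (T1 * T2)%type R)
    (F : T1 -> \bar R) :
  coupling alpha beta p -> measurable_fun setT F ->
  \int[p]_z F z.1 = \int[alpha]_x F x.
Proof.
move=> [p1 _] mF; rewrite -(integral_pushforwardT measurable_fst p mF).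
by apply: eq_measure_integral => A mA _; exact: p1.
Qed.

Lemma coupling_integral_snd d1 d2 (T1 : measurableType d1)
    (T2 : measurableType d2) (R : realType) (alpha : probability T1 R)
    (beta : probability T2 R) (p : probability (T1 * T2)%type R)
    (F : T2 -> \bar R) :
  coupling alpha beta p -> measurable_fun setT F ->
  \int[p]_z F z.2 = \int[beta]_y F y.
Proof.
move=> [_ p2] mF; rewrite -(integral_pushforwardT measurable_snd p mF).
by apply: eq_measure_integral => A mA _; exact: p2.
Qed.

Lemma coupling_integrable_fst d1 d2 (T1 : measurableType d1)
    (T2 : measurableType d2) (R : realType) (alpha : probability T1 R)
    (beta : probability T2 R) (p : probability (T1 * T2)%type R)
    (F : T1 -> \bar R) :
  coupling alpha beta p -> alpha.-integrable setT F ->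
  p.-integrable setT (fun z => F z.1).
Proof.
move=> cp /integrableP[mF iF]; apply/integrableP; split.
  exact: measurableT_comp.
rewrite (coupling_integral_fst (F := fun x => `|F x|) cp)//.
exact: measurableT_comp.
Qed.

Lemma coupling_integrable_snd d1 d2 (T1 : measurableType d1)
    (T2 : measurableType d2) (R : realType) (alpha : probability T1 R)
    (beta : probability T2 R) (p : probability (T1 * T2)%type R)
    (F : T2 -> \bar R) :
  coupling alpha beta p -> beta.-integrable setT F ->
  p.-integrable setT (fun z => F z.2).
Proof.
move=> cp /integrableP[mF iF]; apply/integrableP; split.
  exact: measurableT_comp.
rewrite (coupling_integral_snd (F := fun x => `|F x|) cp)//.
exact: measurableT_comp.
Qed.

Lemma coupling_ae_snd d1 d2 (T1 : measurableType d1)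
    (T2 : measurableType d2) (R : realType) (alpha : probability T1 R)
    (beta : probability T2 R) (p : probability (T1 * T2)%type R)
    (A : T2 -> Prop) :
  coupling alpha beta p -> {ae beta, forall x, A x} -> {ae p, forall z, A z.2}.
Proof.
move=> [_ p2] [N [mN N0 NA]]; exists (snd @^-1` N); split.
- by rewrite -[X in measurable X]setTI; exact: measurable_snd.
- by apply: (etrans (p2 _ mN)).
- by move=> z /= Az; exact: NA.
Qed.

(** A difference of extended reals is finite only if both terms are. The barycenter equation, whose
    right side is real, thus gives integrability of the coordinates. *)
Lemma fin_num_integral_integrable d (T : measurableType d) (R : realType)
    (mu : {measure set T -> \bar R}) (f : T -> \bar R) :
  measurable_fun setT f -> \int[mu]_x f x \is a fin_num ->
  mu.-integrable setT f.
Proof.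
move=> mf; rewrite integralE fin_numB => /andP[fp fn].
have mfp := measurable_funepos mf; have mfn := measurable_funeneg mf.
apply/integrableP; split=> //.
rewrite (_ : (fun x => `|f x|) = f^\+ \+ f^\-); last by rewrite -fune_abse.
by rewrite ge0_integralD// lte_add_pinfty// ltey_eq ?fp ?fn.
Qed.

Lemma measurable_kernel_integral d1 d2 (T1 : measurableType d1)
    (T2 : measurableType d2) (R : realType) (kappa : R.-pker T1 ~> T2)
    (F : T1 * T2 -> \bar R) : measurable_fun setT F ->
  measurable_fun setT (fun x => \int[kappa x]_y F (x, y)).
Proof.
move=> mF; rewrite [X in measurable_fun _ X](_ : _ = fun x =>
    \int[kappa x]_y F^\+ (x, y) - \int[kappa x]_y F^\- (x, y)).
  apply: emeasurable_funB; apply: measurable_fun_integral_finite_kernel => //.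
    exact: measurable_funepos.
  exact: measurable_funeneg.
apply/funext => x; rewrite integralE; congr (_ - _); apply: eq_integral => y _;
  by rewrite !(funeposE, funenegE).
Qed.

Lemma disintegrates_integral_ae d1 d2 (T1 : measurableType d1)
    (T2 : measurableType d2) (R : realType) (mu : probability T1 R)
    (kappa : R.-pker T1 ~> T2) (m : probability (T1 * T2)%type R)
    (F : T1 * T2 -> \bar R) (G : T1 -> \bar R) :
  disintegrates mu kappa m -> m.-integrable setT F -> measurable_fun setT G ->
  {ae mu, forall x, \int[kappa x]_y F (x, y) = G x} ->
  \int[m]_z F z = \int[mu]_x G x.
Proof.
move=> dm iF mG FG; rewrite (disintegrates_integrable dm iF).
apply: ae_eq_integral => //; last by apply: filterS FG => x ->.
apply: measurable_kernel_integral; exact: measurable_int iF.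
Qed.

Lemma barycenter_dotp (R : realType) (n : nat)
    (k : {measure set 'rV[R]_n -> \bar R}) (v x : 'rV[R]_n) :
  (forall i, \int[k]_y (y ord0 i)%:E = (x ord0 i)%:E) ->
  k.-integrable setT (fun y => (dotp v y)%:E) /\
  \int[k]_y (dotp v y)%:E = (dotp v x)%:E.
Proof.
move=> kx.
have ik i : k.-integrable setT (fun y => (v ord0 i)%:E * (y ord0 i)%:E).
  apply: integrableZl => //; apply: fin_num_integral_integrable.
    by apply/measurable_EFinP; exact: measurable_coord.
  by rewrite kx.
have dE : (fun y : 'rV[R]_n => (dotp v y)%:E) =
    fun y => \sum_(i <- index_enum 'I_n) ((v ord0 i)%:E * (y ord0 i)%:E).
  by apply/funext => y; rewrite /dotp -sumEFin; apply: eq_bigr => i _.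
split; first by rewrite dE; apply: integrable_sum => // i _; exact: ik.
rewrite dE integral_sum// /dotp -sumEFin; apply: eq_bigr => i _.
rewrite integralZl// ?kx//; apply: fin_num_integral_integrable.
  by apply/measurable_EFinP; exact: measurable_coord.
by rewrite kx.
Qed.

Lemma disintegrates_fst d1 d2 (T1 : measurableType d1)
    (T2 : measurableType d2) (R : realType) (mu : probability T1 R)
    (kappa : R.-pker T1 ~> T2) (m : probability (T1 * T2)%type R) A :
  disintegrates mu kappa m -> measurable A -> m (fst @^-1` A) = mu A.
Proof.
move=> dm mA; rewrite dm; last first.
  by rewrite -[X in measurable X]setTI; exact: measurable_fst.
transitivity (\int[mu]_x (\1_A x)%:E); last by rewrite integral_indic// setIT.
apply: eq_integral => x _; rewrite indicE xsectionE.
case: (boolP (x \in A)) => xA.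
  rewrite (_ : _ @^-1` _ = setT) ?prob_kernel//.
  by apply/seteqP; split=> // y _ /=; rewrite inE in xA.
rewrite (_ : _ @^-1` _ = set0) ?measure0//.
by apply/seteqP; split=> // y /=; move: xA; rewrite notin_setE.
Qed.

Lemma disintegrates_snd d1 d2 (T1 : measurableType d1)
    (T2 : measurableType d2) (R : realType) (mu : probability T1 R)
    (kappa : R.-pker T1 ~> T2) (m : probability (T1 * T2)%type R) B :
  disintegrates mu kappa m -> measurable B ->
  m (snd @^-1` B) = \int[mu]_x kappa x B.
Proof.
move=> dm mB; rewrite dm; last first.
  by rewrite -[X in measurable X]setTI; exact: measurable_snd.
by apply: eq_integral => x _; rewrite xsectionE.
Qed.

(** * Joint laws with tilted fibres, and their cut-off exponents *)

Lemma integral_tilt_product (R : realType) (n : nat)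
    (nu : probability 'rV[R]_n R) (a b : R) (psi : 'rV[R]_n -> R)
    d (T : measurableType d) (alpha : probability T R) (h : T -> 'rV[R]_n) :
  exp_moments nu -> (0 <= b)%R -> grows nu a b psi -> measurable_fun setT h ->
  \int[alpha \x nu]_z (tilt nu psi (h z.1) z.2)%:E = 1.
Proof.
move=> H1 b0 gp mh; rewrite fubini_tonelli1//=; last 2 first.
- by apply/measurable_EFinP; apply: measurable_tilt_pair => //; case: gp.
- by move=> z; rewrite lee_fin tilt_ge0.
rewrite -[RHS](probability_integral_cst alpha); apply: eq_integral => x _.
exact: (integral_tilt (h x) H1 b0 gp).
Qed.

Lemma tilt_joint (R : realType) (n : nat)
    (nu : probability 'rV[R]_n R) (a b : R) (psi : 'rV[R]_n -> R)
    d (T : measurableType d) (alpha : probability T R) (h : T -> 'rV[R]_n) :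
  exp_moments nu -> (0 <= b)%R -> grows nu a b psi -> measurable_fun setT h ->
  exists p : probability (T * 'rV[R]_n)%type R,
    has_density p (alpha \x nu) (fun z => tilt nu psi (h z.1) z.2).
Proof.
move=> H1 b0 gp mh; apply: density_probability.
- by apply: measurable_tilt_pair => //; case: gp.
- by move=> z; exact: tilt_ge0.
- exact: (integral_tilt_product alpha H1 b0 gp mh).
Qed.

Lemma tilt_joint_disintegrates (R : realType) (n : nat)
    (nu : probability 'rV[R]_n R) (psi : 'rV[R]_n -> R)
    d (T : measurableType d) (alpha : probability T R) (h : T -> 'rV[R]_n)
    (p : probability (T * 'rV[R]_n)%type R) (kappa : R.-pker T ~> 'rV[R]_n) :
  measurable_fun setT psi -> measurable_fun setT h ->
  has_density p (alpha \x nu) (fun z => tilt nu psi (h z.1) z.2) ->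
  (forall x A, measurable A ->
    kappa x A = \int[nu]_(y in A) (tilt nu psi (h x) y)%:E) ->
  disintegrates alpha kappa p.
Proof.
move=> mp mh [mt pE] hk A mA; rewrite pE// integral_mkcond.
pose F (z : T * 'rV[R]_n) := (tilt nu psi (h z.1) z.2 * \1_A z)%:E.
transitivity (\int[alpha \x nu]_z F z).
  by apply: eq_integral => z _; rewrite epatch_indic /F EFinM.
rewrite fubini_tonelli1//; last 2 first.
- by apply/measurable_EFinP; apply: measurable_funM.
- by move=> z; rewrite lee_fin mulr_ge0// tilt_ge0.
apply: eq_integral => x _; rewrite hk; last exact: measurable_xsection.
rewrite [RHS]integral_mkcond; apply: eq_integral => y _.
by rewrite epatch_indic /F /= EFinM !indicE mem_xsection.
Qed.

Definition tilt_exponent (R : realType) (n : nat) (nu : probability 'rV[R]_n R)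
    (psi : 'rV[R]_n -> R) (T : Type) (h : T -> 'rV[R]_n) (z : T * 'rV[R]_n) : R :=
  (dotp (h z.1) z.2 + psi z.2 - ln (laplace nu psi (h z.1)))%R.

Definition inner_value (R : realType) (n : nat) (nu : probability 'rV[R]_n R)
    (psi : 'rV[R]_n -> R) (h : 'rV[R]_n -> 'rV[R]_n) (x : 'rV[R]_n) : R :=
  (dotp (h x) x - ln (laplace nu psi (h x)))%R.

(** A factor for the exponent, and not a restriction of the domain: a cut-off exponent equals 0
    outside the region, so the fibre of its exponential there has mass 1. *)
Definition cutoff (R : realType) (n : nat) (h : 'rV[R]_n -> 'rV[R]_n) (N : R)
    (x : 'rV[R]_n) : R :=
  \1_[set x | (enorm (h x) <= N)%R] x.

Lemma tilt_expR (R : realType) (n : nat) (nu : probability 'rV[R]_n R)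
    (a b : R) (psi : 'rV[R]_n -> R) (T : Type) (h : T -> 'rV[R]_n)
    (z : T * 'rV[R]_n) :
  exp_moments nu -> (0 <= b)%R -> grows nu a b psi ->
  tilt nu psi (h z.1) z.2 = expR (tilt_exponent nu psi h z).
Proof.
move=> H1 b0 gp; have Z0 := laplace_gt0 (h z.1) H1 b0 gp.
by rewrite /tilt /tilt_exponent [RHS]expRD expRN lnK// posrE.
Qed.

Lemma measurable_ln_laplace d (T : measurableType d) (R : realType) (n : nat)
    (nu : probability 'rV[R]_n R) (psi : 'rV[R]_n -> R) (h : T -> 'rV[R]_n) :
  measurable_fun setT psi -> measurable_fun setT h ->
  measurable_fun setT (fun x => ln (laplace nu psi (h x))).
Proof.
move=> mp mh; apply: (measurableT_comp (@measurable_ln R)).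
exact: measurableT_comp (measurable_laplace _ mp) mh.
Qed.

Lemma measurable_tilt_exponent d (T : measurableType d) (R : realType) (n : nat)
    (nu : probability 'rV[R]_n R) (psi : 'rV[R]_n -> R) (h : T -> 'rV[R]_n) :
  measurable_fun setT psi -> measurable_fun setT h ->
  measurable_fun setT (tilt_exponent nu psi h).
Proof.
move=> mp mh; have mh1 : measurable_fun setT (fun z : T * 'rV[R]_n => h z.1).
  exact: measurableT_comp.
apply: measurable_funB; last exact: measurable_ln_laplace.
apply: measurable_funD; first exact: measurable_dotp.
exact: measurableT_comp.
Qed.

Lemma measurable_inner_value (R : realType) (n : nat)
    (nu : probability 'rV[R]_n R) (psi : 'rV[R]_n -> R)
    (h : 'rV[R]_n -> 'rV[R]_n) :
  measurable_fun setT psi -> measurable_fun setT h ->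
  measurable_fun setT (inner_value nu psi h).
Proof.
move=> mp mh; apply: measurable_funB; first exact: measurable_dotp.
exact: measurable_ln_laplace.
Qed.

Lemma measurable_cutoff (R : realType) (n : nat) (h : 'rV[R]_n -> 'rV[R]_n)
    (N : R) : measurable_fun setT h -> measurable_fun setT (cutoff h N).
Proof.
move=> mh; apply: measurable_indic.
have := measurable_fun_ler (measurableT_comp (@measurable_enorm R n) mh)
  (@measurable_cst _ _ _ _ setT N).
move=> /(_ measurableT [set true] I); rewrite setTI.
by rewrite (_ : _ @^-1` _ = [set x | (enorm (h x) <= N)%R]).
Qed.

Lemma cutoff01 (R : realType) (n : nat) (h : 'rV[R]_n -> 'rV[R]_n) (N : R)
    (x : 'rV[R]_n) :
  (cutoff h N x = 1 /\ (enorm (h x) <= N) \/ cutoff h N x = 0)%R.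
Proof.
rewrite /cutoff indicE; case: (boolP (_ \in _)) => xN /=; last by right.
by left; move: xN; rewrite inE.
Qed.

Lemma cutoff_le (R : realType) (n : nat) (h : 'rV[R]_n -> 'rV[R]_n) (N r : R)
    (x : 'rV[R]_n) : (`|cutoff h N x * r| <= `|r|)%R.
Proof.
by have [[-> _]|->] := cutoff01 h N x; rewrite ?mul1r// mul0r normr0.
Qed.

Lemma cutoff_cvg (R : realType) (n : nat) (h : 'rV[R]_n -> 'rV[R]_n)
    (x : 'rV[R]_n) (r : R) :
  (cutoff h k%:R x * r @[k --> \oo] --> r)%R.
Proof.
apply: cvg_near_cst; near=> k.
rewrite /cutoff indicE mem_set ?mul1r//=; near: k; exact: nbhs_infty_ger.
Unshelve. all: by end_near. Qed.

Lemma inner_sup_value (R : realType) (n : nat) (mu nu : probability 'rV[R]_n R)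
    (a b : R) (psi : 'rV[R]_n -> R) (h : 'rV[R]_n -> 'rV[R]_n) :
  exp_moments nu -> (0 <= b)%R -> grows nu a b psi ->
  measurable_fun setT h ->
  dual_objective mu nu psi \is a fin_num ->
  {ae mu, forall x, inner_solution nu psi x (h x)} ->
  mu.-integrable setT (EFin \o inner_value nu psi h) /\
  dual_objective mu nu psi =
    \int[nu]_y (psi y)%:E + \int[mu]_x (inner_value nu psi h x)%:E.
Proof.
move=> H1 b0 gp mh Dfin sol.
have iS := inner_sup_integrable H1 b0 gp Dfin.
have mI : measurable_fun setT (EFin \o inner_value nu psi h).
  by apply/measurable_EFinP; apply: measurable_inner_value => //; case: gp.
have SE : ae_eq mu setT (inner_sup nu psi) (EFin \o inner_value nu psi h).
  apply: filterS sol => x solx _.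
  by rewrite (inner_sup_solution solx) (inner_objectiveE _ _ H1 b0 gp).
have IE : \int[mu]_x inner_sup nu psi x = \int[mu]_x (inner_value nu psi h x)%:E.
  by apply: ae_eq_integral => //; exact: measurable_int iS.
split; last by rewrite -IE.
apply: fin_num_integral_integrable => //.
by rewrite /= -IE; exact: integrable_fin_num iS.
Qed.

(** On the region, |h(x).y| <= N |y| is integrable and the martingale property replaces y by x. The
    term in [psi] is still integrated against [m], because the cutoff depends on x and [psi] on y;
    it reduces to a nu-integral only in the limit. *)
Lemma primal_cutoff (R : realType) (n : nat) (mu nu : probability 'rV[R]_n R)
    (a b N : R) (psi : 'rV[R]_n -> R) (h : 'rV[R]_n -> 'rV[R]_n)
    (m : probability ('rV[R]_n * 'rV[R]_n)%type R) :
  exp_moments nu -> (0 <= b)%R -> (0 <= N)%R -> grows nu a b psi ->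
  measurable_fun setT h -> martingale_coupling mu nu m ->
  m.-integrable setT
    (fun z => (cutoff h N z.1 * tilt_exponent nu psi h z)%:E) /\
  \int[m]_z (cutoff h N z.1 * tilt_exponent nu psi h z)%:E =
  \int[mu]_x (cutoff h N x * inner_value nu psi h x)%:E +
  \int[m]_z (cutoff h N z.1 * psi z.2)%:E.
Proof.
move=> H1 b0 N0 gp mh [cm [kappa [dm bar]]]; have [mp _] := gp.
have mc := measurable_cutoff N mh.
have mc1 : measurable_fun setT (fun z : 'rV[R]_n * 'rV[R]_n => cutoff h N z.1).
  exact: measurableT_comp.
have mh1 : measurable_fun setT (fun z : 'rV[R]_n * 'rV[R]_n => h z.1).
  exact: measurableT_comp.
have mL := measurable_ln_laplace nu mp mh.
have [C HC] := @ln_laplace_bounded _ _ nu a b N H1 b0 N0.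
have i1 : m.-integrable setT (fun z => (cutoff h N z.1 * dotp (h z.1) z.2)%:E).
  apply: (@integrable_le_norm _ _ _ _ _ (fun z => 0 + N * enorm z.2)%R).
  - by apply: measurable_funM => //; exact: measurable_dotp.
  - move=> z; have [[-> hN]|->] := cutoff01 h N z.1.
      rewrite mul1r add0r; apply: le_trans (norm_dotp_le _ _) _.
      by rewrite ler_wpM2r// enorm_ge0.
    by rewrite mul0r normr0 add0r mulr_ge0// enorm_ge0.
  - exact: (coupling_integrable_snd cm (integrable_enorm 0 N H1)).
have i2 : m.-integrable setT (fun z => (cutoff h N z.1 * psi z.2)%:E).
  apply: (@integrable_le_norm _ _ _ _ _ (fun z => `|psi z.2|)%R).
  - by apply: measurable_funM => //; exact: measurableT_comp.
  - by move=> z; exact: cutoff_le.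
  - exact: (coupling_integrable_snd cm (integrable_norm (grows_integrable H1 gp))).
have i3' : mu.-integrable setT
    (fun x => (cutoff h N x * ln (laplace nu psi (h x)))%:E).
  apply: (@integrable_le_norm _ _ _ _ _ (fun x => `|C|)%R).
  - exact: measurable_funM.
  - move=> x; have [[-> hN]|->] := cutoff01 h N x.
      by rewrite mul1r; apply: le_trans (HC _ _ gp hN) (ler_norm _).
    by rewrite mul0r normr0.
  - exact: finite_measure_integrable_cst.
have i3 := coupling_integrable_fst cm i3'.
have -> : (fun z => (cutoff h N z.1 * tilt_exponent nu psi h z)%:E) =
    (fun z => (cutoff h N z.1 * dotp (h z.1) z.2)%:E +
      (cutoff h N z.1 * psi z.2)%:E -
      (cutoff h N z.1 * ln (laplace nu psi (h z.1)))%:E).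
  apply/funext => z.
  rewrite [RHS](_ : _ = (cutoff h N z.1 * dotp (h z.1) z.2 +
    cutoff h N z.1 * psi z.2 - cutoff h N z.1 * ln (laplace nu psi (h z.1)))%:E)//.
  by rewrite /tilt_exponent mulrBr mulrDr.
split; first by apply: integrableB => //; exact: integrableD.
rewrite integralB//; last exact: integrableD.
rewrite integralD// addeAC; congr (_ + _).
have mcd : measurable_fun setT (fun x => (cutoff h N x * dotp (h x) x)%:E).
  by apply/measurable_EFinP; apply: measurable_funM => //; exact: measurable_dotp.
have i1E : \int[m]_z (cutoff h N z.1 * dotp (h z.1) z.2)%:E =
    \int[mu]_x (cutoff h N x * dotp (h x) x)%:E.
  apply: (disintegrates_integral_ae dm) => //.
  apply: filterS bar => x barx /=.
  have [id dE] := barycenter_dotp (h x) barx.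
  by under eq_integral do rewrite EFinM; rewrite integralZl// dE -EFinM.
rewrite i1E (coupling_integral_fst
  (F := fun x => (cutoff h N x * ln (laplace nu psi (h x)))%:E) cm); last first.
  exact: measurable_int i3'.
rewrite -integralB//.
  by apply: eq_integral => x _; rewrite -EFinB -mulrBr.
apply: fin_num_integral_integrable => //.
by rewrite -i1E; exact: integrable_fin_num i1.
Qed.

(** Dominated convergence with majorants |psi(y)| and |inner_value x|. The second is integrable as a
    whole, its two terms having been regrouped before the limit. *)
Lemma primal_cutoff_cvg (R : realType) (n : nat) (mu nu : probability 'rV[R]_n R)
    (a b : R) (psi : 'rV[R]_n -> R) (h : 'rV[R]_n -> 'rV[R]_n)
    (m : probability ('rV[R]_n * 'rV[R]_n)%type R) :
  exp_moments nu -> (0 <= b)%R -> grows nu a b psi ->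
  measurable_fun setT h ->
  dual_objective mu nu psi \is a fin_num ->
  {ae mu, forall x, inner_solution nu psi x (h x)} ->
  martingale_coupling mu nu m ->
  \int[m]_z (cutoff h k%:R z.1 * tilt_exponent nu psi h z)%:E @[k --> \oo] -->
    dual_objective mu nu psi.
Proof.
move=> H1 b0 gp mh Dfin sol mm; have [cm _] := mm; have [mp _] := gp.
have [iI ->] := inner_sup_value H1 b0 gp mh Dfin sol.
have ip := grows_integrable H1 gp.
have mI := measurable_inner_value nu mp mh.
rewrite (_ : (fun k : nat => _) = fun k : nat =>
    \int[m]_z (cutoff h k%:R z.1 * psi z.2)%:E +
    \int[mu]_x (cutoff h k%:R x * inner_value nu psi h x)%:E); last first.
  apply/funext => k; have k0 : (0 <= k%:R :> R)%R by [].
  by rewrite (primal_cutoff H1 b0 k0 gp mh mm).2 addeC.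
apply: cvgeD.
- by rewrite fin_num_adde_defl//; exact: integrable_fin_num iI.
- have psiE : measurable_fun setT (EFin \o psi) by exact/measurable_EFinP.
  rewrite -(coupling_integral_snd (F := EFin \o psi) cm psiE).
  apply: (@cvg_integral_dominated _ _ _ _
    (fun k z => cutoff h k%:R z.1 * psi z.2)%R (fun z => psi z.2)
    (fun z => `|psi z.2|%R)).
  + move=> k; apply: measurable_funM; last exact: measurableT_comp.
    by apply: measurableT_comp => //; exact: measurable_cutoff.
  + exact: measurableT_comp.
  + by move=> z; exact: cutoff_cvg.
  + exact: (coupling_integrable_snd cm (integrable_norm ip)).
  + by move=> k; apply: aeW => z; exact: cutoff_le.
- apply: (@cvg_integral_dominated _ _ _ _
    (fun k x => cutoff h k%:R x * inner_value nu psi h x)%R (inner_value nu psi h)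
    (fun x => `|inner_value nu psi h x|%R)) => //.
  + by move=> k; apply: measurable_funM => //; exact: measurable_cutoff.
  + by move=> x; exact: cutoff_cvg.
  + exact: integrable_norm.
  + by move=> k; apply: aeW => x; exact: cutoff_le.
Qed.

Lemma primal_ge (R : realType) (n : nat) (mu nu : probability 'rV[R]_n R)
    (a b : R) (psi : 'rV[R]_n -> R) (h : 'rV[R]_n -> 'rV[R]_n)
    (m : probability ('rV[R]_n * 'rV[R]_n)%type R) :
  exp_moments nu -> (0 <= b)%R -> grows nu a b psi ->
  measurable_fun setT h ->
  dual_objective mu nu psi \is a fin_num ->
  {ae mu, forall x, inner_solution nu psi x (h x)} ->
  martingale_coupling mu nu m ->
  dual_objective mu nu psi <= rel_entropy m (mu \x nu).
Proof.
move=> H1 b0 gp mh Dfin sol mm; have [mp _] := gp.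
have cv := primal_cutoff_cvg H1 b0 gp mh Dfin sol mm.
rewrite -(cvg_lim _ cv)//; apply: lime_le; first by apply/cvg_ex; exists (dual_objective mu nu psi).
apply: nearW => k; have k0 : (0 <= k%:R :> R)%R by [].
have mg : measurable_fun setT
    (fun z => cutoff h k%:R z.1 * tilt_exponent nu psi h z)%R.
  apply: measurable_funM; last exact: measurable_tilt_exponent.
  by apply: measurableT_comp => //; exact: measurable_cutoff.
apply: (rel_entropy_ge mg); first exact: (primal_cutoff H1 b0 k0 gp mh mm).1.
(* The test exponent is normalized fibrewise: the tilted density where the cutoff is 1, the constant
   density 1 where it is 0. *)
rewrite fubini_tonelli1//; last first.
  by apply/measurable_EFinP; exact: (measurableT_comp (@measurable_expR R) mg).
rewrite -[RHS](probability_integral_cst mu 1); apply: eq_integral => x _.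
rewrite /fubini_F /=; have [[-> _]|->] := cutoff01 h k%:R x.
  rewrite -[RHS](integral_tilt (h x) H1 b0 gp); apply: eq_integral => y _.
  by rewrite mul1r -(tilt_expR h (x, y) H1 b0 gp).
rewrite -[RHS](probability_integral_cst nu 1); apply: eq_integral => y _.
by rewrite mul0r expR0.
Qed.

(* Fatou's lemma applied to g + exp (- g), where g is the log-density of m:
   int exp (- g) dm = 1. *)
Lemma primal_le (R : realType) (n : nat) (mu nu : probability 'rV[R]_n R)
    (a b : R) (psi : 'rV[R]_n -> R) (h : 'rV[R]_n -> 'rV[R]_n)
    (m : probability ('rV[R]_n * 'rV[R]_n)%type R) :
  exp_moments nu -> (0 <= b)%R -> grows nu a b psi ->
  measurable_fun setT h ->
  dual_objective mu nu psi \is a fin_num ->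
  {ae mu, forall x, inner_solution nu psi x (h x)} ->
  martingale_coupling mu nu m ->
  has_density m (mu \x nu) (fun z => tilt nu psi (h z.1) z.2) ->
  m.-integrable setT (EFin \o tilt_exponent nu psi h) /\
  \int[m]_z (tilt_exponent nu psi h z)%:E <= dual_objective mu nu psi.
Proof.
move=> H1 b0 gp mh Dfin sol mm hm; have [mp _] := gp.
set g := tilt_exponent nu psi h.
have mg : measurable_fun setT g by exact: measurable_tilt_exponent.
pose gN k z := (cutoff h k%:R z.1 * g z)%R.
have mgN k : measurable_fun setT (gN k).
  apply: measurable_funM => //.
  by apply: measurableT_comp => //; exact: measurable_cutoff.
have igN k : m.-integrable setT (EFin \o gN k).
  by have k0 : (0 <= k%:R :> R)%R by []; exact: (primal_cutoff H1 b0 k0 gp mh mm).1.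
have cv := primal_cutoff_cvg H1 b0 gp mh Dfin sol mm.
have t0 z : (0 <= tilt nu psi (h z.1) z.2)%R by exact: tilt_ge0.
(* On a fibre with f = g the factor exp (- f) cancels the density of [m]; on a fibre with f = 0 the
   tilted density is left. Both have nu-integral 1. *)
have exp1 (f : 'rV[R]_n * 'rV[R]_n -> R) : measurable_fun setT f ->
    (forall x, (forall y, f (x, y) = g (x, y)) \/ (forall y, f (x, y) = 0%R)) ->
    m.-integrable setT (fun z => (expR (- f z))%:E) /\
    \int[m]_z (expR (- f z))%:E = 1.
  move=> mf fg; have me : measurable_fun setT (fun z => (expR (- f z))%:E).
    by apply/measurable_EFinP; apply: measurableT_comp => //; exact: measurableT_comp.
  suff e1 : \int[m]_z (expR (- f z))%:E = 1.
    by split=> //; apply: ge0_integrable => //; rewrite e1 ltry.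
  rewrite (density_integral hm)// fubini_tonelli1//; last 2 first.
  - apply: emeasurable_funM => //; apply/measurable_EFinP.
    exact: measurable_tilt_pair.
  - by move=> z; rewrite mule_ge0// lee_fin ?expR_ge0.
  rewrite -[RHS](probability_integral_cst mu 1); apply: eq_integral => x _.
  rewrite /fubini_F; have [fE|fE] := fg x.
    rewrite -[RHS](probability_integral_cst nu 1); apply: eq_integral => y _.
    rewrite fE (tilt_expR h (x, y) H1 b0 gp) -EFinM -expRD -/g.
    by rewrite addNr expR0.
  rewrite -[RHS](integral_tilt (h x) H1 b0 gp); apply: eq_integral => y _.
  by rewrite fE oppr0 expR0 mul1e.
have [ieg eg1] : m.-integrable setT (fun z => (expR (- g z))%:E) /\
    \int[m]_z (expR (- g z))%:E = 1.
  by apply: exp1 => // x; left.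
have egN k : m.-integrable setT (fun z => (expR (- gN k z))%:E) /\
    \int[m]_z (expR (- gN k z))%:E = 1.
  apply: exp1 => // x; have [[c1 _]|c0] := cutoff01 h k%:R x.
    by left => y; rewrite /gN /= c1 mul1r.
  by right => y; rewrite /gN /= c0 mul0r.
(* r + exp (- r) >= 1 supplies the sign for Fatou's lemma, although [g] has no integrable lower
   bound at this stage. *)
have pos (r : R) : 0 <= r%:E + (expR (- r))%:E.
  by rewrite -EFinD lee_fin; have := expR_ge1Dx (- r); lra.
pose G z := (g z)%:E + (expR (- g z))%:E.
pose GN k z := (gN k z)%:E + (expR (- gN k z))%:E.
have mG : measurable_fun setT G.
  apply: emeasurable_funD; first exact/measurable_EFinP.
  by apply/measurable_EFinP; apply: measurableT_comp => //; exact: measurableT_comp.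
have mGN k : measurable_fun setT (GN k).
  apply: emeasurable_funD; first exact/measurable_EFinP.
  by apply/measurable_EFinP; apply: measurableT_comp => //; exact: measurableT_comp.
have leG : \int[m]_z G z <= dual_objective mu nu psi + 1.
  (* For fixed z the cutoff is eventually 1, so the sequence is eventually constant. *)
  have -> : \int[m]_z G z = \int[m]_z limn_einf (GN^~ z).
    apply: eq_integral => z _; apply/esym.
    apply: (cvg_limn_einf_sup _).1; apply: cvg_near_cst; near=> k.
    by rewrite /GN /gN /cutoff indicE mem_set ?mul1r//=; near: k; exact: nbhs_infty_ger.
  apply: le_trans (fatou m measurableT mGN (fun k z _ => pos _)) _.
  have cv1 : \int[m]_z GN k z @[k --> \oo] --> dual_objective mu nu psi + 1.
    rewrite (_ : (fun k => _) = fun k => \int[m]_z (gN k z)%:E + 1); last first.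
      apply/funext => k; rewrite integralD//; [|exact: igN|exact: (egN k).1].
      by rewrite (egN k).2.
    by apply: cvgeD => //; [rewrite fin_num_adde_defl|exact: cvg_cst].
  by rewrite (cvg_limn_einf_sup cv1).1.
have iG : m.-integrable setT G.
  apply: ge0_integrable => //; first by move=> z; exact: pos.
  by apply: le_lt_trans leG _; rewrite lte_add_pinfty// ?ltry// ltey_eq Dfin.
have ig : m.-integrable setT (EFin \o g).
  have : m.-integrable setT (fun z => G z - (expR (- g z))%:E) by exact: integrableB.
  by under eq_fun do rewrite addeK//.
split=> //; move: leG; rewrite integralD// eg1 leeD2rE//.
Unshelve. all: by end_near. Qed.

(** * The Schroedinger problem *)

Lemma integral_distributionT d1 d2 (X : measurableType d1) (Y : measurableType d2)
    (R : realType) (P : probability X R) (h : {mfun X >-> Y}) (f : Y -> \bar R) :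
  measurable_fun setT f -> \int[distribution P h]_y f y = \int[P]_x f (h x).
Proof. by move=> mf; exact: (integral_pushforwardT (measurable_funPT h) P mf). Qed.

Lemma integrable_distributionT d1 d2 (X : measurableType d1) (Y : measurableType d2)
    (R : realType) (P : probability X R) (h : {mfun X >-> Y}) (f : Y -> \bar R) :
  measurable_fun setT f -> P.-integrable setT (fun x => f (h x)) ->
  (distribution P h).-integrable setT f.
Proof.
by move=> mf; exact: (integrable_pushforwardT (measurable_funPT h) mf).
Qed.

Lemma tilt_barycenter_ae (R : realType) (n : nat) (mu nu : probability 'rV[R]_n R)
    (a b : R) (psi : 'rV[R]_n -> R) (h : 'rV[R]_n -> 'rV[R]_n)
    (kappa : R.-pker 'rV[R]_n ~> 'rV[R]_n) :
  exp_moments nu -> (0 <= b)%R -> grows nu a b psi ->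
  {ae mu, forall x, inner_solution nu psi x (h x)} ->
  (forall x A, measurable A ->
    kappa x A = \int[nu]_(y in A) (tilt nu psi (h x) y)%:E) ->
  {ae mu, forall x, forall i,
    \int[kappa x]_y (y ord0 i)%:E = (x ord0 i)%:E}.
Proof.
move=> H1 b0 gp sol hk; apply: filterS sol => x solx i.
have [Q hQ] := tilt_probability (h x) H1 b0 gp.
rewrite -(tilt_barycenter i H1 b0 gp hQ solx).
apply: eq_measure_integral => A mA _.
by apply: (etrans (hk x A mA)); apply/esym; exact: hQ.2.
Qed.

Lemma tilt_martingale (R : realType) (n : nat) (mu nu : probability 'rV[R]_n R)
    (a b : R) (psi : 'rV[R]_n -> R) (h : 'rV[R]_n -> 'rV[R]_n)
    (kappa : R.-pker 'rV[R]_n ~> 'rV[R]_n)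
    (m : probability ('rV[R]_n * 'rV[R]_n)%type R) :
  exp_moments nu -> (0 <= b)%R -> grows nu a b psi ->
  dual_value mu nu \is a fin_num ->
  dual_objective mu nu psi = dual_value mu nu ->
  {ae mu, forall x, inner_solution nu psi x (h x)} ->
  (forall x A, measurable A ->
    kappa x A = \int[nu]_(y in A) (tilt nu psi (h x) y)%:E) ->
  disintegrates mu kappa m -> martingale_coupling mu nu m.
Proof.
move=> H1 b0 gp Vfin DV sol hk dm; split.
  split=> A mA; first exact: (disintegrates_fst dm mA).
  apply: (etrans (disintegrates_snd dm mA)).
  exact: (tilt_marginal H1 b0 gp Vfin DV sol hk mA).
by exists kappa; split=> //; exact: (tilt_barycenter_ae H1 b0 gp sol hk).
Qed.

Lemma tilt_solves_P (R : realType) (n : nat) (mu nu : probability 'rV[R]_n R)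
    (a b : R) (psi : 'rV[R]_n -> R) (h : 'rV[R]_n -> 'rV[R]_n)
    (m : probability ('rV[R]_n * 'rV[R]_n)%type R) :
  exp_moments nu -> (0 <= b)%R -> grows nu a b psi ->
  measurable_fun setT h ->
  dual_objective mu nu psi \is a fin_num ->
  {ae mu, forall x, inner_solution nu psi x (h x)} ->
  martingale_coupling mu nu m ->
  has_density m (mu \x nu) (fun z => tilt nu psi (h z.1) z.2) ->
  solves_P mu nu m.
Proof.
move=> H1 b0 gp mh Dfin sol mm hm; split=> // m' mm'.
apply: le_trans (primal_ge H1 b0 gp mh Dfin sol mm').
have [_ le] := primal_le H1 b0 gp mh Dfin sol mm hm.
rewrite (rel_entropy_exp_density (g := tilt_exponent nu psi h))//.
rewrite (_ : (fun z => expR _) = fun z => tilt nu psi (h z.1) z.2)//.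
by apply/funext => z; rewrite (tilt_expR h z H1 b0 gp).
Qed.

(** The change of variables k = h(x) in [tilt_marginal]; the kernel of the identity map provides
    measurability in k. *)
Lemma tilt_distribution_marginal (R : realType) (n : nat)
    (mu nu : probability 'rV[R]_n R)
    (a b : R) (psi : 'rV[R]_n -> R) (h : {mfun 'rV[R]_n >-> 'rV[R]_n})
    (A : set 'rV[R]_n) :
  exp_moments nu -> (0 <= b)%R -> grows nu a b psi ->
  dual_value mu nu \is a fin_num ->
  dual_objective mu nu psi = dual_value mu nu ->
  {ae mu, forall x, inner_solution nu psi x (h x)} ->
  measurable A ->
  \int[distribution mu h]_k \int[nu]_(y in A) (tilt nu psi k y)%:E = nu A.
Proof.
move=> H1 b0 gp Vfin DV sol mA.
have [ki hki] := tilt_kernel H1 b0 gp (@measurable_id _ 'rV[R]_n setT).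
have [kh hkh] := tilt_kernel H1 b0 gp (measurable_funPT h).
rewrite -(tilt_marginal H1 b0 gp Vfin DV sol (fun x A _ => hkh x A) mA).
transitivity (\int[distribution mu h]_k ki k A).
  by apply: eq_integral => x _; rewrite hki.
rewrite (integral_distributionT mu h (f := fun x => ki x A)); last first.
  exact: measurable_kernel.
by apply: eq_integral => x _; rewrite hki hkh.
Qed.

Lemma tilt_coupling (R : realType) (n : nat)
    (mu nu : probability 'rV[R]_n R)
    (a b : R) (psi : 'rV[R]_n -> R) (h : {mfun 'rV[R]_n >-> 'rV[R]_n})
    (p : probability ('rV[R]_n * 'rV[R]_n)%type R) :
  exp_moments nu -> (0 <= b)%R -> grows nu a b psi ->
  dual_value mu nu \is a fin_num ->
  dual_objective mu nu psi = dual_value mu nu ->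
  {ae mu, forall x, inner_solution nu psi x (h x)} ->
  has_density p (distribution mu h \x nu) (fun z => tilt nu psi z.1 z.2) ->
  coupling (distribution mu h) nu p.
Proof.
move=> H1 b0 gp Vfin DV sol hp.
have [ki hki] := tilt_kernel H1 b0 gp (@measurable_id _ 'rV[R]_n setT).
have dp := tilt_joint_disintegrates (proj1 gp) (@measurable_id _ 'rV[R]_n setT)
  hp (fun x A _ => hki x A).
split=> A mA; first exact: (disintegrates_fst dp mA).
apply: (etrans (disintegrates_snd dp mA)).
rewrite -(tilt_distribution_marginal H1 b0 gp Vfin DV sol mA).
by apply: eq_integral => x _; rewrite hki.
Qed.

Lemma schrodinger_density_tilt (R : realType) (n : nat)
    (nu : probability 'rV[R]_n R) (a b : R) (psi : 'rV[R]_n -> R) :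
  exp_moments nu -> (0 <= b)%R -> grows nu a b psi ->
  schrodinger_density
    (fun x => - ln (\int[nu]_y expR (psi y + dotp x y)))%R psi =
  fun z => tilt nu psi z.1 z.2.
Proof.
move=> H1 b0 gp; apply/funext => z; rewrite (tilt_expR id z H1 b0 gp).
rewrite /schrodinger_density /tilt_exponent.
have -> : (\int[nu]_y expR (psi y + dotp z.1 y))%R = laplace nu psi z.1.
  by apply: eq_Rintegral => y _; rewrite addrC.
by congr expR; rewrite -addrA addrC [(psi _ + _)%R]addrC.
Qed.

(** The first equation is the normalization of the tilt, for every xbar. For the second, the
    integral over [mubar] is a function of y with integral nu(E) over every measurable E, hence 1
    almost everywhere. *)
Lemma tilt_schrodinger_system (R : realType) (n : nat)
    (mu nu : probability 'rV[R]_n R)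
    (a b : R) (psi : 'rV[R]_n -> R) (h : {mfun 'rV[R]_n >-> 'rV[R]_n}) :
  exp_moments nu -> (0 <= b)%R -> grows nu a b psi ->
  dual_value mu nu \is a fin_num ->
  dual_objective mu nu psi = dual_value mu nu ->
  {ae mu, forall x, inner_solution nu psi x (h x)} ->
  schrodinger_system (distribution mu h) nu
    (fun x => - ln (\int[nu]_y expR (psi y + dotp x y)))%R psi.
Proof.
move=> H1 b0 gp Vfin DV sol.
rewrite /schrodinger_system (schrodinger_density_tilt H1 b0 gp); split.
  by apply: aeW => x; exact: (integral_tilt x H1 b0 gp).
pose f (z : 'rV[R]_n * 'rV[R]_n) := (tilt nu psi z.1 z.2)%:E.
have mf : measurable_fun setT f.
  by apply/measurable_EFinP; exact: (measurable_tilt_pair nu (proj1 gp) (@measurable_id _ 'rV[R]_n setT)).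
have f0 z : 0 <= f z by rewrite lee_fin tilt_ge0.
have H := @integral_ae_eq _ _ _ nu setT measurableT
  (fubini_G (distribution mu h) f) (cst 1).
have : ae_eq nu setT (cst 1) (fubini_G (distribution mu h) f).
  apply: H.
  - exact: finite_measure_integrable_cst.
  - exact: measurable_fun_fubini_tonelli_G.
  - move=> E _ mE; rewrite integral_cst// mul1e.
    apply: (etrans (esym (tilt_distribution_marginal H1 b0 gp Vfin DV sol mE))).
    pose fE (z : 'rV[R]_n * 'rV[R]_n) := f z * (\1_E z.2)%:E.
    have mfE : measurable_fun setT fE.
      apply: emeasurable_funM => //; apply/measurable_EFinP.
      exact: (measurableT_comp (measurable_indic mE)).
    have fE0 z : 0 <= fE z by rewrite mule_ge0// lee_fin.
    rewrite [RHS]integral_mkcond.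
    transitivity (\int[distribution mu h]_x \int[nu]_y fE (x, y)).
      apply: eq_integral => x _; rewrite integral_mkcond; apply: eq_integral => y _.
      by rewrite epatch_indic.
    rewrite fubini_tonelli//; apply: eq_integral => y _.
    rewrite epatch_indic /fE /= ge0_integralZr//.
    exact: measurableT_comp.
by apply: filterS => y /(_ I) yE; exact: (esym yE).
Qed.

Lemma coupling_dotp_integrable (R : realType) (n : nat)
    (alpha beta : probability 'rV[R]_n R)
    (q : probability ('rV[R]_n * 'rV[R]_n)%type R) :
  finite_second_moment alpha -> finite_second_moment beta ->
  coupling alpha beta q -> q.-integrable setT (fun z => (dotp z.1 z.2)%:E).
Proof.
move=> a2 b2 cq.
have i2 (P : probability 'rV[R]_n R) : finite_second_moment P ->
    P.-integrable setT (fun x => (enorm x ^+ 2)%:E).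
  move=> P2; apply: ge0_integrable => //.
  - apply/measurable_EFinP; apply: measurable_funX; exact: measurable_enorm.
  - by move=> x; rewrite lee_fin sqr_ge0.
apply: (@integrable_le_norm _ _ _ _ _
  (fun z => enorm z.1 ^+ 2 + enorm z.2 ^+ 2)%R).
- exact: measurable_dotp.
- move=> z; apply: le_trans (norm_dotp_le _ _) _.
  move: (enorm z.1) (enorm z.2) (enorm_ge0 z.1) (enorm_ge0 z.2) => s t s0 t0.
  by nra.
- apply: (@integrableD _ _ _ _ _ measurableT (fun z => (enorm z.1 ^+ 2)%:E)
    (fun z => (enorm z.2 ^+ 2)%:E)).
    exact: (coupling_integrable_fst cq (i2 _ a2)).
  exact: (coupling_integrable_snd cq (i2 _ b2)).
Qed.

(** With phibar = - ln (laplace), this is the sum of the integrals of the two Schroedinger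
    potentials against their marginals. *)
Definition SP_level (R : realType) (n : nat) (alpha nu : probability 'rV[R]_n R)
    (psi : 'rV[R]_n -> R) : \bar R :=
  \int[nu]_y (psi y)%:E - \int[alpha]_k (ln (laplace nu psi k))%:E.

(** Apart from the pairing, the exponent splits into functions of one variable, so its integral
    depends on the coupling only through the pairing. *)
Lemma SP_exponent (R : realType) (n : nat)
    (alpha nu : probability 'rV[R]_n R) (a b : R) (psi : 'rV[R]_n -> R)
    (q : probability ('rV[R]_n * 'rV[R]_n)%type R) :
  exp_moments nu -> grows nu a b psi ->
  finite_second_moment alpha -> finite_second_moment nu ->
  alpha.-integrable setT (fun k => (ln (laplace nu psi k))%:E) ->
  coupling alpha nu q ->
  q.-integrable setT (EFin \o tilt_exponent nu psi id) /\
  \int[q]_z (tilt_exponent nu psi id z)%:E =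
    \int[q]_z (dotp z.1 z.2)%:E + SP_level alpha nu psi.
Proof.
move=> H1 gp a2 n2 iL cq.
have id_ := coupling_dotp_integrable a2 n2 cq.
have ip := coupling_integrable_snd cq (grows_integrable H1 gp).
have il := coupling_integrable_fst cq iL.
have idp : q.-integrable setT (fun z => (dotp z.1 z.2)%:E + (psi z.2)%:E).
  exact: integrableD.
have -> : EFin \o tilt_exponent nu psi id = fun z : 'rV[R]_n * 'rV[R]_n =>
    (dotp z.1 z.2)%:E + (psi z.2)%:E - (ln (laplace nu psi z.1))%:E by [].
split; first exact: integrableB.
transitivity (\int[q]_z ((dotp z.1 z.2)%:E + (psi z.2)%:E -
  (ln (laplace nu psi z.1))%:E)); first by [].
rewrite integralB// integralD// /SP_level addeA.
have mp : measurable_fun setT (EFin \o psi) by apply/measurable_EFinP; case: gp.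
have <- := coupling_integral_snd (F := EFin \o psi) cq mp.
by have <- := coupling_integral_fst cq (measurable_int _ iL).
Qed.

(** Gibbs' inequality, its value at the tilted law and its equality case, with the pairing moved to
    the other side. The third claim forces every minimizer to have the tilted density. *)
Lemma SP_objective_level (R : realType) (n : nat)
    (alpha nu : probability 'rV[R]_n R) (a b : R) (psi : 'rV[R]_n -> R) :
  exp_moments nu -> (0 <= b)%R -> grows nu a b psi ->
  finite_second_moment alpha -> finite_second_moment nu ->
  alpha.-integrable setT (fun k => (ln (laplace nu psi k))%:E) ->
  forall q, coupling alpha nu q ->
  [/\ SP_level alpha nu psi <= SP_objective alpha nu q,
      has_density q (alpha \x nu) (fun z => tilt nu psi z.1 z.2) ->
        SP_objective alpha nu q = SP_level alpha nu psi &
      SP_objective alpha nu q <= SP_level alpha nu psi ->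
        has_density q (alpha \x nu) (fun z => tilt nu psi z.1 z.2)].
Proof.
move=> H1 b0 gp a2 n2 iL q cq.
have [ig gE] := SP_exponent H1 gp a2 n2 iL cq.
have dfin : \int[q]_z (dotp z.1 z.2)%:E \is a fin_num.
  exact: integrable_fin_num (coupling_dotp_integrable a2 n2 cq).
have mg : measurable_fun setT (tilt_exponent nu psi (@id 'rV[R]_n)).
  exact: (measurable_tilt_exponent nu (proj1 gp) (@measurable_id _ _ setT)).
have tE : (fun z : 'rV[R]_n * 'rV[R]_n => tilt nu psi z.1 z.2) =
    fun z => expR (tilt_exponent nu psi id z).
  by apply/funext => z; rewrite -(tilt_expR id z H1 b0 gp).
have g1 : \int[alpha \x nu]_z (expR (tilt_exponent nu psi id z))%:E = 1.
  rewrite -[RHS](integral_tilt_product alpha H1 b0 gp (@measurable_id _ _ setT)).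
  by apply: eq_integral => z _; rewrite -(tilt_expR id z H1 b0 gp).
rewrite /SP_objective tE; split.
- rewrite leeBrDl// -gE; exact: (rel_entropy_ge mg ig g1).
- by move=> hq; rewrite (rel_entropy_exp_density hq) gE addeAC subee// add0e.
- rewrite leeBlDl// -gE => le; exact: (rel_entropy_le_density mg ig g1 le).
Qed.

Lemma SP_tilt (R : realType) (n : nat)
    (alpha nu : probability 'rV[R]_n R) (a b : R) (psi : 'rV[R]_n -> R)
    (p : probability ('rV[R]_n * 'rV[R]_n)%type R) :
  exp_moments nu -> (0 <= b)%R -> grows nu a b psi ->
  finite_second_moment alpha -> finite_second_moment nu ->
  alpha.-integrable setT (fun k => (ln (laplace nu psi k))%:E) ->
  coupling alpha nu p ->
  has_density p (alpha \x nu) (fun z => tilt nu psi z.1 z.2) ->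
  [/\ SP_value alpha nu = SP_level alpha nu psi, solves_SP alpha nu p &
      schrodinger_potentials alpha nu
        (fun x => - ln (\int[nu]_y expR (psi y + dotp x y)))%R psi].
Proof.
move=> H1 b0 gp a2 n2 iL cp hp.
have key := SP_objective_level H1 b0 gp a2 n2 iL.
have [_ /(_ hp) pE _] := key p cp.
have sp : solves_SP alpha nu p.
  by split=> // q cq; rewrite pE; have [] := key q cq.
split=> //.
  apply/eqP; rewrite eq_le; apply/andP; split.
    by apply: ereal_inf_lbound; exists p.
  by apply: le_ereal_inf_tmp => _ [q cq <-]; have [] := key q cq.
split; first by exists p.
move=> q [cq qle]; rewrite (schrodinger_density_tilt H1 b0 gp).
by have [_ _] := key q cq; apply; rewrite -pE; exact: qle.
Qed.

(** * Images of measures and data processing *)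

Lemma pushforward_probability d1 d2 (X : measurableType d1)
    (Y : measurableType d2) (R : realType) (phi : X -> Y) (P : probability X R) :
  measurable_fun setT phi ->
  exists Q : probability Y R, forall A, Q A = P (phi @^-1` A).
Proof.
move=> mphi; pose hm := @isMeasurableFun.Build _ _ _ _ phi mphi.
pose h : {mfun X >-> Y} := HB.pack phi hm.
by exists (distribution P h).
Qed.

Lemma integral_image d1 d2 (X : measurableType d1)
    (Y : measurableType d2) (R : realType) (phi : X -> Y) (P : probability X R)
    (Q : probability Y R) (F : Y -> \bar R) :
  measurable_fun setT phi ->
  (forall A, measurable A -> Q A = P (phi @^-1` A)) -> measurable_fun setT F ->
  \int[Q]_y F y = \int[P]_x F (phi x).
Proof.
move=> mphi QP mF; rewrite -(integral_pushforwardT mphi P mF).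
by apply: eq_measure_integral => A mA _; exact: QP.
Qed.

Lemma integrable_image d1 d2 (X : measurableType d1)
    (Y : measurableType d2) (R : realType) (phi : X -> Y) (P : probability X R)
    (Q : probability Y R) (F : Y -> \bar R) :
  measurable_fun setT phi ->
  (forall A, measurable A -> Q A = P (phi @^-1` A)) -> Q.-integrable setT F ->
  P.-integrable setT (fun x => F (phi x)).
Proof.
move=> mphi QP /integrableP[mF iF]; apply/integrableP; split.
  exact: measurableT_comp.
rewrite -(integral_image mphi QP (F := fun y => `|F y|))//.
exact: measurableT_comp.
Qed.

Lemma lne_le_expRN (R : realType) (r t : R) : (0 <= r)%R ->
  lne r%:E <= (t + r * expR (- t) - 1)%:E.
Proof.
rewrite le_eqVlt => /predU1P[<-|r0]; first by rewrite le0_lneNy// leNye.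
rewrite lne_EFin// lee_fin.
have := expR_ge1Dx (ln r - t); rewrite expRD lnK ?posrE//; lra.
Qed.

(* The data processing inequality: ln f <= G + f exp (- G) - 1 for the density
   f of the image measures, and f exp (- G) has p-integral 1. *)
Lemma rel_entropy_image_le d1 d2 (X : measurableType d1)
    (Y : measurableType d2) (R : realType) (phi : X -> Y)
    (p P0 : probability X R) (Q P : probability Y R) (G : X -> R) :
  measurable_fun setT phi ->
  (forall A, measurable A -> Q A = p (phi @^-1` A)) ->
  (forall A, measurable A -> P A = P0 (phi @^-1` A)) ->
  measurable_fun setT G -> has_density p P0 (fun x => expR (G x)) ->
  p.-integrable setT (EFin \o G) ->
  rel_entropy Q P <= \int[p]_x (G x)%:E.
Proof.
move=> mphi Qp PP0 mG hp iG.
have QP : Q `<< P.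
  apply/null_content_dominatesP => A mA PA; rewrite Qp//.
  have /null_content_dominatesP := density_dominates hp; apply.
    by rewrite -[X in measurable X]setTI; exact: mphi.
  by apply: (etrans (esym (PP0 _ mA))).
have [f [f0 hf]] := dominates_density QP; have [mf _] := hf.
rewrite (rel_entropy_density hf f0).
have mlf : measurable_fun setT (fun x => lne (f x)%:E).
  by apply: (measurableT_comp (@measurable_lne R)); exact/measurable_EFinP.
rewrite (integral_image mphi Qp mlf).
have mfp : measurable_fun setT (fun x => f (phi x)) by exact: measurableT_comp.
have meN : measurable_fun setT (fun x => expR (- G x)).
  by apply: (measurableT_comp (@measurable_expR R)); exact: measurableT_comp.
have mfe : measurable_fun setT (fun x => (f (phi x) * expR (- G x))%:E).
  by apply/measurable_EFinP; exact: measurable_funM.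
have fe1 : \int[p]_x (f (phi x) * expR (- G x))%:E = 1.
  rewrite (density_integral hp)//.
  rewrite -[RHS](proj2 (density_integrable1 hf f0)).
  have mef : measurable_fun setT (EFin \o f) by exact/measurable_EFinP.
  apply/esym; apply: (etrans (integral_image mphi PP0 mef)).
  by apply: eq_integral => x _; rewrite -EFinM -mulrA -expRD addNr expR0 mulr1.
have ife : p.-integrable setT (fun x => (f (phi x) * expR (- G x))%:E).
  apply: ge0_integrable => //; last by rewrite fe1 ltry.
  by move=> x; rewrite lee_fin mulr_ge0// expR_ge0.
have iGf : p.-integrable setT (fun x => (G x)%:E + (f (phi x) * expR (- G x))%:E).
  exact: integrableD.
have i1 : p.-integrable setT (fun _ => 1%E) by exact: finite_measure_integrable_cst.
apply: (@le_trans _ _ (\int[p]_x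
    ((G x)%:E + (f (phi x) * expR (- G x))%:E - 1))); last first.
  by rewrite integralB// integralD// fe1 probability_integral_cst addeK.
apply: ae_le_integral.
- exact: (measurableT_comp mlf mphi).
- by apply: (measurable_int p); exact: integrableB.
- by apply: aeW => x; exact: lne_le_expRN.
Qed.

(** * The variational problem *)

Lemma coupling_product (R : realType) d1 d2 (T1 : measurableType d1)
    (T2 : measurableType d2) (alpha : probability T1 R) (beta : probability T2 R) :
  coupling alpha beta (alpha \x beta).
Proof.
split=> A mA.
- have -> : fst @^-1` A = A `*` [set: T2].
    by apply/seteqP; split=> [z ?|z []].
  apply: (etrans (product_measure1E alpha beta mA measurableT)).
  by rewrite [X in _ * X]probability_setT mule1.
- have -> : snd @^-1` A = [set: T1] `*` A.
    by apply/seteqP; split=> [z ?|z []].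
  apply: (etrans (product_measure1E alpha beta measurableT mA)).
  by rewrite [X in X * _]probability_setT mul1e.
Qed.

(** Identifies the image of the reference measure when the middle variable of a triple (xbar, x, y)
    is dropped. *)
Lemma coupling_product_fst (R : realType) d1 d2 d3 (T1 : measurableType d1)
    (T2 : measurableType d2) (T3 : measurableType d3)
    (alpha : probability T1 R) (beta : probability T2 R)
    (nu : probability T3 R) (q : probability (T1 * T2)%type R) A :
  coupling alpha beta q -> measurable A ->
  (alpha \x nu) A = (q \x nu) ((fun z : (T1 * T2) * T3 => (z.1.1, z.2)) @^-1` A).
Proof.
move=> cq mA; rewrite /product_measure1 /=.
transitivity (\int[alpha]_x nu (xsection A x)); first by [].
rewrite -(coupling_integral_fst (F := fun x => nu (xsection A x)) cq); last first.
  exact: measurable_fun_xsection.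
by apply: eq_integral => z _ /=; rewrite !xsectionE.
Qed.

(** In the law [p] of (xbar, x, y), y depends on the pair only through x. Dropping xbar gives [m],
    so functions of (x, y) may be integrated against either. *)
Lemma glue_image (R : realType) (n : nat) (mu nu mubar : probability 'rV[R]_n R)
    (a b : R) (psi : 'rV[R]_n -> R) (h : 'rV[R]_n -> 'rV[R]_n)
    (q m : probability ('rV[R]_n * 'rV[R]_n)%type R)
    (p : probability (('rV[R]_n * 'rV[R]_n) * 'rV[R]_n)%type R) :
  exp_moments nu -> (0 <= b)%R -> grows nu a b psi -> measurable_fun setT h ->
  coupling mubar mu q ->
  has_density p (q \x nu) (fun z => tilt nu psi (h z.1.2) z.2) ->
  has_density m (mu \x nu) (fun z => tilt nu psi (h z.1) z.2) ->
  forall A, measurable A -> m A = p ((fun z => (z.1.2, z.2)) @^-1` A).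
Proof.
move=> H1 b0 gp mh cq hp hm A mA.
have mh2 : measurable_fun setT (fun w : 'rV[R]_n * 'rV[R]_n => h w.2).
  exact: measurableT_comp.
have [kq hkq] := tilt_kernel H1 b0 gp mh2.
have [km hkm] := tilt_kernel H1 b0 gp mh.
have mphi : measurable_fun setT
    (fun z : ('rV[R]_n * 'rV[R]_n) * 'rV[R]_n => (z.1.2, z.2)).
  by apply: measurable_fun_pair => //; exact: measurableT_comp.
rewrite (tilt_joint_disintegrates (proj1 gp) mh2 hp (fun x B _ => hkq x B)).
  rewrite (tilt_joint_disintegrates (proj1 gp) mh hm (fun x B _ => hkm x B))//.
  rewrite -(coupling_integral_snd (F := fun x => km x (xsection A x)) cq).
    by apply: eq_integral => w _; rewrite hkq hkm !xsectionE.
  by apply: measurable_fun_xsection_finite_kernel; rewrite inE.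
by rewrite -[X in measurable X]setTI; exact: mphi.
Qed.

(** [q'] is the law of (xbar, y) under the gluing. Dropping x does not raise the entropy, and the
    martingale property keeps the pairing, so the two pairings cancel and only the entropy
    remains. *)
Lemma SP_competitor (R : realType) (n : nat)
    (mu nu mubar : probability 'rV[R]_n R)
    (a b : R) (psi : 'rV[R]_n -> R) (h : 'rV[R]_n -> 'rV[R]_n)
    (q m : probability ('rV[R]_n * 'rV[R]_n)%type R) :
  exp_moments nu -> (0 <= b)%R -> grows nu a b psi -> measurable_fun setT h ->
  dual_value mu nu \is a fin_num ->
  dual_objective mu nu psi = dual_value mu nu ->
  {ae mu, forall x, inner_solution nu psi x (h x)} ->
  finite_second_moment mu -> finite_second_moment nu ->
  finite_second_moment mubar -> coupling mubar mu q ->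
  martingale_coupling mu nu m ->
  has_density m (mu \x nu) (fun z => tilt nu psi (h z.1) z.2) ->
  exists2 q', coupling mubar nu q' &
    SP_objective mubar nu q' + \int[q]_z (dotp z.1 z.2)%:E <=
      dual_objective mu nu psi.
Proof.
move=> H1 b0 gp mh Vfin DV sol m2 n2 mb2 cq mm hm.
have Dfin : dual_objective mu nu psi \is a fin_num by rewrite DV.
have mh2 : measurable_fun setT (fun w : 'rV[R]_n * 'rV[R]_n => h w.2).
  exact: measurableT_comp.
have [kq hkq] := tilt_kernel H1 b0 gp mh2.
have [km hkm] := tilt_kernel H1 b0 gp mh.
have [p hp] := tilt_joint q H1 b0 gp mh2.
have dp := tilt_joint_disintegrates (proj1 gp) mh2 hp (fun x B _ => hkq x B).
pose phi1 (z : ('rV[R]_n * 'rV[R]_n) * 'rV[R]_n) := (z.1.1, z.2).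
pose phi2 (z : ('rV[R]_n * 'rV[R]_n) * 'rV[R]_n) := (z.1.2, z.2).
have mphi1 : measurable_fun setT phi1.
  by apply: measurable_fun_pair => //; exact: measurableT_comp.
have mphi2 : measurable_fun setT phi2.
  by apply: measurable_fun_pair => //; exact: measurableT_comp.
have mE := glue_image H1 b0 gp mh cq hp hm.
have [q' q'E] := pushforward_probability p mphi1.
have cq' : coupling mubar nu q'.
  split=> A mA.
    rewrite q'E -(proj1 cq A mA).
    have mA' : measurable (fst @^-1` A : set ('rV[R]_n * 'rV[R]_n)).
      by rewrite -[X in measurable X]setTI; exact: measurable_fst.
    by rewrite -(disintegrates_fst dp mA').
  rewrite q'E; apply: (etrans (disintegrates_snd dp mA)).
  rewrite -(tilt_marginal H1 b0 gp Vfin DV sol (fun x B _ => hkm x B) mA).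
  rewrite -(coupling_integral_snd (F := fun x => km x A) cq).
    by apply: eq_integral => w _; rewrite hkq hkm.
  exact: measurable_kernel.
exists q' => //.
have [ig gle] := primal_le H1 b0 gp mh Dfin sol mm hm.
have mg := measurable_tilt_exponent nu (proj1 gp) mh.
have mgE : measurable_fun setT (EFin \o tilt_exponent nu psi h).
  exact/measurable_EFinP.
(* The log-density of the glued law is a function of (x, y), so its integral is the one already
   bounded for [m]. *)
have ent : rel_entropy q' (mubar \x nu) <= dual_objective mu nu psi.
  apply: le_trans gle; rewrite (integral_image mphi2 mE mgE).
  apply: (rel_entropy_image_le (P0 := (q \x nu)%E) mphi1 (fun A _ => q'E A)).
  - by move=> A mA; exact: (coupling_product_fst nu cq mA).
  - exact: measurableT_comp.
  - rewrite (_ : (fun x => _) = fun z => tilt nu psi (h z.1.2) z.2)//.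
    by apply/funext => z; rewrite -(tilt_expR h (z.1.2, z.2) H1 b0 gp).
  - exact: (integrable_image mphi2 mE ig).
have id' := coupling_dotp_integrable mb2 n2 cq'.
(* Given (xbar, x), the variable y has mean x, so xbar.y averages to xbar.x. *)
have dE : \int[q']_z (dotp z.1 z.2)%:E = \int[q]_z (dotp z.1 z.2)%:E.
  have q'E' A : measurable A -> q' A = p (phi1 @^-1` A) by move=> _; exact: q'E.
  rewrite (integral_image mphi1 q'E' (measurable_int _ id')).
  apply: (disintegrates_integral_ae dp (integrable_image mphi1 q'E' id')).
    by apply/measurable_EFinP; exact: measurable_dotp.
  have bar := tilt_barycenter_ae H1 b0 gp sol (fun x B _ => hkm x B).
  apply: filterS (coupling_ae_snd cq bar) => w barw.
  have := @barycenter_dotp _ _ (kq w) w.1 w.2; case=> // i; rewrite -barw.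
  by apply: eq_measure_integral => A _ _; apply: (etrans (hkq w A)); rewrite hkm.
rewrite /SP_objective dE subeK//.
exact: integrable_fin_num (coupling_dotp_integrable mb2 m2 cq).
Qed.

(** The bound for each coupling passes to the supremum defining [MCov] once the value of SP is real,
    whence the case distinction. *)
Lemma VP_le (R : realType) (n : nat)
    (mu nu mubar : probability 'rV[R]_n R) (V : \bar R) :
  V \is a fin_num ->
  finite_second_moment mubar -> finite_second_moment mu ->
  (forall q, coupling mubar mu q -> exists2 q', coupling mubar nu q' &
    SP_objective mubar nu q' + \int[q]_z (dotp z.1 z.2)%:E <= V) ->
  SP_value mubar nu + MCov mubar mu <= V.
Proof.
move=> Vfin mb2 m2 H.
have dfin q : coupling mubar mu q -> \int[q]_z (dotp z.1 z.2)%:E \is a fin_num.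
  by move=> cq; exact: integrable_fin_num (coupling_dotp_integrable mb2 m2 cq).
have le q : coupling mubar mu q ->
    SP_value mubar nu + \int[q]_z (dotp z.1 z.2)%:E <= V.
  move=> cq; have [q' cq' le] := H q cq; apply: le_trans le.
  by apply: leeD2r; apply: ereal_inf_lbound; exists q'.
(* A coupling exists, so the value +oo for SP would contradict the finiteness of [V]. *)
have c0 := coupling_product mubar mu.
case SE : (SP_value mubar nu) le => [s| |] le; last by rewrite addNye leNye.
- rewrite -leeBrDl//; apply: ge_ereal_sup => _ [q cq <-].
  by rewrite leeBrDl//; exact: le.
- by have := le _ c0; rewrite addye ?leye_eq; last (by case: (\int[_]_z _) (dfin _ c0));
    move=> /eqP VE; rewrite VE in Vfin.
Qed.

(** The law of (h(x), x) couples [mubar] with [mu]; its pairing added to the level of SP recombines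
    into D(psi), so the upper bound for competitors is reached. *)
Lemma tilt_solves_VP (R : realType) (n : nat)
    (mu nu : probability 'rV[R]_n R)
    (a b : R) (psi : 'rV[R]_n -> R) (h : {mfun 'rV[R]_n >-> 'rV[R]_n})
    (m p : probability ('rV[R]_n * 'rV[R]_n)%type R) :
  exp_moments nu -> (0 <= b)%R -> grows nu a b psi ->
  dual_value mu nu \is a fin_num ->
  dual_objective mu nu psi = dual_value mu nu ->
  {ae mu, forall x, inner_solution nu psi x (h x)} ->
  finite_second_moment mu -> finite_second_moment nu ->
  finite_second_moment (distribution mu h) ->
  martingale_coupling mu nu m ->
  has_density m (mu \x nu) (fun z => tilt nu psi (h z.1) z.2) ->
  has_density p (distribution mu h \x nu) (fun z => tilt nu psi z.1 z.2) ->
  [/\ solves_VP mu nu (distribution mu h), solves_SP (distribution mu h) nu p &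
      schrodinger_potentials (distribution mu h) nu
        (fun x => - ln (\int[nu]_y expR (psi y + dotp x y)))%R psi].
Proof.
move=> H1 b0 gp Vfin DV sol m2 n2 mb2 mm hm hp.
have Dfin : dual_objective mu nu psi \is a fin_num by rewrite DV.
have mh : measurable_fun setT h by exact: measurable_funPT.
have [iI DE] := inner_sup_value H1 b0 gp mh Dfin sol.
have mgr : measurable_fun setT (fun x => (h x, x)) by exact: measurable_fun_pair.
have [q qE] := pushforward_probability mu mgr.
have cq : coupling (distribution mu h) mu q by split=> A mA; rewrite qE.
have id_ := coupling_dotp_integrable mb2 m2 cq.
have qE' A : measurable A -> q A = mu ((fun x => (h x, x)) @^-1` A).
  by move=> _; exact: qE.
have idh : mu.-integrable setT (fun x => (dotp (h x) x)%:E).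
  exact: (integrable_image mgr qE' id_).
have dE : \int[q]_z (dotp z.1 z.2)%:E = \int[mu]_x (dotp (h x) x)%:E.
  exact: (integral_image mgr qE' (measurable_int _ id_)).
have mL : measurable_fun setT (fun k => (ln (laplace nu psi k))%:E).
  apply/measurable_EFinP.
  exact: (measurable_ln_laplace nu (proj1 gp) (@measurable_id _ _ setT)).
(* With second moments h(x).x is integrable, so L(h(x)) is too, as its difference with the
   integrable inner value. *)
have iLh : mu.-integrable setT (fun x => (ln (laplace nu psi (h x)))%:E).
  have : mu.-integrable setT
      (fun x => (dotp (h x) x)%:E - (inner_value nu psi h x)%:E).
    exact: integrableB.
  apply: eq_integrable => // x _; rewrite -EFinB /inner_value opprB addrC.
  by rewrite subrK.
have iL := integrable_distributionT mL iLh.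
have cp := tilt_coupling H1 b0 gp Vfin DV sol hp.
have [SE sp pot] := SP_tilt H1 b0 gp mb2 n2 iL cp hp.
have VE : dual_objective mu nu psi =
    SP_level (distribution mu h) nu psi + \int[q]_z (dotp z.1 z.2)%:E.
  rewrite DE.
  have -> : \int[mu]_x (inner_value nu psi h x)%:E =
      - (\int[mu]_x (ln (laplace nu psi (h x)))%:E) +
      \int[mu]_x (dotp (h x) x)%:E.
    by rewrite addeC; exact: (integralB measurableT idh iLh).
  rewrite dE /SP_level (integral_distributionT mu h mL).
  exact: addeA.
split=> //; split=> // mubar mb2'.
apply: (@le_trans _ _ (dual_objective mu nu psi)); last first.
  by rewrite VE SE leeD2l//; apply: ereal_sup_ubound; exists q.
apply: VP_le => // q' cq'.
exact: (SP_competitor H1 b0 gp mh Vfin DV sol m2 n2 mb2' cq' mm hm).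
Qed.

(** (H4) determines [h] only up to a mu-null set, so the conclusion is stated for every measurable
    version, after the existence of one. The claims on (VP) and SP assume that [mubar] has a finite
    second moment: this is feasibility in (VP) and makes the pairing integrable. *)
Theorem proposition3p8 (R : realType) (d : nat)
    (mu nu : probability 'rV[R]_d R) (psi : 'rV[R]_d -> R)
    (mu2 : finite_second_moment mu) (nu2 : finite_second_moment nu)
    (mu_le_nu : convex_order mu nu)
    (H1 : forall q : R, (0 <= q)%R ->
      \int[nu]_y (expR (q * enorm y))%:E < +oo)
    (H2 : forall (a : 'rV[R]_d) (c : R), a != 0%R ->
      ~ concentrated_on nu (hyperplane a c))
    (H3_finite : dual_value mu nu \is a fin_num)
    (H3_attained : dual_objective mu nu psi = dual_value mu nu)
    (H3_integrable : nu.-integrable setT (EFin \o psi))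
    (H3_growth : exists a b : R, [/\ (0 <= a)%R, (0 <= b)%R &
      {ae nu, forall y, (`|psi y| <= a + b * enorm y)%R}])
    (H4 : {ae mu, forall x, exists! h, inner_solution nu psi x h}) :
  (exists h : {mfun 'rV[R]_d >-> 'rV[R]_d},
    {ae mu, forall x, inner_solution nu psi x (h x)}) /\
  forall h : {mfun 'rV[R]_d >-> 'rV[R]_d},
    {ae mu, forall x, inner_solution nu psi x (h x)} ->
  let mubar : probability 'rV[R]_d R := distribution mu h in
  let phibar (xbar : 'rV[R]_d) : R :=
    (- ln (\int[nu]_y expR (psi y + dotp xbar y)))%R in
  exists (m pi : probability ('rV[R]_d * 'rV[R]_d)%type R)
         (kappa : R.-pker 'rV[R]_d ~> 'rV[R]_d),
    [/\ disintegrates mu kappa m,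
        forall x A, measurable A -> kappa x A =
          \int[nu]_(y in A)
            (expR (dotp (h x) y + psi y) /
             \int[nu]_y' expR (dotp (h x) y' + psi y'))%R%:E,
        has_density pi (mubar \x nu) (schrodinger_density phibar psi),
        [/\ coupling mubar nu pi,
            schrodinger_system mubar nu phibar psi &
            (finite_second_moment mubar ->
              [/\ solves_VP mu nu mubar, solves_SP mubar nu pi &
                  schrodinger_potentials mubar nu phibar psi])] &
        solves_P mu nu m].
Proof.
have [a [b [a0 b0 gpsi]]] := H3_growth.
have gp : grows nu a b psi.
  by split=> //; apply/measurable_EFinP; exact: measurable_int H3_integrable.
have Dfin : dual_objective mu nu psi \is a fin_num by rewrite H3_attained.
split; first exact: (measurable_inner_solution H1 b0 gp H4).
move=> h sol mubar phibar.
have mh : measurable_fun setT h by exact: measurable_funPT.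
have [kappa hk] := tilt_kernel H1 b0 gp mh.
have hk' x A : measurable A ->
    kappa x A = \int[nu]_(y in A) (tilt nu psi (h x) y)%:E by move=> _; exact: hk.
(* [m] and [pi] come from one construction, with the map [h] over [mu] and the identity over
   [mubar]. *)
have [m hm] := tilt_joint mu H1 b0 gp mh.
have [pi hpi] := tilt_joint mubar H1 b0 gp (@measurable_id _ 'rV[R]_d setT).
have dm := tilt_joint_disintegrates (proj1 gp) mh hm hk'.
have mm := tilt_martingale H1 b0 gp H3_finite H3_attained sol hk' dm.
exists m, pi, kappa; split=> //.
- by rewrite /phibar (schrodinger_density_tilt H1 b0 gp).
- split.
  + exact: (tilt_coupling H1 b0 gp H3_finite H3_attained sol hpi).
  + exact: (tilt_schrodinger_system H1 b0 gp H3_finite H3_attained sol).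
  + move=> mb2.
    exact: (tilt_solves_VP H1 b0 gp H3_finite H3_attained sol mu2 nu2 mb2 mm hm hpi).
- exact: (tilt_solves_P H1 b0 gp mh Dfin sol mm hm).
Qed.
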